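(* Let $\mu$ be a finite, non-null, symmetric Borel measure on $\mathbb{R}$ such that $$\int_{-\infty}^\infty x^2\,\mu(dx)<\infty \quad\text{and}\quad \mu\left(\mathbb{R}\setminus\{0\}\right)>0 .$$ Let $R(t)=\int_{-\infty}^\infty e^{itx}\,\mu(dx)$ for $t\in\mathbb{R}$, and assume that for some $\varepsilon>0$, $R(t)=R(0)+O(|t|^\varepsilon)$, $t\in\mathbb{R}$. Let $(X_t:t\in\mathbb{R})$ be a zero mean stationary Gaussian process with continuous sample paths and $\mathrm{E}(X_sX_t)=R(s-t)$ for all $s,t\in\mathbb{R}$. For $u>0$ let $$\tau_u^+=\inf\{t\ge 0:X_t\le u\},\qquad \tau_u^-=\sup\{t\le 0:X_t\le u\}.$$ Then, as $u\to\infty$, conditionally on the event $[X_0>u]$, $$u\left(\tau_u^+-\tau_u^-\right)\Rightarrow 2\,\frac{R(0)}{\sqrt{-R''(0)}}\,\sqrt{Z^2+2T^*},$$ where $Z$ is a standard normal random variable, $T^*$ is a standard exponential random variable (mean $1$), and $Z$ and $T^*$ are independent.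
   Context: A measure $\mu$ on $\mathbb{R}$ is symmetric if $\mu(-A)=\mu(A)$ for every Borel set $A$, where $-A=\{x\in\mathbb{R}:-x\in A\}$; finite and non-null means $0<\mu(\mathbb{R})<\infty$. By symmetry $R$ is real-valued. Finiteness of the second moment of $\mu$ makes $R$ a $C^2$ function, with $R'(0)=0>R''(0)$ (the strict inequality uses $\mu(\mathbb{R}\setminus\{0\})>0$). The condition $R(t)=R(0)+O(|t|^\varepsilon)$ means that there is a constant $C<\infty$ with $|R(t)-R(0)|\le C|t|^\varepsilon$ for all $t\in\mathbb{R}$. Conventions: $\inf\emptyset=\infty$ and $\sup\emptyset=-\infty$. The statement ''$W_u\Rightarrow W$ conditionally on $[X_0>u]$ as $u\to\infty$'' means that the conditional laws $P(W_u\in\cdot\mid X_0>u)$ converge weakly, as $u\to\infty$, to the law of $W$. *)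

(* Defs.v *)
From HB Require Import structures.
From mathcomp Require Import all_boot all_order all_algebra.
From mathcomp Require Import all_classical all_reals all_analysis.
From mathcomp Require Import measurable_realfun.
From mathcomp.real_closed Require Import complex.
Import Order.TTheory GRing.Theory Num.Theory.
Import numFieldNormedType.Exports.

Set Implicit Arguments.
Unset Strict Implicit.
Unset Printing Implicit Defensive.

Local Open Scope classical_set_scope.
Local Open Scope ring_scope.
Local Open Scope complex_scope.

Section laws.
Context {R : realType}.

Definition same_law d (T : measurableType d) (nu1 nu2 : set T -> \bar R) : Prop :=
  forall A, measurable A -> nu1 A = nu2 A.

(* [normal_prob m s] is a normal law only for [s != 0]: its density at [s = 0]
   is a junk value, so the degenerate normal law is spelled out. *)
Definition gaussian_law (nu : set R -> \bar R) : Prop :=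
  exists m s : R, 0 <= s /\
    same_law nu (if s == 0 then \d_m : set R -> \bar R else normal_prob m s).

(* Only used for [P B > 0]. *)
Definition conditional d (T : measurableType d) (P : set T -> \bar R)
    (B : set T) : set T -> \bar R :=
  fun A => (P (A `&` B) / P B)%E.

Definition independent d (T : measurableType d) (P : probability T R)
    (Y Z : {RV P >-> R}) : Prop :=
  forall A B : set R, measurable A -> measurable B ->
    P (Y @^-1` A `&` Z @^-1` B) = (P (Y @^-1` A) * P (Z @^-1` B))%E.

(* Weak convergence of laws on the extended line, which is needed because
   the hitting times below may be infinite. *)
Definition cvg_weakly (I : Type) (F : set_system I)
    (nu_ : I -> set (\bar R) -> \bar R) (nu : set (\bar R) -> \bar R) : Prop :=
  forall f : \bar R -> R, continuous f -> bounded_fun f ->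
    (\int[nu_ i]_x (f x)%:E)%E @[i --> F] --> (\int[nu]_x (f x)%:E)%E.

End laws.

Section spectral.
Context {R : realType}.
Implicit Types (mu : {measure set R -> \bar R}) (t x : R).

Definition symmetric_measure mu : Prop :=
  forall A : set R, measurable A -> mu [set x : R | A (- x)] = mu A.

Definition expi x : R[i] := cos x +i* sin x.

Definition complex_integral mu (f : R -> R[i]) : R[i] :=
  (\int[mu]_x complex.Re (f x)) +i* (\int[mu]_x complex.Im (f x)).

Definition fourier mu t : R[i] := complex_integral mu (fun x => expi (t * x)).

End spectral.

Section processes.
Context {R : realType} d (Omega : measurableType d) (P : probability Omega R).
Implicit Types X : R -> {RV P >-> R}.

Definition gaussian_process X : Prop :=
  forall n (t a : n.-tuple R),
    gaussian_law
      (pushforward P (fun w => \sum_(i < n) tnth a i * X (tnth t i) w)).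

Definition fdd X n (t : n.-tuple R) : set (n.-tuple R) -> \bar R :=
  pushforward P (fun w => [tuple X (tnth t i) w | i < n]).

Definition stationary X : Prop :=
  forall n (t : n.-tuple R) (h : R),
    same_law (fdd X [tuple tnth t i + h | i < n]) (fdd X t).

Definition continuous_paths X : Prop :=
  forall w, continuous (fun t => X t w).

Definition tau_plus X (u : R) (w : Omega) : \bar R :=
  ereal_inf [set t%:E | t in [set t | 0 <= t /\ X t w <= u]].

Definition tau_minus X (u : R) (w : Omega) : \bar R :=
  ereal_sup [set t%:E | t in [set t | t <= 0 /\ X t w <= u]].

End processes.

(* Main.v *)
(* Write r for the covariance R and sg2 = - r''(0), c = sg2 / (2 r(0)), and split
   X_t = (r(t) / r(0)) X_0 + Y_t, where Y is independent of X_0.  At the time scale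
   1/u, put x = u (X_0 - u) and v = u Y_(1/u).  Uniformly for |t| <= K,

     u (X_(t/u) - u) = x + t v - c t^2 + o(1)   on [X_0 > u],

   so u (tau^+ - tau^-) is close to the distance sqrt (v^2 + 4 c x) / c between the
   roots of the parabola.  Given X_0 > u, the pair (x, v) converges in law to
   (r(0) T, sqrt sg2 Z), which gives the limit.  The o(1) is the deviation of
   t |-> u Y_(t/u) from linearity: by the spectral isometry its increments have
   L^1 norm at most kappa |b - a| with kappa -> 0, and by independence the same
   bound holds conditionally on X_0 > u. *)

Require Import Defs.
From HB Require Import structures.
From mathcomp Require Import all_boot all_order all_algebra.
From mathcomp Require Import all_classical all_reals all_analysis.
From mathcomp Require Import measurable_realfun.
From mathcomp.real_closed Require Import complex.
From mathcomp Require Import ring lra.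
Import Order.TTheory GRing.Theory Num.Theory.
Import numFieldNormedType.Exports.

Set Implicit Arguments.
Unset Strict Implicit.
Unset Printing Implicit Defensive.

Local Open Scope classical_set_scope.
Local Open Scope ring_scope.
Local Open Scope complex_scope.

(** * Trigonometric polynomials and independence *)

(** [gaussian_process] only gives the laws of single linear combinations, so the independence of X_0
    and Y is extracted from characteristic functions. Their uniqueness theorem is obtained by
    reaching the indicator of a half-line through two successive bounded limits of trigonometric
    polynomials.

    A truncated moment m(h), tending to 0 with h, takes its place both in the expansion of r and in
    the L^2 norm of the increments.

    The limit of (x, v) needs no asymptotics of the normal tail: one substitution in the Gaussian
    density produces the exponential density exactly, times a constant that cancels in conditional
    means and a weight in [0, 1] that tends to 1.

    The parabola describes the hitting times well only if x stays away from 0 and (x, v) stays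
    bounded. A continuous cutoff in (x, v) confines the comparison to such a region, and the mass it
    loses is controlled by applying the convergence of (x, v) to the cutoff itself. *)

Section Rintegral_lemmas.
Context {R : realType} d (T : measurableType d).

Lemma le_bounded_integrable (mu : {finite_measure set T -> \bar R})
    (f : T -> R) (M : R) :
  measurable_fun setT f -> (forall x, `|f x| <= M) ->
  mu.-integrable setT (EFin \o f).
Proof.
move=> mf fM; apply: (@le_integrable _ _ _ mu _ measurableT _ (cst M%:E)).
- exact/measurable_EFinP.
- by move=> x _ /=; rewrite lee_fin (le_trans (fM x))// ler_norm.
- exact: finite_measure_integrable_cst.
Qed.

Lemma le_norm_integrable (mu : {measure set T -> \bar R}) (f g : T -> R) :
  measurable_fun setT f -> (forall x, `|f x| <= g x) ->
  mu.-integrable setT (EFin \o g) -> mu.-integrable setT (EFin \o f).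
Proof.
move=> mf fg; apply: le_integrable => //; first exact/measurable_EFinP.
by move=> x _ /=; rewrite lee_fin (le_trans (fg x))// ler_norm.
Qed.

Lemma dominated_cvg_Rintegral (mu : {measure set T -> \bar R})
    (f_ : nat -> T -> R) (f g : T -> R) :
  (forall n, measurable_fun setT (f_ n)) ->
  (forall x, f_ n x @[n --> \oo] --> f x) ->
  (forall n x, `|f_ n x| <= g x) -> mu.-integrable setT (EFin \o g) ->
  \int[mu]_x f_ n x @[n --> \oo] --> \int[mu]_x f x.
Proof.
move=> mf_ ff fg ig.
have mf : measurable_fun setT f.
  by apply: (measurable_fun_cvg mf_) => x _; exact: ff.
have ff' x : [set: T] x -> (EFin \o f_ n) x @[n --> \oo] --> (EFin \o f) x.
  by move=> _; apply: cvg_EFin; [exact: nearW|exact: ff].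
have [i1 _ i2] := @dominated_convergence _ T R mu setT measurableT
  (fun n => EFin \o f_ n) (EFin \o f) (EFin \o g)
  (fun n => (measurable_EFinP _ _).2 (mf_ n)) ((measurable_EFinP _ _).2 mf)
  (aeW _ ff') ig (aeW _ (fun x n _ => fg n x)).
by apply: fine_cvg; rewrite fineK// integrable_fin_num.
Qed.

End Rintegral_lemmas.

Lemma measurable_cos {R : realType} : measurable_fun setT (@cos R).
Proof. by apply: continuous_measurable_fun; exact: continuous_cos. Qed.

Lemma measurable_sin {R : realType} : measurable_fun setT (@sin R).
Proof. by apply: continuous_measurable_fun; exact: continuous_sin. Qed.

Section sign_approximation.
Context {R : realType}.
Implicit Types x y : R.

(* [y |-> (3y - y^3)/2] maps [-1, 1] to itself, with attracting fixed points
   -1 and 1, so its iterates converge to the sign function. *)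
Definition sharpen y : R := (3 * y - y ^+ 3) / 2.

Lemma sharpenN y : sharpen (- y) = - sharpen y.
Proof. rewrite /sharpen; ring. Qed.

Lemma iter_sharpenN n y : iter n sharpen (- y) = - iter n sharpen y.
Proof. by elim: n => //= n ->; rewrite sharpenN. Qed.

Lemma sharpen_ge y : 0 <= y <= 1 -> y <= sharpen y <= 1.
Proof.
move=> /andP[y0 y1]; rewrite /sharpen; apply/andP; split; rewrite -subr_ge0.
  have -> : (3 * y - y ^+ 3) / 2 - y = y * (1 - y) * (1 + y) / 2 by field.
  by rewrite !mulr_ge0//; lra.
have -> : 1 - (3 * y - y ^+ 3) / 2 = (1 - y) ^+ 2 * (2 + y) / 2 by field.
by rewrite !mulr_ge0// ?sqr_ge0//; lra.
Qed.

Lemma iter_sharpen_ge n y : 0 <= y <= 1 -> y <= iter n sharpen y <= 1.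
Proof.
move=> y01; elim: n => [|n /andP[yn n1]]/=; first by rewrite lexx; case/andP: y01.
have /sharpen_ge/andP[h1 h2] : 0 <= iter n sharpen y <= 1.
  by rewrite n1 andbT (le_trans _ yn)//; case/andP: y01.
by rewrite (le_trans yn h1).
Qed.

(** For an iterate z, [1 - sharpen z = (1 - z) * (1 - z / 2 - z^2 / 2)]. As the iterates never fall
    below y, each step contracts the distance to 1 by at least the factor [1 - y / 2]. *)
Lemma iter_sharpen_near1 n y : 0 <= y <= 1 ->
  1 - iter n sharpen y <= (1 - y / 2) ^+ n.
Proof.
move=> y01; have /andP[y0 y1] := y01.
elim: n => [|n IH]; first by rewrite expr0 /=; lra.
have /andP[a b] := iter_sharpen_ge n y01.
move: IH a b; rewrite exprS iterS; set z := iter n sharpen y => IH a b.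
have -> : 1 - sharpen z = (1 - z) * ((1 - z) * (2 + z) / 2) by rewrite /sharpen; field.
rewrite mulrC ler_pM//; [|lra|].
  by rewrite !mulr_ge0//; lra.
have : 0 <= z ^+ 2 by exact: sqr_ge0.
by rewrite expr2; lra.
Qed.

Lemma norm_iter_sharpen n y : `|y| <= 1 -> `|iter n sharpen y| <= 1.
Proof.
wlog y0 : y / 0 <= y => [hw|].
  have [/hw//|y0] := leP 0 y.
  by have := hw (- y); rewrite iter_sharpenN !normrN; apply; lra.
rewrite ger0_norm// => y1.
have /(iter_sharpen_ge n)/andP[a b] : 0 <= y <= 1 by rewrite y0.
by rewrite ger0_norm// (le_trans y0 a).
Qed.

Lemma iter_sharpen_cvg y : `|y| <= 1 ->
  iter n sharpen y @[n --> \oo] --> Num.sg y.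
Proof.
wlog y0 : y / 0 <= y => [hw|].
  have [/hw//|y0 y1] := leP 0 y.
  have := hw (- y); rewrite normrN oppr_ge0 sgrN => /(_ (ltW y0) y1).
  have -> : (fun n => iter n sharpen y) = - (fun n => iter n sharpen (- y)).
    by apply/funext => n; rewrite !fctE iter_sharpenN opprK.
  by rewrite -[X in _ -> _ --> X]opprK => /cvgN.
rewrite ger0_norm// => y1.
move: y0; rewrite le_eqVlt => /predU1P[<-|y0].
  rewrite sgr0 (_ : (fun n => _) = cst 0); first exact: cvg_cst.
  apply/funext; elim => //= n ->; rewrite /sharpen expr0n/=; ring.
rewrite gtr0_sg//.
apply: (@squeeze_cvgr _ _ _ _ (fun n => 1 - (1 - y / 2) ^+ n) (cst 1)).
- apply: nearW => n.
  have y01 : 0 <= y <= 1 by rewrite (ltW y0).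
  have := iter_sharpen_near1 n y01; have /andP[_ ->] := iter_sharpen_ge n y01.
  by rewrite andbT; lra.
- rewrite -[X in _ --> X]subr0; apply: cvgB; first exact: cvg_cst.
  by apply: cvg_expr; rewrite ger0_norm; lra.
- exact: cvg_cst.
Qed.

End sign_approximation.

Section trig_polynomials.
Context {R : realType}.

(** Frequencies are arbitrary reals, not multiples of a common one. The phase b lets one constructor
    cover sines, translations and constants. *)
Inductive trig_poly : (R -> R) -> Prop :=
| trig_cos c a b : trig_poly (fun x => c * cos (a * x + b))
| trig_add f g : trig_poly f -> trig_poly g -> trig_poly (fun x => f x + g x).

Lemma eq_trig_poly f g : f =1 g -> trig_poly f -> trig_poly g.
Proof. by move=> /funext ->. Qed.

Lemma trig_cst c : trig_poly (fun=> c).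
Proof.
by apply: eq_trig_poly (trig_cos c 0 0) => x; rewrite mul0r addr0 cos0 mulr1.
Qed.

Lemma trig_sin a b : trig_poly (fun x => sin (a * x + b)).
Proof.
apply: eq_trig_poly (trig_cos 1 a (b - pi / 2)) => x.
by rewrite mul1r addrA cosBpihalf.
Qed.

(** Product-to-sum formula. Closure under products is what allows the cubic [sharpen] to be iterated
    inside the class. *)
Lemma trig_mul f g : trig_poly f -> trig_poly g -> trig_poly (fun x => f x * g x).
Proof.
elim=> [c a b|f1 f2 _ IH1 _ IH2 /[dup] /IH1 h1 /IH2 h2]; last first.
  by apply: eq_trig_poly (trig_add h1 h2) => x; rewrite mulrDl.
elim=> [c' a' b'|g1 g2 _ IH1 _ IH2]; last first.
  by apply: eq_trig_poly (trig_add IH1 IH2) => x; rewrite mulrDr.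
apply: eq_trig_poly (trig_add (trig_cos (c * c' / 2) (a + a') (b + b'))
   (trig_cos (c * c' / 2) (a - a') (b - b'))) => x.
have -> : (a + a') * x + (b + b') = (a * x + b) + (a' * x + b') by ring.
have -> : (a - a') * x + (b - b') = (a * x + b) - (a' * x + b') by ring.
by rewrite cosD cosB; field.
Qed.

Lemma trig_iter_sharpen n f : trig_poly f ->
  trig_poly (fun x => iter n sharpen (f x)).
Proof.
move=> tf; elim: n => //= n IH.
have h := trig_add (trig_mul (trig_cst (3 / 2)) IH)
  (trig_mul (trig_cst (- (1 / 2))) (trig_mul IH (trig_mul IH IH))).
by apply: eq_trig_poly h => x; rewrite /sharpen; field.
Qed.

Lemma continuous_trig_poly f : trig_poly f -> continuous f.
Proof.
elim=> [c a b|f1 f2 _ IH1 _ IH2] x; last by apply: cvgD; [exact: IH1|exact: IH2].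
apply: cvgM; first exact: cvg_cst.
apply: (@continuous_comp _ _ _ (fun x => a * x + b) cos); last exact: continuous_cos.
by apply: cvgD; [apply: cvgM; [exact: cvg_cst|exact: cvg_id]|exact: cvg_cst].
Qed.

Lemma measurable_trig_poly f : trig_poly f -> measurable_fun setT f.
Proof. by move=> /continuous_trig_poly; exact: continuous_measurable_fun. Qed.

Lemma bounded_trig_poly f : trig_poly f -> exists M, forall x, `|f x| <= M.
Proof.
elim=> [c a b|f1 f2 _ [M1 h1] _ [M2 h2]]; last first.
  by exists (M1 + M2) => x; rewrite (le_trans (ler_normD _ _))// lerD.
exists `|c| => x; rewrite normrM ler_piMr// ler_norml cos_le1 andbT.
exact: cos_geN1.
Qed.

End trig_polynomials.

Section fourier_uniqueness.
Context {R : realType} d (T : measurableType d) (P : {finite_measure set T -> \bar R}).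
Variables (X g1 g2 : T -> R) (M : R).
Hypotheses (mX : measurable_fun setT X) (mg1 : measurable_fun setT g1)
  (mg2 : measurable_fun setT g2) (g1M : forall w, `|g1 w| <= M)
  (g2M : forall w, `|g2 w| <= M).
Hypothesis cosE : forall a b, \int[P]_w (cos (a * X w + b) * g1 w) =
  \int[P]_w (cos (a * X w + b) * g2 w).

Let integrableM (phi : R -> R) (K : R) (g : T -> R) :
  measurable_fun setT phi -> (forall x, `|phi x| <= K) ->
  measurable_fun setT g -> (forall w, `|g w| <= M) ->
  P.-integrable setT (EFin \o (fun w => phi (X w) * g w)).
Proof.
move=> mphi phiK mg gM; apply: (@le_bounded_integrable _ _ _ _ _ (K * M)).
  by apply: measurable_funM => //; exact: measurableT_comp.
by move=> w; rewrite normrM ler_pM.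
Qed.

Lemma Rintegral_trig_poly f : trig_poly f ->
  \int[P]_w (f (X w) * g1 w) = \int[P]_w (f (X w) * g2 w).
Proof.
elim=> [c a b|h1 h2 t1 IH1 t2 IH2].
  have mc : measurable_fun setT (fun x : R => cos (a * x + b)).
    by have := measurable_trig_poly (trig_cos 1 a b); under eq_fun do rewrite mul1r.
  have cM x : `|cos (a * x + b)| <= 1 by rewrite ler_norml cos_le1 cos_geN1.
  under eq_Rintegral do rewrite -mulrA.
  under [RHS]eq_Rintegral do rewrite -mulrA.
  by rewrite !RintegralZl// ?cosE//; [exact: (integrableM mc cM)|exact: (integrableM mc cM)].
have [[K1 hK1] [K2 hK2]] := (bounded_trig_poly t1, bounded_trig_poly t2).
have [m1 m2] := (measurable_trig_poly t1, measurable_trig_poly t2).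
under eq_Rintegral do rewrite mulrDl.
under [RHS]eq_Rintegral do rewrite mulrDl.
by rewrite !RintegralD ?IH1 ?IH2//;
  do ?[exact: (integrableM m1 hK1)|exact: (integrableM m2 hK2)].
Qed.

Let Rintegral_lim (phi_ : nat -> R -> R) (phi : R -> R) :
  (forall n, measurable_fun setT (phi_ n)) ->
  (forall n x, `|phi_ n x| <= 1) ->
  (forall x, phi_ n x @[n --> \oo] --> phi x) ->
  (forall n, \int[P]_w (phi_ n (X w) * g1 w) = \int[P]_w (phi_ n (X w) * g2 w)) ->
  \int[P]_w (phi (X w) * g1 w) = \int[P]_w (phi (X w) * g2 w).
Proof.
move=> mphi phi1 phicvg phiE.
have L (g : T -> R) : measurable_fun setT g -> (forall w, `|g w| <= M) ->
    \int[P]_w (phi_ n (X w) * g w) @[n --> \oo] --> \int[P]_w (phi (X w) * g w).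
  move=> mg gM; apply: (@dominated_cvg_Rintegral _ _ _ _ _ _ (cst M)).
  - by move=> n; apply: measurable_funM => //; exact: measurableT_comp.
  - by move=> w; apply: cvgM => //; exact: cvg_cst.
  - by move=> n w; rewrite normrM -[leRHS]mul1r ler_pM.
  - exact: finite_measure_integrable_cst.
have := L _ mg1 g1M; rewrite (funext phiE) => h1.
exact: (cvg_unique _ h1 (L _ mg2 g2M)).
Qed.

(** Let s_N(x) = sin((x - c) / (N + 1)). Sharpening s_N drives it to its sign, and z |-> (z^2 + z) /
    2 sends -1, 0, 1 to 0, 0, 1, so the limit in n is the indicator of s_N > 0; the limit in N is
    the indicator of x > c. The weights g1 and g2 make this usable for joint laws: one of them will
    depend on a second variable. *)
Lemma Rintegral_tail_eq c :
  \int[P]_w (\1_[set x | c < x] (X w) * g1 w) =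
  \int[P]_w (\1_[set x | c < x] (X w) * g2 w).
Proof.
pose s N x := sin (N.+1%:R^-1 * x + (- c / N.+1%:R)).
have sE N x : s N x = sin ((x - c) / N.+1%:R) by rewrite /s; congr sin; ring.
have ts N : trig_poly (s N) by exact: trig_sin.
have s1 N x : `|s N x| <= 1 by rewrite ler_norml sin_le1 sin_geN1.
pose q n N x := (iter n sharpen (s N x) ^+ 2 + iter n sharpen (s N x)) / 2.
have tq n N : trig_poly (q n N).
  have ti := trig_iter_sharpen n (ts N).
  apply: eq_trig_poly (trig_mul (trig_cst 2^-1) (trig_add (trig_mul ti ti) ti)).
  by move=> x; rewrite /q expr2 mulrC.
have half1 (z : R) : `|z| <= 1 -> `|(z ^+ 2 + z) / 2| <= 1.
  rewrite !ler_norml => /andP[z1 z2].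
  have : 0 <= (1 - z) * (1 + z) by rewrite mulr_ge0; lra.
  have := sqr_ge0 z; rewrite expr2; nra.
have sg1 (z : R) : `|Num.sg z| <= 1 by rewrite normr_sg; case: (z != 0).
apply: (@Rintegral_lim
    (fun N x => (Num.sg (s N x) ^+ 2 + Num.sg (s N x)) / 2)) => //.
- move=> N; apply: (measurable_fun_cvg (h := fun n x => q n N x)).
    by move=> n; exact: measurable_trig_poly.
  move=> x _; apply: cvgM; last exact: cvg_cst.
  by apply: cvgD; [apply: cvgM|]; exact: iter_sharpen_cvg.
- by move=> N x; exact: half1.
(* Once N > |x - c| the argument of the sine lies in (-1, 1), inside (-pi, pi), where the sine has
   the sign of its argument: the sequence is eventually constant. *)
- move=> x; apply: cvg_near_cst; near=> N; rewrite indicE sE.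
  have N0 : (0 : R) < N.+1%:R by [].
  have NB : `|x - c| < N.+1%:R.
    by rewrite (lt_trans (_ : _ < N%:R)) ?ltr_nat//; near: N; exact: nbhs_infty_gtr.
  have pi1 : (1 : R) < pi by have := @pi_ge2 R; lra.
  have [cx|xc|->] := ltgtP c x.
  + rewrite mem_set//= gtr0_sg ?expr1n; first by field.
    apply: sin_gt0_pi; rewrite divr_gt0 ?subr_gt0//=.
    rewrite (lt_trans _ pi1)// ltr_pdivrMr// mul1r.
    by rewrite (le_lt_trans _ NB)// ler_norm.
  + rewrite memNset/=; last by apply/negP; rewrite -leNgt ltW.
    rewrite ltr0_sg; first by rewrite expr2; field.
    rewrite -oppr_gt0 -sinN; apply: sin_gt0_pi.
    rewrite -mulNr opprB divr_gt0 ?subr_gt0//=.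
    rewrite (lt_trans _ pi1)// ltr_pdivrMr// mul1r.
    by rewrite (le_lt_trans _ NB)// distrC ler_norm.
  + rewrite memNset/= ?ltxx// subrr mul0r sin0 sgr0 expr0n/=; ring.
- move=> N; apply: (@Rintegral_lim (q ^~ N)
    (fun x => (Num.sg (s N x) ^+ 2 + Num.sg (s N x)) / 2)).
  + by move=> n; exact: measurable_trig_poly.
  + by move=> n x; apply: half1; exact: norm_iter_sharpen.
  + move=> x; apply: cvgM; last exact: cvg_cst.
    by apply: cvgD; [apply: cvgM|]; exact: iter_sharpen_cvg.
  + by move=> n; exact: Rintegral_trig_poly.
Unshelve. all: end_near. Qed.

End fourier_uniqueness.

Section independence.
Context {R : realType}.

Lemma eq_measure_tails (m1 m2 : {measure set R -> \bar R}) :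
  (m1 setT < +oo)%E -> (forall c, m1 `]c, +oo[%classic = m2 `]c, +oo[%classic) ->
  forall A, measurable A -> m1 A = m2 A.
Proof.
move=> m1y m12 A mA.
apply: (measure_unique (RGenOInfty.G (R:=R)) (fun n => `]- n%:R, +oo[%classic)) => //.
- exact: RGenOInfty.measurableE.
- move=> _ _ [a ->] [b ->]; exists (Num.max a b).
  apply/seteqP; split => x /=; rewrite !in_itv/= !andbT gt_max.
    by move=> [-> ->].
  by move=> /andP.
- by move=> n; exists (- n%:R).
- rewrite -subTset => x _; exists (Num.bound `|x|) => //=.
  rewrite in_itv/= andbT ltrNl (le_lt_trans _ (archi_boundP (normr_ge0 x)))//.
  by rewrite -normrN ler_norm.
- by move=> _ [a ->]; exact: m12.
- by move=> k; apply: le_lt_trans m1y; apply: le_measure; rewrite ?inE.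
Qed.

Context d (T : measurableType d) (P : probability T R) (X V : {RV P >-> R}).

(** One variable is freed at a time. With V confined to a half-line, both sides are finite measures
    in the set for X that agree on half-lines, hence on Borel sets; then the same argument runs in
    the set for V, with the Borel set for X fixed. *)
Lemma independent_of_tails :
  (forall c e, P ([set w | c < X w] `&` [set w | e < V w]) =
    (P [set w | (c < X w)%R] * P [set w | (e < V w)%R])%E) ->
  independent X V.
Proof.
move=> PE A B mA mB.
have pre (U : T -> R) c : [set w | c < U w] = U @^-1` `]c, +oo[.
  by apply/seteqP; split => w /=; rewrite in_itv/= andbT.
have mX C : measurable C -> measurable (X @^-1` C).
  by move=> mC; rewrite -[X in measurable X]setTI; exact: measurable_funP.
have mV C : measurable C -> measurable (V @^-1` C).
  by move=> mC; rewrite -[X in measurable X]setTI; exact: measurable_funP.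
have fP C : measurable C -> (fine (P C))%:E = P C.
  by move=> mC; rewrite fineK// fin_num_measure.
have f0 C : 0 <= fine (P C) by rewrite fine_ge0.
have step1 c : P (X @^-1` A `&` [set w | c < V w]) =
    (P (X @^-1` A) * P [set w | (c < V w)%R])%E.
  have mW : measurable [set w | c < V w] by rewrite pre; exact: mV.
  pose m1 : {measure set R -> \bar R} := pushforward (mrestr P mW) X.
  pose m2 : {measure set R -> \bar R} :=
    mscale (NngNum (f0 [set w | c < V w])) (distribution P X).
  have m1E C : m1 (measurable_funP X) C = P (X @^-1` C `&` [set w | c < V w]) by [].
  have m2E C : m2 C = (P (X @^-1` C) * P [set w | (c < V w)%R])%E.
    by rewrite [LHS]/= /mscale /= fP// muleC.
  rewrite -m1E -m2E; apply: eq_measure_tails => // [|e].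
    rewrite m1E (le_lt_trans (probability_le1 _ _)) ?ltry//.
    by apply: measurableI => //; exact: mX.
  by rewrite m1E m2E -pre PE.
have mXA := mX _ mA.
pose m1 : {measure set R -> \bar R} := pushforward (mrestr P mXA) V.
pose m2 : {measure set R -> \bar R} :=
  mscale (NngNum (f0 (X @^-1` A))) (distribution P V).
have m1E C : m1 (measurable_funP V) C = P (X @^-1` A `&` V @^-1` C).
  by rewrite setIC.
have m2E C : m2 C = (P (X @^-1` A) * P (V @^-1` C))%E.
  by rewrite [LHS]/= /mscale /= fP.
rewrite -m1E -m2E; apply: eq_measure_tails => // [|e].
  rewrite m1E (le_lt_trans (probability_le1 _ _)) ?ltry//.
  by apply: measurableI; [by []|exact: mV].
by rewrite m1E m2E -pre step1.
Qed.

(** Fourier uniqueness is used twice: in X, comparing the weight [cos (a' * V + b')] with its mean,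
    and then in V, comparing the indicator of X > c with its probability. *)
Lemma independent_of_cos :
  (forall a b a' b', \int[P]_w (cos (a * X w + b) * cos (a' * V w + b')) =
    \int[P]_w cos (a * X w + b) * \int[P]_w cos (a' * V w + b')) ->
  independent X V.
Proof.
move=> cosE.
have mcos (U : {RV P >-> R}) a b : measurable_fun setT (fun w => cos (a * U w + b)).
  have := measurable_trig_poly (trig_cos 1 a b).
  by under eq_fun do rewrite mul1r; move=> h; exact: (measurableT_comp h).
have cos1 (z : R) : `|cos z| <= 1 by rewrite ler_norml cos_le1 cos_geN1.
have icos (U : {RV P >-> R}) a b : P.-integrable setT (EFin \o (fun w => cos (a * U w + b))).
  by apply: (@le_bounded_integrable _ _ _ P _ 1) => [|w]; [exact: mcos|exact: cos1].
have Ecos1 (U : {RV P >-> R}) a b : `|\int[P]_w cos (a * U w + b)| <= 1.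
  apply: le_trans (le_normr_Rintegral measurableT (icos U a b)) _.
  apply: (@le_trans _ _ (\int[P]__ (1 : R))); last first.
    by rewrite Rintegral_cst//= probability_setT mul1r.
  apply: le_Rintegral => //.
  - exact/integrable_norm.
  - exact: finite_measure_integrable_cst.
have mtail (U : {RV P >-> R}) c : measurable [set w | c < U w].
  rewrite (_ : [set w | _] = U @^-1` `]c, +oo[).
    by rewrite -[X in measurable X]setTI; exact: measurable_funP.
  by apply/seteqP; split => w /=; rewrite in_itv/= andbT.
have Eind A : measurable A -> \int[P]_w \1_A w = fine (P A).
  by move=> mA; rewrite /Rintegral integral_indic// setIT.
apply: independent_of_tails => c e.
have step1 a' b' : \int[P]_w (\1_[set w | c < X w] w * cos (a' * V w + b')) =
    fine (P [set w | c < X w]) * \int[P]_w cos (a' * V w + b').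
  rewrite -[LHS]/(\int[P]_w (\1_[set x | c < x] (X w) * cos (a' * V w + b'))).
  rewrite (@Rintegral_tail_eq _ _ _ P X _
    (fun=> \int[P]_w cos (a' * V w + b')) 1)//.
    by rewrite RintegralZr//; [congr (_ * _); exact: (Eind _ (mtail _ _))|exact: (integrable_indic _ (mtail _ _))].
  by move=> a b; rewrite cosE RintegralZr.
have H : \int[P]_w (\1_[set w | e < V w] w * \1_[set w | c < X w] w) =
  fine (P [set w | e < V w]) * fine (P [set w | c < X w]).
  rewrite -[LHS]/(\int[P]_w (\1_[set x | e < x] (V w) * \1_[set w | c < X w] w)).
  rewrite (@Rintegral_tail_eq _ _ _ P V _ (fun=> fine (P [set w | c < X w])) 1)//.
  - by rewrite RintegralZr//; [congr (_ * _); exact: (Eind _ (mtail _ _))|exact: (integrable_indic _ (mtail _ _))].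
  - by move=> w; rewrite indicE; case: (_ \in _); rewrite ?normr1 ?normr0.
  - move=> w; rewrite ger0_norm ?fine_ge0// -lee_fin fineK ?fin_num_measure//.
    exact: probability_le1.
  - move=> a b; under eq_Rintegral do rewrite mulrC.
    by rewrite step1 RintegralZr// mulrC.
rewrite setIC.
have mI := measurableI _ _ (mtail V e) (mtail X c).
have HE := Eind _ mI; rewrite indicI in HE.
rewrite -[LHS]fineK ?fin_num_measure// -HE [X in X%:E]H EFinM muleC.
by rewrite !fineK ?fin_num_measure//; exact: mtail.
Qed.

(** X is integrated first, so that the exceedance of X can be computed with the value of V
    frozen. *)
Lemma independent_integralE (h : R * R -> \bar R) : independent X V ->
  measurable_fun setT h -> (forall z, 0 <= h z)%E ->
  (\int[P]_w h (X w, V w) =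
   \int[distribution P V]_v \int[distribution P X]_x h (x, v))%E.
Proof.
move=> XV mh h0.
have mXV : measurable_fun setT (fun w => (X w, V w)).
  by apply/measurable_fun_pairP; split; exact: measurable_funP.
transitivity (\int[distribution P X \x distribution P V]_z h z)%E; last first.
  by rewrite fubini_tonelli2.
pose m : {measure set (R * R) -> \bar R} := pushforward P (fun w => (X w, V w)).
transitivity (\int[m mXV]_z h z)%E; first by rewrite ge0_integral_pushforward.
apply: eq_measure_integral => A mA _; apply/esym.
by apply: product_measure_unique => // B C mB mC; rewrite -XV.
Qed.

End independence.

(** * The standard normal law *)

Section density.
Context {R : realType} d (T : measurableType d)
  (nu : {finite_measure set T -> \bar R})
  (mu : {sigma_finite_measure set T -> \bar R}) (g : T -> R).
Hypotheses (mg : measurable_fun setT g) (g0 : forall x, 0 <= g x)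
  (nuE : forall A, measurable A -> nu A = (\int[mu]_(x in A) (g x)%:E)%E).

(** The density g has the same integrals over measurable sets as the Radon-Nikodym derivative, hence
    equals it almost everywhere. *)
Lemma ge0_integral_density (f : T -> \bar R) :
  measurable_fun setT f -> (forall x, 0 <= f x)%E ->
  (\int[nu]_x f x = \int[mu]_x (f x * (g x)%:E))%E.
Proof.
move=> mf f0.
have numu : nu `<< mu.
  apply/null_content_dominatesP => A mA muA0; rewrite nuE//.
  by apply: null_set_integral => //; exact/measurable_EFinP/measurable_funTS.
rewrite -(Radon_Nikodym_SigmaFinite.change_of_variables numu)//.
have iRN := Radon_Nikodym_SigmaFinite.f_integrable numu.
have mEg : measurable_fun setT (EFin \o g) by exact/measurable_EFinP.
apply: ge0_ae_eq_integral => //.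
- by apply: emeasurable_funM => //; exact: measurable_int iRN.
- exact: emeasurable_funM.
- by move=> x _; rewrite mule_ge0// Radon_Nikodym_SigmaFinite.f_ge0.
- by move=> x _; rewrite mule_ge0// lee_fin.
- have : ae_eq mu setT (Radon_Nikodym_SigmaFinite.f nu mu) (EFin \o g).
    apply: integral_ae_eq => // E _ mE.
    by rewrite -Radon_Nikodym_SigmaFinite.f_integral// nuE.
  by apply: filterS => x /= /[apply] ->.
Qed.

Lemma integrable_density (f : T -> R) : measurable_fun setT f ->
  mu.-integrable setT (EFin \o (fun x => f x * g x)) ->
  nu.-integrable setT (EFin \o f).
Proof.
move=> mf /integrableP[_ fgy]; apply/integrableP; split.
  exact/measurable_EFinP.
rewrite ge0_integral_density//; last exact/measurableT_comp/measurable_EFinP.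
apply: le_lt_trans fgy; rewrite le_eqVlt; apply/orP; left; apply/eqP.
by apply: eq_integral => x _ /=; rewrite normrM (ger0_norm (g0 x)).
Qed.

Lemma Rintegral_density (f : T -> R) : measurable_fun setT f ->
  mu.-integrable setT (EFin \o (fun x => f x * g x)) ->
  \int[nu]_x f x = \int[mu]_x (f x * g x).
Proof.
move=> mf ifg; have if_ := integrable_density mf ifg.
have mEf : measurable_fun setT (EFin \o f) by exact/measurable_EFinP.
congr fine; rewrite integralE [RHS]integralE.
rewrite !ge0_integral_density; [|exact: measurable_funeneg|by []|
  exact: measurable_funepos|by []].
congr (_ - _)%E; apply: eq_integral => x _.
  rewrite !funeposE /= EFinM; case: (leP 0 (f x)) => fx.
    by rewrite !max_l ?lee_fin ?mulr_ge0.
  by rewrite !max_r ?mul0e// lee_fin ?mulr_le0_ge0// ltW.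
rewrite !funenegE /=; case: (leP 0 (f x)) => fx.
  by rewrite !max_r ?mul0e// lee_fin oppr_le0// mulr_ge0.
by rewrite !max_l -?EFinM ?mulNr// lee_fin oppr_ge0 ?mulr_le0_ge0// ltW.
Qed.

End density.

Section trigonometric_integrals.
Context {R : realType} (nu : {finite_measure set R -> \bar R}).
Hypothesis mom2 : nu.-integrable setT (EFin \o (fun x : R => x ^+ 2)).

Lemma integrable_mom1 : nu.-integrable setT (EFin \o (fun x : R => `|x|)).
Proof.
apply: (@le_norm_integrable _ _ _ nu _ (fun x => 1 + x ^+ 2)).
- exact: measurableT_comp.
- move=> x; rewrite normr_id -[x ^+ 2]real_normK ?num_real//.
  have := sqr_ge0 (`|x| - 1); rewrite !expr2; have := sqr_ge0 (`|x|); rewrite expr2; nra.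
- rewrite (_ : EFin \o _ = (EFin \o cst 1) \+ (EFin \o (fun x => x ^+ 2)))//.
  by apply: integrableD => //; exact: finite_measure_integrable_cst.
Qed.

Let mlin (a b : R) : measurable_fun setT (fun x => a * x + b).
Proof. by apply: measurable_funD => //; exact: measurable_funM. Qed.

Lemma integrable_cos (a b : R) : nu.-integrable setT (EFin \o (fun x => cos (a * x + b))).
Proof.
apply: (@le_bounded_integrable _ _ _ _ _ 1).
  exact: measurableT_comp measurable_cos (mlin a b).
by move=> x; rewrite ler_norml cos_le1 cos_geN1.
Qed.

Lemma integrable_x_sin (a b : R) :
  nu.-integrable setT (EFin \o (fun x => x * sin (a * x + b))).
Proof.
apply: (le_norm_integrable _ _ integrable_mom1).
  apply: measurable_funM => //.
  exact: measurableT_comp measurable_sin (mlin a b).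
by move=> x; rewrite normrM ler_piMr// ler_norml sin_le1 sin_geN1.
Qed.

Let is_derive_under (f df : R -> R -> R) (G : R -> R) (t : R) :
  (forall s, nu.-integrable setT (EFin \o f s)) ->
  (forall s x : R, is_derive s 1 (f ^~ x) (df s x)) ->
  (forall x, 0 <= G x) -> nu.-integrable setT (EFin \o G) ->
  (forall s x, `|df s x| <= G x) ->
  is_derive t 1 (fun s => \int[nu]_x f s x) (\int[nu]_x df t x).
Proof.
move=> intf dfE G0 iG dfG.
have tt : `]t - 1, t + 1[%classic t.
  by rewrite /= in_itv/= ltrBlDr ltrDl ltr01.
have dE s x : (partial1of2 f) s x = df s x.
  by rewrite partial1of2E; exact: (@derive_val _ _ _ _ _ _ _ (dfE s x)).
have der s x : `]t - 1, t + 1[%classic s -> setT x -> derivable (f ^~ x) s 1.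
  by move=> _ _; exact: (@ex_derive _ _ _ _ _ _ _ (dfE s x)).
have bd s x : `]t - 1, t + 1[%classic s -> setT x -> `|(partial1of2 f) s x| <= G x.
  by move=> _ _; rewrite dE.
have int s : `]t - 1, t + 1[%classic s -> nu.-integrable setT (EFin \o f s).
  by move=> _; exact: intf.
have H1 := derivable_under_integral measurableT tt int der G0 iG bd.
have H2 := differentiation_under_integral measurableT tt int der G0 iG bd.
apply: DeriveDef => //; rewrite -derive1E H2.
by apply: eq_Rintegral => x _; rewrite dE.
Qed.

Lemma is_derive_Rintegral_cos (b t : R) :
  is_derive t 1 (fun s => \int[nu]_x cos (s * x + b))
    (\int[nu]_x (- (x * sin (t * x + b)))).
Proof.
apply: (is_derive_under _ (df := fun s x => - (x * sin (s * x + b)))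
  _ _ _ integrable_mom1) => //.
- by move=> s; exact: integrable_cos.
- move=> s x; apply: trigger_derive.
  rewrite /GRing.scale/=; ring.
- by move=> s x; rewrite normrN normrM ler_piMr// ler_norml sin_le1 sin_geN1.
Qed.

Lemma is_derive_Rintegral_x_sin (t : R) :
  is_derive t 1 (fun s => \int[nu]_x (- (x * sin (s * x))))
    (\int[nu]_x (- (x ^+ 2 * cos (t * x)))).
Proof.
apply: (is_derive_under _ (df := fun s x => - (x ^+ 2 * cos (s * x)))
  _ _ _ mom2) => //.
- move=> s.
  rewrite (_ : EFin \o _ = -%E \o (EFin \o (fun x => x * sin (s * x + 0)))).
    by apply: integrableN; exact: integrable_x_sin.
  by apply/funext => x /=; rewrite addr0.
- move=> s x; apply: trigger_derive.
  rewrite /GRing.scale/=; ring.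
- by move=> x; exact: sqr_ge0.
- move=> s x; rewrite normrN normrM ger0_norm ?sqr_ge0// ler_piMr ?sqr_ge0//.
  by rewrite ler_norml cos_le1 cos_geN1.
Qed.

End trigonometric_integrals.

(** The integral over [-n, n] is F(n) - F(-n); integrability of f removes the truncation. *)
Lemma Rintegral_derive_vanishing {R : realType} (F f : R -> R) :
  (forall x : R, is_derive x 1 F (f x)) -> continuous f ->
  lebesgue_measure.-integrable setT (EFin \o f) ->
  F n%:R @[n --> \oo] --> 0 -> F (- n%:R) @[n --> \oo] --> 0 ->
  \int[lebesgue_measure]_x f x = 0.
Proof.
move=> dF cf intf Fp Fm.
pose I n : set R := `[- n%:R, n%:R]%classic.
have mI n : measurable (I n) by exact: measurable_itv.
have lim1 : \int[lebesgue_measure]_x (f \_ (I n)) x @[n --> \oo] -->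
    \int[lebesgue_measure]_x f x.
  apply: (@dominated_cvg_Rintegral _ _ _ lebesgue_measure (fun n => f \_ (I n)) f
    (fun x => `|f x|)).
  - move=> n; apply/(measurable_restrictT _ (mI n)).
    by apply: measurable_funTS; exact: continuous_measurable_fun.
  - move=> x; apply: cvg_near_cst; near=> n; rewrite patchE mem_set// /I/=.
    rewrite in_itv/= -ler_norml; near: n; exact: nbhs_infty_ger.
  - by move=> n x /=; rewrite patchE; case: ifP; rewrite ?normr0.
  - exact: integrable_norm.
have lim2 : \int[lebesgue_measure]_x (f \_ (I n)) x @[n --> \oo] --> (0 : R).
  rewrite -[X in _ --> X](subrr 0).
  have : F n%:R - F (- n%:R) @[n --> \oo] --> (0 - 0 : R) by exact: cvgB.
  apply: cvg_trans; apply: near_eq_cvg; near=> n.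
  rewrite -Rintegral_mkcond /Rintegral (@continuous_FTC2 _ f F)//.
  - have : (0 < n%:R :> R) by rewrite ltr0n; near: n; exact: nbhs_infty_gt.
    by lra.
  - by apply: continuous_subspaceT.
  - have cF : continuous F by move=> x; apply/differentiable_continuous/derivable1_diffP.
    split; first by move=> x _; exact: ex_derive.
      by apply: cvg_at_right_filter; exact: cF.
    by apply: cvg_at_left_filter; exact: cF.
  - by move=> x _; rewrite derive1E; exact: derive_val.
exact: (cvg_unique _ lim1 lim2).
Unshelve. all: end_near. Qed.

Lemma normal_pdf_peakE {R : realType} (m s x : R) : s != 0 ->
  normal_pdf m s x = normal_peak s * normal_fun m s x.
Proof. by rewrite /normal_pdf => /negbTE ->. Qed.

(* [normal_prob] is a measure on [measurableTypeR R], whose display differs from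
   that of [R]; [normal_law] is the same set function seen as a measure on [R]. *)
Section normal_law.
Context {R : realType}.

Definition normal_law (m s : R) : set R -> \bar R := normal_prob m s.

HB.instance Definition _ m s := isMeasure.Build _ R R (normal_law m s)
  (measure0 (normal_prob m s)) (measure_ge0 (normal_prob m s))
  (@measure_semi_sigma_additive _ _ _ (normal_prob m s)).
HB.instance Definition _ m s := @Measure_isProbability.Build _ R R (normal_law m s)
  (@probability_setT _ _ _ (normal_prob m s)).

Let measurable_idR : measurable_fun (T := measurableTypeR R) (U := R) setT idfun.
Proof. by move=> mT Y mY; rewrite setTI preimage_id. Qed.

Lemma ge0_integral_normal_law m s (f : R -> \bar R) :
  measurable_fun setT f -> (forall x, 0 <= f x)%E ->
  (\int[normal_law m s]_x f x = \int[normal_prob m s]_x f x)%E.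
Proof.
move=> mf f0.
exact: (ge0_integral_pushforward measurable_idR (normal_prob m s) measurableT mf).
Qed.

Lemma integrable_normal_law m s (f : R -> \bar R) :
  (normal_prob m s).-integrable setT f -> (normal_law m s).-integrable setT f.
Proof.
move=> intf; have mf : measurable_fun setT f by exact: measurable_int intf.
exact: (integrable_pushforward measurable_idR mf intf measurableT).
Qed.

Lemma integral_normal_law m s (f : R -> \bar R) :
  (normal_prob m s).-integrable setT f ->
  (\int[normal_law m s]_x f x = \int[normal_prob m s]_x f x)%E.
Proof.
move=> intf; have mf : measurable_fun setT f by exact: measurable_int intf.
exact: (integral_pushforward measurable_idR mf intf measurableT).
Qed.

End normal_law.

Section standard_normal.
Context {R : realType}.
Local Notation leb := (@lebesgue_measure R).
Local Notation gamma := (@normal_law R 0 1).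
Local Notation phi := (@normal_pdf R 0 1).

Lemma std_normal_pdfE x : phi x = normal_peak 1 * expR (- (x ^+ 2) / 2).
Proof.
rewrite normal_pdf_peakE ?oner_eq0// /normal_fun subr0 expr1n.
by rewrite -[1 *+ 2]/(2%:R).
Qed.

Lemma is_derive_phi (x : R) : is_derive x 1 phi (- x * phi x).
Proof.
rewrite (_ : phi = fun x => normal_peak 1 * expR (- (x ^+ 2) / 2)); last first.
  by apply/funext => y; exact: std_normal_pdfE.
by apply: trigger_derive; rewrite /GRing.scale/=; field.
Qed.

Let C : R := 4 * normal_peak 1.

(** Half of the Gaussian exponent absorbs the polynomial: [1 + x^2 / 4 <= expR (x^2 / 4)], whence
    the factor 4 in [C]. All integrands of Stein's identity get their majorant from this bound. *)
Let quad_phi_le x : (1 + x ^+ 2) * phi x <= C * expR (- (x ^+ 2) / 4).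
Proof.
rewrite std_normal_pdfE /C.
have -> : - (x ^+ 2) / 2 = x ^+ 2 / 4 * (-1) + (- (x ^+ 2) / 4) :> R by field.
set e := expR (- (x ^+ 2) / 4).
rewrite expRD -/e mulrN1.
have p0 : 0 <= normal_peak (1 : R) by exact: normal_peak_ge0.
have e0 : 0 <= e by exact: expR_ge0.
have h1 : 1 + x ^+ 2 / 4 <= expR (x ^+ 2 / 4) by exact: expR_ge1Dx.
have x20 := sqr_ge0 x.
have h2 : (1 + x ^+ 2) * expR (- (x ^+ 2 / 4)) <= 4.
  rewrite expRN ler_pdivrMr ?expR_gt0//; lra.
have := ler_wpM2r (mulr_ge0 p0 e0) h2; lra.
Qed.

(** Up to its peak, this is the normal density of variance 2. *)
Let integrable_bound : leb.-integrable setT (EFin \o (fun x : R => expR (- (x ^+ 2) / 4))).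
Proof.
have s2 : Num.sqrt 2 != 0 :> R by rewrite gt_eqF// sqrtr_gt0.
have := integrableZl measurableT ((normal_peak (Num.sqrt (2 : R)))^-1)
  (integrable_normal_pdf 0 (Num.sqrt (2 : R))).
apply: eq_integrable => // x _ /=.
rewrite normal_pdf_peakE// /normal_fun subr0 sqr_sqrtr//.
rewrite -EFinM mulKf ?gt_eqF ?normal_peak_gt0//.
by congr (expR (_ / _))%:E; ring.
Qed.

Section stein.
Variables (h dh : R -> R) (A : R).
Hypotheses (hE : forall x : R, is_derive x 1 h (dh x)) (cdh : continuous dh)
  (hA : forall x, `|h x| <= A * (1 + `|x|)) (dhA : forall x, `|dh x| <= A).

Let A0 : 0 <= A. Proof. exact: le_trans (dhA 0). Qed.

Let ch : continuous h.
Proof. by move=> x; apply/differentiable_continuous/derivable1_diffP. Qed.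

Let norm_le x : 1 + `|x| <= 2 * (1 + x ^+ 2) :> R.
Proof.
rewrite -[x ^+ 2]real_normK ?num_real// expr2.
have := sqr_ge0 (`|x| - 1); rewrite expr2; nra.
Qed.

Let phi0 (x : R) : 0 <= phi x. Proof. exact: normal_pdf_ge0. Qed.

Let xh_le x : `|x * h x * phi x| <= 2 * A * C * expR (- (x ^+ 2) / 4).
Proof.
rewrite normrM (ger0_norm (phi0 x)) normrM.
have h1 : `|x| * `|h x| <= A * (2 * (1 + x ^+ 2)).
  have := ler_wpM2l (normr_ge0 x) (hA x).
  move=> /le_trans; apply; rewrite mulrCA ler_wpM2l//.
  rewrite -[x ^+ 2]real_normK ?num_real// expr2.
  have := sqr_ge0 (`|x| - 1); rewrite expr2; nra.
have := ler_wpM2r (phi0 x) h1.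
have := ler_wpM2l A0 (quad_phi_le x).
lra.
Qed.

Let dh_le x : `|dh x * phi x| <= 2 * A * C * expR (- (x ^+ 2) / 4).
Proof.
rewrite normrM (ger0_norm (phi0 x)).
have h1 := ler_wpM2r (phi0 x) (dhA x).
have h2 := ler_wpM2l A0 (quad_phi_le x).
have := mulr_ge0 (mulr_ge0 A0 (sqr_ge0 x)) (phi0 x).
have := mulr_ge0 A0 (phi0 x); nra.
Qed.

Let h_le x : `|h x * phi x| <= 2 * A * C * expR (- (x ^+ 2) / 4).
Proof.
rewrite normrM (ger0_norm (phi0 x)).
have h1 := ler_wpM2r (phi0 x) (hA x).
have h2 := ler_wpM2l A0 (quad_phi_le x).
have := ler_wpM2r (phi0 x) (ler_wpM2l A0 (norm_le x)); lra.
Qed.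

Let ibound : leb.-integrable setT
  (EFin \o (fun x : R => 2 * A * C * expR (- (x ^+ 2) / 4))).
Proof. exact: (integrableZl measurableT (2 * A * C) integrable_bound). Qed.

Let mphi : measurable_fun setT phi. Proof. exact: measurable_normal_pdf. Qed.

Let mh : measurable_fun setT h. Proof. exact: continuous_measurable_fun. Qed.

Let mdh : measurable_fun setT dh. Proof. exact: continuous_measurable_fun. Qed.

Lemma integrable_stein_l : leb.-integrable setT (EFin \o (fun x => dh x * phi x)).
Proof. by apply: (@le_norm_integrable _ _ _ leb _ _ _ dh_le ibound); exact: measurable_funM. Qed.

Lemma integrable_stein_r : leb.-integrable setT (EFin \o (fun x => x * h x * phi x)).
Proof.
apply: (@le_norm_integrable _ _ _ leb _ _ _ xh_le ibound).
by apply: measurable_funM => //; exact: measurable_funM.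
Qed.

Let exp_cvg : expR (- (n%:R ^+ 2) / 4) @[n --> \oo] --> (0 : R).
Proof.
apply: (@squeeze_cvgr _ _ _ _ (cst 0) (fun n => 2 * n.+1%:R^-1)).
- apply: nearW => n /=; rewrite expR_ge0/= mulNr expRN.
  rewrite -div1r ler_pdivrMr ?expR_gt0// mulrAC ler_pdivlMr ?ltr0n// mul1r.
  have := expR_ge1Dx ((n%:R : R) ^+ 2 / 4).
  have : (0 : R) <= n%:R by [].
  rewrite -[n.+1%:R]natr1 expr2; set e := expR _; set m : R := n%:R.
  have := sqr_ge0 (m / 2 - 1); rewrite expr2; nra.
- exact: cvg_cst.
- rewrite -[X in _ --> X](mulr0 2); apply: cvgM; first exact: cvg_cst.
  exact: cvg_harmonic.
Qed.

Let hphi_cvg (s : nat -> R) : (forall n, s n ^+ 2 = n%:R ^+ 2) ->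
  h (s n) * phi (s n) @[n --> \oo] --> (0 : R).
Proof.
move=> sE; apply: norm_cvg0.
apply: (@squeeze_cvgr _ _ _ _ (cst 0) (fun n => 2 * A * C * expR (- (n%:R ^+ 2) / 4))).
- by apply: nearW => n /=; rewrite normr_ge0 -sE h_le.
- exact: cvg_cst.
- by rewrite -[X in _ --> X](mulr0 (2 * A * C)); apply: cvgM exp_cvg; exact: cvg_cst.
Qed.

(** Stein's identity: [(h * phi)' = (dh - x * h) * phi], and [h * phi] vanishes at both infinities.
    The first two moments and the characteristic function of the normal law all come from it. *)
Lemma stein : \int[gamma]_x dh x = \int[gamma]_x (x * h x).
Proof.
have dE (f : R -> R) : measurable_fun setT f ->
    leb.-integrable setT (EFin \o (fun x => f x * phi x)) ->
    \int[gamma]_x f x = \int[leb]_x (f x * phi x).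
  move=> mf intf; rewrite -(@Rintegral_density _ _ _ (normal_prob 0 1) leb phi) //.
  congr fine; apply: integral_normal_law.
  by apply: (@integrable_density _ _ _ (normal_prob 0 1) leb phi).
rewrite !dE//; [|exact: measurable_funM|exact: integrable_stein_r|
  exact: integrable_stein_l].
apply/eqP; rewrite -subr_eq0 -RintegralB//; [|exact: integrable_stein_l|
  exact: integrable_stein_r].
apply/eqP; apply: (@Rintegral_derive_vanishing _ (fun x => h x * phi x)).
- move=> x; have dx := hE x; have px := is_derive_phi x.
  by apply: trigger_derive; rewrite /GRing.scale/=; ring.
- have cphi : continuous phi by apply: continuous_normal_pdf; rewrite oner_eq0.
  move=> x; apply: cvgB; first by apply: cvgM; [exact: cdh|exact: cphi].
  apply: cvgM; last exact: cphi.
  by apply: cvgM; [exact: cvg_id|exact: ch].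
- have := integrableB measurableT integrable_stein_l integrable_stein_r.
  by apply: eq_integrable.
- exact: hphi_cvg.
- by apply: hphi_cvg => n; rewrite sqrrN.
Qed.

End stein.

End standard_normal.

Section normal_moments.
Context {R : realType}.
Local Notation gamma := (@normal_law R 0 1).
Local Notation phi := (@normal_pdf R 0 1).

Let id1 (x : R) : `|x| <= 1 * (1 + `|x|). Proof. by rewrite mul1r lerDr. Qed.

Let cst1 (x : R) : `|1 : R| <= 1. Proof. by rewrite normr1. Qed.

Lemma Rintegral_gamma_cst (c : R) : \int[gamma]__ c = c.
Proof.
by rewrite Rintegral_cst//= probability_setT mulr1.
Qed.

Lemma integrable_gamma_sqr : gamma.-integrable setT (EFin \o (fun x : R => x ^+ 2)).
Proof.
apply: integrable_normal_law.
apply: (@integrable_density _ _ _ (normal_prob 0 1) lebesgue_measure phi).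
- exact: measurable_normal_pdf.
- by move=> x; exact: normal_pdf_ge0.
- by [].
- by apply: measurable_funX.
- have := @integrable_stein_r R id (cst 1) 1 (fun x => is_derive_id x 1)
    id1 cst1.
  by apply: eq_integrable => // x _ /=; rewrite expr2.
Qed.

Lemma gamma_sqr : \int[gamma]_x (x ^+ 2) = 1 :> R.
Proof.
have := @stein R id (cst 1) 1 (fun x => is_derive_id x 1) (@cst_continuous R R 1) id1 cst1.
by rewrite Rintegral_gamma_cst => /esym.
Qed.

Lemma gamma_mean : \int[gamma]_x x = 0 :> R.
Proof.
have := @stein _ (cst 1) (cst 0) 1 (fun x => is_derive_cst _ _ _) (@cst_continuous R R 0).
rewrite Rintegral_gamma_cst => h; rewrite {}[RHS]h//.
- by apply: eq_Rintegral => x _; rewrite mulr1.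
- by move=> x; rewrite normr1 mul1r lerDl.
- by move=> x; rewrite normr0.
Qed.

(** As a function of t = s, the integral K satisfies K' = - t K, by differentiation under the
    integral and Stein's identity for sin(t x + b). So K(t) exp(t^2 / 2) is constant, equal to its
    value cos b at 0. *)
Lemma gamma_cos (s b : R) : \int[gamma]_x cos (s * x + b) = cos b * expR (- (s ^+ 2 / 2)).
Proof.
pose K t := \int[gamma]_x cos (t * x + b).
have dK (t : R) : is_derive t 1 K (- t * K t).
  have := is_derive_Rintegral_cos integrable_gamma_sqr b t.
  congr is_derive.
  have ix := integrable_x_sin integrable_gamma_sqr t b.
  have -> : \int[gamma]_x (- (x * sin (t * x + b))) =
      - \int[gamma]_x (x * sin (t * x + b)).
    rewrite -[RHS]mulN1r -RintegralZl//.
    by apply: eq_Rintegral => x _; rewrite mulN1r.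
  rewrite mulNr; congr (- _).
  have hE (x : R) : is_derive x 1 (fun x => sin (t * x + b)) (t * cos (t * x + b)).
    by apply: trigger_derive; rewrite /GRing.scale/=; ring.
  rewrite -(@stein _ (fun x => sin (t * x + b))
    (fun x => t * cos (t * x + b)) (1 + `|t|) hE).
  - by rewrite RintegralZl//; exact: integrable_cos.
  - move=> x; apply: cvgM; first exact: cvg_cst.
    apply: (@continuous_comp _ _ _ (fun x => t * x + b) cos); last exact: continuous_cos.
    by apply: cvgD; [apply: cvgM; [exact: cvg_cst|exact: cvg_id]|exact: cvg_cst].
  - move=> x; apply: (@le_trans _ _ 1); first by rewrite ler_norml sin_le1 sin_geN1.
    by rewrite -[leLHS]mulr1 ler_pM ?lerDl.
  - move=> x; rewrite normrM (@le_trans _ _ `|t|) ?lerDr//.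
    by rewrite ler_piMr// ler_norml cos_le1 cos_geN1.
have dKe (t : R) : is_derive t 1 (fun t => K t * expR (t ^+ 2 / 2)) 0.
  have ? := dK t; apply: trigger_derive; rewrite /GRing.scale/=. by field.
have := is_derive_0_is_cst s 0 dKe.
rewrite {2}/K expr0n/= mul0r expR0 mulr1.
under eq_Rintegral do rewrite mul0r add0r.
rewrite Rintegral_gamma_cst => <-.
by rewrite expRN mulfK// gt_eqF// expR_gt0.
Qed.

(** Half-lines suffice, and on them this is the linear substitution in the density. *)
Lemma normal_prob_affine (m s : R) (A : set R) : 0 < s -> measurable A ->
  normal_prob m s A = gamma ((fun x => m + s * x) @^-1` A).
Proof.
move=> s0 mA.
have maff : measurable_fun setT (fun x : R => m + s * x).
  by apply: measurable_funD => //; exact: measurable_funM.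
pose n : {measure set R -> \bar R} := pushforward gamma (fun x : R => m + s * x).
apply: (@eq_measure_tails _ (normal_law m s) (n maff)) => //.
  exact: le_lt_trans (probability_le1 (normal_law m s) measurableT) (ltry _).
move=> c; rewrite /n /= /pushforward.
pose F (x : R) := m + s * x.
have Fc : F ((c - m) / s) = c by rewrite /F mulrCA mulfV ?gt_eqF// mulr1 addrC subrK.
have dF (x : R) : is_derive x 1 F s.
  by apply: trigger_derive; rewrite /GRing.scale/=; ring.
have F'E : F^`()%classic = cst s.
  by apply/funext => x; rewrite derive1E; exact: (@derive_val _ _ _ _ _ _ _ (dF x)).
have -> : F @^-1` `]c, +oo[ = `](c - m) / s, +oo[%classic.
  apply/seteqP; split => x; rewrite /= !in_itv/= !andbT /F ltr_pdivrMr// ltrBlDl mulrC//.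
rewrite /normal_law /normal_prob integral_itv_obnd_cbnd; last first.
  by apply/measurable_EFinP; apply: measurable_funTS; exact: measurable_normal_pdf.
rewrite [RHS]integral_itv_obnd_cbnd; last first.
  by apply/measurable_EFinP; apply: measurable_funTS; exact: measurable_normal_pdf.
rewrite -{1}Fc increasing_ge0_integration_by_substitutiony.
- apply: eq_integral => x _; congr EFin.
  rewrite !fctE/= F'E !normal_pdf_peakE ?oner_eq0 ?gt_eqF// /normal_fun /F.
  rewrite addrC addKr subr0 expr1n exprMn mulrAC; congr (_ * _).
    rewrite /normal_peak expr1n mul1r -!mulrnAr sqrtrM ?sqr_ge0//.
    by rewrite sqrtr_sqr gtr0_norm// invfM mulrAC mulVf ?mul1r// gt_eqF.
  congr expR; rewrite -[_ *+ 2]mulr_natr -[1 *+ 2]mulr_natr; field.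
  by rewrite gt_eqF.
- by move=> x y _ _ xy; rewrite /F ltrD2l ltr_pM2l.
- by rewrite F'E => x _; exact: cvg_cst.
- by rewrite F'E; exact: is_cvg_cst.
- by rewrite F'E; exact: is_cvg_cst.
- split; first by move=> x _; exact: ex_derive.
  apply: cvg_at_right_filter; apply/differentiable_continuous/derivable1_diffP.
  exact: ex_derive.
- exact: cvg_comp (gt0_cvgMry s0 cvg_id) (cvg_addrl m).
- by apply: continuous_subspaceT; apply: continuous_normal_pdf; rewrite gt_eqF.
- by move=> x _; exact: normal_pdf_ge0.
Qed.

(** Writing a Gaussian law as the image of [gamma] by an affine map covers the Dirac case s = 0 as
    well, so later computations of moments need no case distinction. *)
Lemma gaussian_law_affine (nu : set R -> \bar R) : gaussian_law nu ->
  exists m s : R, 0 <= s /\ forall A, measurable A ->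
    nu A = gamma ((fun x => m + s * x) @^-1` A).
Proof.
move=> [m [s [s0 nuE]]]; exists m, s; split => // A mA; rewrite nuE//.
case: eqVneq => [->|sn0]; last by rewrite normal_prob_affine// lt_neqAle eq_sym sn0.
rewrite diracE (_ : _ @^-1` A = if m \in A then setT else set0).
  by case: ifP => mA'; rewrite ?mA' ?measure0 ?probability_setT.
case: ifPn => [/set_mem|/negP] mA'; apply/seteqP; split => x //=; rewrite mul0r addr0//.
by move=> h; apply: mA'; exact/mem_set.
Qed.

End normal_moments.

Section square_integrable.
Context {R : realType} d (T : measurableType d) (mu : {finite_measure set T -> \bar R}).
Implicit Types f g : T -> R.

Definition L2 f := measurable_fun setT f /\
  mu.-integrable setT (EFin \o (fun w => f w ^+ 2)).

Lemma L2_mul f g : L2 f -> L2 g -> mu.-integrable setT (EFin \o (fun w => f w * g w)).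
Proof.
move=> [mf if2] [mg ig2].
apply: (@le_norm_integrable _ _ _ mu _ (fun w => f w ^+ 2 + g w ^+ 2)).
- exact: measurable_funM.
- move=> w; rewrite ler_norml !expr2; have := sqr_ge0 (f w + g w).
  have := sqr_ge0 (f w - g w); have := sqr_ge0 (f w); have := sqr_ge0 (g w).
  rewrite !expr2; nra.
- by have := integrableD measurableT if2 ig2; exact: eq_integrable.
Qed.

Lemma L2_cst c : L2 (fun=> c).
Proof. by split => //; exact: finite_measure_integrable_cst. Qed.

Lemma L2_integrable f : L2 f -> mu.-integrable setT (EFin \o f).
Proof.
move=> /L2_mul/(_ (L2_cst 1)); apply: eq_integrable => // x _ /=.
by rewrite mulr1.
Qed.

Lemma L2D f g : L2 f -> L2 g -> L2 (fun w => f w + g w).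
Proof.
move=> Lf Lg; have [mf if2] := Lf; have [mg ig2] := Lg; split.
  exact: measurable_funD.
have i1 := integrableD measurableT if2 ig2.
have := integrableD measurableT i1 (integrableZl measurableT 2 (L2_mul Lf Lg)).
apply: eq_integrable => // x _ /=.
by rewrite -!EFinM -!EFinD; congr EFin; ring.
Qed.

Lemma L2Z c f : L2 f -> L2 (fun w => c * f w).
Proof.
move=> [mf if2]; split; first exact: measurable_funM.
have := integrableZl measurableT (c ^+ 2) if2.
by apply: eq_integrable => // x _ /=; rewrite -EFinM exprMn.
Qed.

Lemma Rintegral_sqrD f g a b : L2 f -> L2 g ->
  \int[mu]_w ((a * f w + b * g w) ^+ 2) =
  a ^+ 2 * \int[mu]_w (f w ^+ 2) + b ^+ 2 * \int[mu]_w (g w ^+ 2) +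
  2 * a * b * \int[mu]_w (f w * g w).
Proof.
move=> Lf Lg; have ifg := L2_mul Lf Lg; have [_ if2] := Lf; have [_ ig2] := Lg.
have iZ c h : mu.-integrable setT (EFin \o h) ->
    mu.-integrable setT (EFin \o (fun w => c * h w)).
  by move=> ih; have := integrableZl measurableT c ih; exact: eq_integrable.
rewrite -!RintegralZl// -RintegralD//; [|exact: iZ|exact: iZ].
rewrite -RintegralD//; [by apply: eq_Rintegral => x _; ring| |exact: iZ].
by have := integrableD measurableT (iZ (a ^+ 2) _ if2) (iZ (b ^+ 2) _ ig2);
  exact: eq_integrable.
Qed.

Lemma Rintegral_lin f g a b : L2 f -> L2 g ->
  \int[mu]_w (a * f w + b * g w) = a * \int[mu]_w f w + b * \int[mu]_w g w.
Proof.
move=> Lf Lg; have iF := L2_integrable (L2Z a Lf); have iG := L2_integrable (L2Z b Lg).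
by rewrite RintegralD// !RintegralZl//; exact: L2_integrable.
Qed.

End square_integrable.

Section gaussian_variables.
Context {R : realType} d (T : measurableType d) (P : probability T R).
Local Notation gamma := (@normal_law R 0 1).

Lemma L2_gamma_id : L2 gamma (@idfun R).
Proof. by split; [exact: measurable_id|exact: integrable_gamma_sqr]. Qed.

Let transfer (Y : {RV P >-> R}) (m s : R) (h : R -> R) :
  (forall A, measurable A -> pushforward P Y A = gamma ((fun x => m + s * x) @^-1` A)) ->
  measurable_fun setT h ->
  P.-integrable setT (EFin \o (h \o Y)) ->
  gamma.-integrable setT (EFin \o (fun x => h (m + s * x))) ->
  \int[P]_w h (Y w) = \int[gamma]_x h (m + s * x).
Proof.
move=> YE mh iY ig.
have maff : measurable_fun setT (fun x : R => m + s * x).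
  by apply: measurable_funD => //; exact: measurable_funM.
pose n : {measure set R -> \bar R} := pushforward gamma (fun x : R => m + s * x).
pose n' : {measure set R -> \bar R} := distribution P Y.
have mEh : measurable_fun setT (EFin \o h) by exact/measurable_EFinP.
congr fine.
transitivity (\int[n']_x (EFin \o h) x)%E.
  by rewrite integral_pushforward.
transitivity (\int[n maff]_x (EFin \o h) x)%E.
  by apply: eq_measure_integral => A mA _; exact: YE.
exact: (integral_pushforward maff mEh ig measurableT).
Qed.

Lemma centered_gaussian_law (Y : {RV P >-> R}) q :
  gaussian_law (pushforward P Y) -> L2 P Y ->
  \int[P]_w Y w = 0 -> \int[P]_w (Y w ^+ 2) = q ->
  exists2 s : R, 0 <= s & s ^+ 2 = q /\ forall A, measurable A ->
    pushforward P Y A = gamma ((fun x => s * x) @^-1` A).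
Proof.
move=> /gaussian_law_affine[m [s [s0 YE]]] LY EY EY2.
have Lid := L2_gamma_id; have L1 := L2_cst gamma 1.
have Laff : L2 gamma (fun x => m + s * x).
  by have := L2D (L2_cst gamma m) (L2Z s Lid).
have m0 : m = 0.
  have := @transfer Y m s idfun YE (@measurable_id _ _ _) (L2_integrable LY)
    (L2_integrable Laff).
  rewrite EY => ->; have := Rintegral_lin m s L1 Lid.
  under eq_Rintegral do rewrite mulr1.
  move=> ->.
  by rewrite gamma_mean mulr0 addr0 Rintegral_gamma_cst mulr1.
exists s => //; split; last by move=> A mA; rewrite YE// m0; under eq_fun do rewrite add0r.
have := @transfer Y m s (fun x => x ^+ 2) YE _ LY.2 Laff.2.
rewrite EY2 => ->; last by apply: measurable_funX.
have := Rintegral_sqrD m s L1 Lid.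
under eq_Rintegral do rewrite mulr1.
by move=> ->; rewrite m0 expr0n/= mul0r add0r mulr0 !mul0r addr0 gamma_sqr mulr1.
Qed.

Lemma standard_gaussian_law (Y : {RV P >-> R}) :
  gaussian_law (pushforward P Y) -> L2 P Y ->
  \int[P]_w Y w = 0 -> \int[P]_w (Y w ^+ 2) = 1 ->
  forall A, measurable A -> distribution P Y A = gamma A.
Proof.
move=> gY LY EY EY2 A mA.
have [s s0 [s1 YE]] := centered_gaussian_law gY LY EY EY2.
have {}s1 : s = 1 by apply/eqP; rewrite -(eqrXn2 (_ : 0 < 2)%N)// s1 expr1n.
rewrite /distribution YE// s1; congr (gamma _).
by apply/seteqP; split => x /=; rewrite mul1r.
Qed.

Lemma centered_gaussian_cos (Y : {RV P >-> R}) q (a b : R) :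
  gaussian_law (pushforward P Y) -> L2 P Y ->
  \int[P]_w Y w = 0 -> \int[P]_w (Y w ^+ 2) = q ->
  \int[P]_w cos (a * Y w + b) = cos b * expR (- (a ^+ 2 * q / 2)).
Proof.
move=> gY LY EY EY2.
have [s s0 [<- YE]] := centered_gaussian_law gY LY EY EY2.
have mc : measurable_fun setT (fun x : R => cos (a * x + b)).
  apply: measurableT_comp measurable_cos _.
  by apply: measurable_funD => //; exact: measurable_funM.
have c1 x : `|cos (a * x + b)| <= 1 by rewrite ler_norml cos_le1 cos_geN1.
rewrite (@transfer Y 0 s (fun x => cos (a * x + b)))//.
- under eq_Rintegral do rewrite add0r mulrA.
  by rewrite gamma_cos exprMn.
- by move=> A mA; rewrite YE//; under [in RHS]eq_fun do rewrite add0r.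
- apply: (@le_bounded_integrable _ _ _ P _ 1) => [|w]; last exact: c1.
  exact: measurableT_comp mc _.
- apply: (@le_bounded_integrable _ _ _ gamma _ 1) => [|w]; last exact: c1.
  apply: measurableT_comp mc _.
  by apply: measurable_funD => //; exact: measurable_funM.
Qed.

(** Without correlation the variance of a X + a' V is a^2 p + a'^2 q whatever the sign of a'. Hence
    both terms of the product-to-sum formula carry the same exponential, and the mean of the product
    of cosines factors. *)
Lemma uncorrelated_gaussian_independent (X V : {RV P >-> R}) :
  (forall a b, gaussian_law (pushforward P (fun w => a * X w + b * V w))) ->
  L2 P X -> L2 P V -> \int[P]_w X w = 0 -> \int[P]_w V w = 0 ->
  \int[P]_w (X w * V w) = 0 -> independent X V.
Proof.
move=> gXV LX LV EX EV EXV.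
pose p := \int[P]_w (X w ^+ 2); pose q := \int[P]_w (V w ^+ 2).
have cE a a' b : \int[P]_w cos (a * X w + a' * V w + b) =
    cos b * expR (- ((a ^+ 2 * p + a' ^+ 2 * q) / 2)).
  have L := L2D (L2Z a LX) (L2Z a' LV).
  pose S : {RV P >-> R} := HB.pack (fun w => a * X w + a' * V w)
    (isMeasurableFun.Build _ _ _ _ _ L.1).
  have ES : \int[P]_w S w = 0 by rewrite Rintegral_lin// EX EV !mulr0 addr0.
  have ES2 : \int[P]_w (S w ^+ 2) = a ^+ 2 * p + a' ^+ 2 * q.
    by rewrite Rintegral_sqrD// EXV mulr0 addr0.
  have := centered_gaussian_cos 1 b (gXV a a' : gaussian_law (pushforward P S)) L ES ES2.
  by rewrite expr1n mul1r => <-; apply: eq_Rintegral => w _; rewrite mul1r.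
have cX a b : \int[P]_w cos (a * X w + b) = cos b * expR (- (a ^+ 2 * p / 2)).
  have := cE a 0 b; rewrite expr0n/= mul0r addr0 => <-.
  by apply: eq_Rintegral => w _; rewrite mul0r addr0.
have cV a b : \int[P]_w cos (a * V w + b) = cos b * expR (- (a ^+ 2 * q / 2)).
  have := cE 0 a b; rewrite expr0n/= mul0r add0r => <-.
  by apply: eq_Rintegral => w _; rewrite mul0r add0r.
have mc a a' b : P.-integrable setT (EFin \o (fun w => cos (a * X w + a' * V w + b))).
  apply: (@le_bounded_integrable _ _ _ P _ 1) => [|w].
    apply: measurableT_comp measurable_cos _.
    by apply: measurable_funD => //; exact: (L2D (L2Z a LX) (L2Z a' LV)).1.
  by rewrite ler_norml cos_le1 cos_geN1.
apply: independent_of_cos => a b a' b'; rewrite cX cV.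
transitivity (2^-1 * (\int[P]_w cos (a * X w + a' * V w + (b + b')) +
   \int[P]_w cos (a * X w + (- a') * V w + (b - b')))).
  rewrite -RintegralD// -RintegralZl//.
    apply: eq_Rintegral => w _.
    have -> : a * X w + a' * V w + (b + b') = (a * X w + b) + (a' * V w + b') by ring.
    have -> : a * X w + (- a') * V w + (b - b') = (a * X w + b) - (a' * V w + b') by ring.
    by rewrite [cos (_ + _ + _)]cosD [cos (_ - _)]cosB; field.
  have := integrableD measurableT (mc a a' (b + b')) (mc a (- a') (b - b')).
  exact: eq_integrable.
by rewrite !cE sqrrN mulrDl opprD expRD cosD cosB; field.
Qed.

End gaussian_variables.

(** * Covariance and spectral measure *)

Section trigonometric_bounds.
Context {R : realType}.
Implicit Types x y z : R.

Lemma le_norm_MVT (f df : R -> R) (x y M : R) :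
  (forall z : R, is_derive z 1 f (df z)) ->
  (forall z, `|z - x| <= `|y - x| -> `|df z| <= M) ->
  `|f y - f x| <= M * `|y - x|.
Proof.
move=> fE dfM.
have cf a b : {within `[a, b], continuous f}.
  apply: continuous_subspaceT => z.
  by apply/differentiable_continuous/derivable1_diffP; exact: ex_derive.
have [xy|yx|->] := ltgtP x y; last by rewrite !subrr normr0 mulr0.
  have [z zxy ->] := MVT xy (fun z _ => fE z) (cf _ _).
  rewrite normrM ler_wpM2r//; apply: dfM.
  move: zxy; rewrite in_itv/= => /andP[xz zy].
  by rewrite !gtr0_norm ?subr_gt0// lerB// ltW.
have [z zxy] := MVT yx (fun z _ => fE z) (cf _ _).
rewrite distrC => ->; rewrite normrM distrC ler_wpM2r//; apply: dfM.
move: zxy; rewrite in_itv/= => /andP[xz zy].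
by rewrite !ltr0_norm ?subr_lt0// !opprB lerB// ltW.
Qed.

Lemma norm_sin_le1 x : `|sin x| <= 1.
Proof. by rewrite ler_norml sin_le1 sin_geN1. Qed.

Lemma norm_cos_le1 x : `|cos x| <= 1.
Proof. by rewrite ler_norml cos_le1 cos_geN1. Qed.

Lemma sin_lipschitz x y : `|sin y - sin x| <= `|y - x|.
Proof.
by rewrite -[leRHS]mul1r; apply: (le_norm_MVT (df := cos)) => z _; exact: norm_cos_le1.
Qed.

Lemma cos_lipschitz x y : `|cos y - cos x| <= `|y - x|.
Proof.
rewrite -[leRHS]mul1r; apply: (le_norm_MVT (df := fun z => - sin z)) => z _.
by rewrite normrN; exact: norm_sin_le1.
Qed.

Lemma subr_sin_le z : `|z - sin z| <= `|z| ^+ 2.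
Proof.
have dE (x : R) : is_derive x 1 (fun z => z - sin z) (1 - cos x).
  by apply: trigger_derive; rewrite /GRing.scale/=; ring.
have := @le_norm_MVT (fun z => z - sin z) (fun z => 1 - cos z) 0 z `|z| dE.
rewrite sin0 !subr0 expr2; apply.
move=> x; rewrite subr0; apply: le_trans.
by have := cos_lipschitz x 0; rewrite cos0 sub0r normrN.
Qed.

(** With y = 2 z the left side is the modulus of 2 (z - sin z)(z + sin z). The minimum makes the
    bound o(y^2) at 0 and O(y^2) at infinity, hence integrable under a second moment alone. *)
Lemma cos_quadratic y :
  `|1 - cos y - y ^+ 2 / 2| <= 2 * (y ^+ 2 * Num.min 1 `|y|).
Proof.
pose z := y / 2; have yz : y = z + z by rewrite /z; field.
have -> : 1 - cos y - y ^+ 2 / 2 = - (2 * (z - sin z) * (z + sin z)).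
  by rewrite yz cosD -!expr2 cos2sin2; field.
have sz : `|sin z| <= `|z| by have := sin_lipschitz 0 z; rewrite sin0 !subr0.
have h1 : `|z + sin z| <= 2 * `|z|.
  by rewrite (le_trans (ler_normD _ _))//; lra.
have h2 : `|z - sin z| <= 2 * `|z| * Num.min 1 `|y|.
  have z0 := normr_ge0 z.
  have [y1|y1] := leP 1 `|y|.
    by rewrite (le_trans (ler_normB _ _))//; lra.
  apply: le_trans (subr_sin_le z) _.
  have -> : `|y| = 2 * `|z| by rewrite yz (_ : z + z = 2 * z) ?normrM ?normr_nat//; ring.
  by rewrite expr2; nra.
rewrite normrN !normrM ger0_norm//.
have -> : y ^+ 2 = 4 * (`|z| * `|z|).
  by rewrite -expr2 real_normK ?num_real// yz; ring.
have z0 := normr_ge0 z; have s0 := normr_ge0 (z + sin z).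
have m0 : 0 <= Num.min 1 `|y| by rewrite le_min ler01 normr_ge0.
have := ler_pM (normr_ge0 _) s0 h2 h1; lra.
Qed.

End trigonometric_bounds.

Section spectral_measure.
Context {R : realType} (mu : {finite_measure set R -> \bar R}).
Hypothesis mom2 : L2 mu (@idfun R).
Let mom2i : mu.-integrable setT (EFin \o (fun x : R => x ^+ 2)) := mom2.2.

(* Controls the Taylor remainders of order 2 of the covariance in the absence of a
   third moment. *)
Definition truncated_moment (h : R) := \int[mu]_x (x ^+ 2 * Num.min 1 (h * `|x|)).

Local Notation m := truncated_moment.

Let truncated_sqr_le (h x : R) : 0 <= h ->
  0 <= x ^+ 2 * Num.min 1 (h * `|x|) <= x ^+ 2.
Proof.
move=> h0; rewrite mulr_ge0 ?sqr_ge0 ?le_min ?ler01 ?mulr_ge0//=.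
by rewrite ler_piMr ?sqr_ge0// ge_min lexx.
Qed.

Let measurable_truncated_sqr (h : R) :
  measurable_fun setT (fun x : R => x ^+ 2 * Num.min 1 (h * `|x|)).
Proof.
apply: measurable_funM; first exact: measurable_funX.
by apply: measurable_minr => //; apply: measurable_funM.
Qed.

Lemma integrable_truncated_sqr (h : R) : 0 <= h ->
  mu.-integrable setT (EFin \o (fun x : R => x ^+ 2 * Num.min 1 (h * `|x|))).
Proof.
move=> h0; apply: (le_norm_integrable (measurable_truncated_sqr h) _ mom2i) => x.
by have /andP[a b] := truncated_sqr_le x h0; rewrite ger0_norm.
Qed.

Lemma truncated_moment_ge0 h : 0 <= h -> 0 <= m h.
Proof.
by move=> h0; apply: Rintegral_ge0 => x _; have /andP[] := truncated_sqr_le x h0.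
Qed.

(** Dominated convergence along h = 1/(n+1) is enough, the integrand being nondecreasing in h. *)
Lemma truncated_moment_small eps : 0 < eps -> exists2 del : R, 0 < del &
  forall h, 0 <= h <= del -> m h <= eps.
Proof.
move=> eps0.
have : m n.+1%:R^-1 @[n --> \oo] --> \int[mu]_x (0 : R).
  apply: (@dominated_cvg_Rintegral _ _ _ mu _ _ (fun x => x ^+ 2)) => //.
  - move=> x; rewrite -[X in _ --> X](mulr0 (x ^+ 2)).
    apply: cvgM; first exact: cvg_cst.
    apply: (@squeeze_cvgr _ _ _ _ (cst 0) (fun n => n.+1%:R^-1 * `|x|)).
    + by apply: nearW => n; rewrite le_min ler01 mulr_ge0//= ge_min lexx orbT.
    + exact: cvg_cst.
    + rewrite -[X in _ --> X](mul0r `|x|); apply: cvgM; last exact: cvg_cst.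
      exact: cvg_harmonic.
  - move=> n x; have n0 : 0 <= n.+1%:R^-1 :> R by [].
    by have /andP[a b] := truncated_sqr_le x n0; rewrite ger0_norm.
rewrite Rintegral_cst// mul0r => /cvgrPdist_le/(_ _ eps0)[N _ /(_ N (leqnn N))].
rewrite sub0r normrN ger0_norm ?truncated_moment_ge0// => mN.
exists N.+1%:R^-1 => // h /andP[h0 hN]; apply: le_trans mN.
apply: le_Rintegral => //; [exact: integrable_truncated_sqr..|].
move=> x _; rewrite ler_wpM2l ?sqr_ge0// le_min ge_min lexx/= ge_min.
by rewrite ler_wpM2r// orbT.
Qed.

Definition spectral_cov (t : R) := \int[mu]_x cos (t * x).
Definition second_moment := \int[mu]_x (x ^+ 2).
Local Notation r := spectral_cov.
Local Notation sg2 := second_moment.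

Let icos t : mu.-integrable setT (EFin \o (fun x => cos (t * x))).
Proof. by have := integrable_cos mu t 0; under eq_fun do rewrite addr0. Qed.

Lemma spectral_quadratic (s : R) : `|r 0 - r s - s ^+ 2 * sg2 / 2| <= 2 * s ^+ 2 * m `|s|.
Proof.
have i0 : mu.-integrable setT (EFin \o (fun x => cos (0 * x) - cos (s * x))).
  by have := integrableB measurableT (icos 0) (icos s); exact: eq_integrable.
have iz c f : mu.-integrable setT (EFin \o f) ->
    mu.-integrable setT (EFin \o (fun w => c * f w)).
  by move=> ih; have := integrableZl measurableT c ih; exact: eq_integrable.
have i2 := iz (s ^+ 2 / 2) _ mom2i.
have iB := integrableB measurableT i0 i2.
rewrite /spectral_cov -RintegralB// mulrAC /second_moment -RintegralZl// -RintegralB//.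
rewrite (le_trans (le_normr_Rintegral _ iB))//.
rewrite /truncated_moment -RintegralZl; [|by []|exact: integrable_truncated_sqr].
apply: le_Rintegral => //; first exact: integrable_norm.
  by apply: iz; exact: integrable_truncated_sqr.
move=> x _; rewrite mul0r cos0 -mulrAC -exprMn (le_trans (cos_quadratic _))//.
by rewrite normrM exprMn !mulrA.
Qed.

(* The integrand is the squared modulus of
   [e^{ibx} - e^{iax} - del (e^{ihx} - 1)]. *)
Lemma spectral_increment_le (a del h K : R) : 0 < h -> 0 <= K ->
  `|a| <= K * h -> `|a + del * h| <= K * h ->
  \int[mu]_x ((cos ((a + del * h) * x) - cos (a * x) - del * (cos (h * x) - 1)) ^+ 2 +
              (sin ((a + del * h) * x) - sin (a * x) - del * sin (h * x)) ^+ 2) <=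
  8 * (del * h) ^+ 2 * m ((K + 1) * h).
Proof.
move=> h0 K0 ha hb.
have Kh0 : 0 <= (K + 1) * h by rewrite mulr_ge0// ?addr_ge0// ltW.
have key x s : 0 <= s <= 1 -> `|(a + s * (del * h)) * x - s * h * x| <= (K + 1) * h * `|x|.
  move=> /andP[s0 s1]; rewrite -mulrBl normrM ler_wpM2r//.
  have : `|a + s * (del * h)| <= K * h.
    have -> : a + s * (del * h) = (1 - s) * a + s * (a + del * h) by ring.
    have s10 : 0 <= 1 - s by rewrite subr_ge0.
    rewrite (le_trans (ler_normD _ _))// !normrM (ger0_norm s0) (ger0_norm s10).
    have : (1 - s) * `|a| <= (1 - s) * (K * h) by rewrite ler_wpM2l ?subr_ge0.
    have := ler_wpM2l s0 hb; lra.
  move=> h1; rewrite (le_trans (ler_normB _ _))//.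
  rewrite [`|s * h|]ger0_norm ?mulr_ge0// ?(ltW h0)//.
  have := ler_wpM2r (ltW h0) s1; lra.
have bnd (f df : R -> R) x : (forall z : R, is_derive z 1 f (df z)) ->
    (forall y z, `|df y - df z| <= Num.min 2 `|y - z|) ->
    (f ((a + del * h) * x) - f (a * x) - del * (f (h * x) - f 0)) ^+ 2 <=
    4 * (del * h) ^+ 2 * (x ^+ 2 * Num.min 1 ((K + 1) * h * `|x|)).
  move=> fE dfL.
  (* Both increments are run through by one parameter, so that their difference is g(1) - g(0). The
     derivative of g is [del * h * x] times the difference of [df] at two points which, by [key],
     are at distance at most (K + 1) h |x|: this is the second-order cancellation. *)
  pose g s := f ((a + s * (del * h)) * x) - del * f (s * h * x).
  have gE (s : R) : is_derive s 1 g
      (del * h * x * (df ((a + s * (del * h)) * x) - df (s * h * x))).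
    have dlin1 : is_derive s 1 (fun s => (a + s * (del * h)) * x) (del * h * x).
      by apply: trigger_derive; rewrite /GRing.scale/=; ring.
    have dlin2 : is_derive s 1 (fun s => s * h * x) (h * x).
      by apply: trigger_derive; rewrite /GRing.scale/=; ring.
    have d1 : is_derive s 1 (fun s => f ((a + s * (del * h)) * x))
        (df ((a + s * (del * h)) * x) * (del * h * x)).
      exact: (@is_derive1_comp _ f (fun s => (a + s * (del * h)) * x)).
    have d2 : is_derive s 1 (fun s => f (s * h * x)) (df (s * h * x) * (h * x)).
      exact: (@is_derive1_comp _ f (fun s => s * h * x)).
    by apply: trigger_derive; rewrite /GRing.scale/=; ring.
  pose M := `|del * h * x| * Num.min 2 ((K + 1) * h * `|x|).
  have gM : `|g 1 - g 0| <= M.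
    have cg : {within `[0, 1], continuous g}.
      apply: continuous_subspaceT => z.
      by apply/differentiable_continuous/derivable1_diffP; exact: ex_derive.
    have [s s01 ->] := MVT ltr01 (fun s _ => gE s) cg.
    rewrite subr0 mulr1 normrM /M ler_wpM2l// (le_trans (dfL _ _))//.
    move: s01; rewrite in_itv/= => /andP[s0 s1].
    rewrite le_min ge_min lexx/= ge_min key ?orbT// !ltW//.
  have -> : f ((a + del * h) * x) - f (a * x) - del * (f (h * x) - f 0) = g 1 - g 0.
    by rewrite /g !mul1r !mul0r addr0; ring.
  rewrite -[X in X <= _]real_normK ?num_real//.
  have M0 : 0 <= M by exact: le_trans gM.
  apply: (@le_trans _ _ (M ^+ 2)).
    by rewrite ler_sqr ?nnegrE.
  rewrite /M; move: (_ * `|x|) (mulr_ge0 Kh0 (normr_ge0 x)) => z z0.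
  rewrite exprMn real_normK ?num_real//.
  rewrite [leLHS](_ : _ = (del * h) ^+ 2 * (x ^+ 2 * Num.min 2 z ^+ 2)); last by ring.
  rewrite [leRHS](_ : _ = (del * h) ^+ 2 * (x ^+ 2 * (4 * Num.min 1 z))); last by ring.
  rewrite ler_wpM2l ?sqr_ge0// ler_wpM2l ?sqr_ge0//.
  (* It remains to see that min(2, z)^2 <= 4 min(1, z): for z >= 1 the left side is at most 4, and
     for z < 1 it is z^2 <= z. *)
  rewrite expr2; have [z1|z1] := leP 1 z.
    have : Num.min 2 z <= 2 by rewrite ge_min lexx.
    have : 0 <= Num.min 2 z by rewrite le_min z0 ler0n.
    nra.
  rewrite min_r; nra.
have sN2 (x y : R) (f : R -> R) : (forall z, `|f z| <= 1) ->
    (forall x y, `|f y - f x| <= `|y - x|) -> `|f x - f y| <= Num.min 2 `|x - y|.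
  move=> f1 fL; rewrite le_min fL andbT (le_trans (ler_normB _ _))//.
  by have := f1 x; have := f1 y; lra.
(* One half for the cosine part and one for the sine part. *)
rewrite (_ : 8 * _ = 4 * (del * h) ^+ 2 + 4 * (del * h) ^+ 2); last by ring.
rewrite mulrDl /truncated_moment -RintegralZl//; last exact: integrable_truncated_sqr.
have iR := integrableZl measurableT (4 * (del * h) ^+ 2) (integrable_truncated_sqr Kh0).
have mc c : measurable_fun setT (fun x : R => cos (c * x)).
  by apply: measurableT_comp measurable_cos _; exact: measurable_funM.
have ms c : measurable_fun setT (fun x : R => sin (c * x)).
  by apply: measurableT_comp measurable_sin _; exact: measurable_funM.
have bc x : (cos ((a + del * h) * x) - cos (a * x) - del * (cos (h * x) - 1)) ^+ 2 <=
    4 * (del * h) ^+ 2 * (x ^+ 2 * Num.min 1 ((K + 1) * h * `|x|)).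
  rewrite -[X in del * (_ - X)]cos0; apply: (bnd cos (fun z => - sin z)) => y z.
  rewrite -opprD normrN; apply: sN2; first exact: norm_sin_le1.
  by move=> ? ?; exact: sin_lipschitz.
have bs x : (sin ((a + del * h) * x) - sin (a * x) - del * sin (h * x)) ^+ 2 <=
    4 * (del * h) ^+ 2 * (x ^+ 2 * Num.min 1 ((K + 1) * h * `|x|)).
  rewrite -[sin (h * x)]subr0 -[X in del * (_ - X)]sin0.
  apply: (bnd sin cos) => y z.
  apply: sN2; first exact: norm_cos_le1.
  by move=> ? ?; exact: cos_lipschitz.
have iR2 : mu.-integrable setT (EFin \o (fun x =>
    4 * (del * h) ^+ 2 * (x ^+ 2 * Num.min 1 ((K + 1) * h * `|x|)) +
    4 * (del * h) ^+ 2 * (x ^+ 2 * Num.min 1 ((K + 1) * h * `|x|)))).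
  by have := integrableD measurableT iR iR; exact: eq_integrable.
rewrite -RintegralD//.
apply: le_Rintegral => //; last by move=> x _; exact: lerD.
apply: le_norm_integrable iR2.
  apply: measurable_funD; apply: measurable_funX; apply: measurable_funB.
  - exact: measurable_funB.
  - by apply: measurable_funM => //; exact: measurable_funB.
  - exact: measurable_funB.
  - exact: measurable_funM.
by move=> x; rewrite ger0_norm ?addr_ge0 ?sqr_ge0// lerD.
Qed.

Lemma derive2_spectral : derive1n 2 r 0 = - sg2.
Proof.
have -> : derive1n 2 r = (r^`()%classic)^`()%classic by [].
have r1 : r^`()%classic = fun t => \int[mu]_x (- (x * sin (t * x))).
  apply/funext => t; rewrite derive1E.
  have := is_derive_Rintegral_cos mom2i 0 t.
  under eq_fun do under eq_Rintegral do rewrite addr0.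
  under eq_Rintegral do rewrite addr0.
  by move=> h; exact: derive_val.
rewrite r1 derive1E.
have h := is_derive_Rintegral_x_sin mom2i 0; rewrite derive_val /second_moment.
rewrite -[RHS]mulN1r -RintegralZl//.
by apply: eq_Rintegral => x _; rewrite mul0r cos0 mulr1 mulN1r.
Qed.

End spectral_measure.

Section linear_combinations.
Context {R : realType} (mu : {finite_measure set R -> \bar R}).
Context d (Omega : measurableType d) (P : probability Omega R).
Variable X : R -> {RV P >-> R}.
Local Notation r := (spectral_cov mu).
Hypotheses (X_mean : forall t : R, ('E_P[X t] = 0)%E)
  (X_gauss : gaussian_process X)
  (X_cov : forall s t : R, ('E_P[(fun w => X s w * X t w)%R] = (r (s - t))%:E)%E).
Hypothesis r0_gt0 : 0 < r 0.
Implicit Types s : seq (R * R).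

(** The covariance at equal times asserts that the integral of X_t^2 is a real number, hence
    finite. *)
Lemma L2_X t : L2 P (X t).
Proof.
split; first exact: measurable_funP.
apply/integrableP; split; first by apply/measurable_EFinP; exact: measurable_funX.
have := X_cov t t; rewrite unlock => h.
rewrite (_ : (\int[P]_w _)%E = (r (t - t))%:E) ?ltry// -h.
by apply: eq_integral => w _ /=; rewrite ger0_norm ?sqr_ge0.
Qed.

(** A pair is (coefficient, time). Lists make it possible to add a multiple of X_0 by a cons, which
    is how residuals stay in this class. *)
Definition lin s w := \sum_(p <- s) p.1 * X p.2 w.

Lemma lin_cons p s : lin (p :: s) = fun w => p.1 * X p.2 w + lin s w.
Proof. by apply/funext => w; rewrite /lin big_cons. Qed.

Lemma lin_nil : lin [::] = fun=> 0.
Proof. by apply/funext => w; rewrite /lin big_nil. Qed.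

Lemma L2_lin s : L2 P (lin s).
Proof.
elim: s => [|p s IH]; first by rewrite lin_nil; exact: L2_cst.
by rewrite lin_cons; apply: L2D => //; apply: L2Z; exact: L2_X.
Qed.

Lemma Rintegral_X t : \int[P]_w X t w = 0.
Proof. by rewrite /Rintegral -expectation_def X_mean. Qed.

Lemma Rintegral_XX t t' : \int[P]_w (X t w * X t' w) = r (t - t').
Proof.
by have := X_cov t t'; rewrite unlock /Rintegral => ->.
Qed.

Lemma Rintegral_lin0 s : \int[P]_w lin s w = 0.
Proof.
elim: s => [|p s IH]; first by rewrite lin_nil Rintegral_cst// mul0r.
rewrite lin_cons; have := @Rintegral_lin _ _ _ P _ _ p.1 1 (L2_X p.2) (L2_lin s).
under eq_Rintegral do rewrite mul1r.
by move=> ->; rewrite IH Rintegral_X !mulr0 addr0.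
Qed.

Lemma gaussian_lin s : gaussian_law (pushforward P (lin s)).
Proof.
have sz1 : size (map snd s) == size s by rewrite size_map.
have sz2 : size (map fst s) == size s by rewrite size_map.
have := X_gauss (Tuple sz1) (Tuple sz2); congr gaussian_law; congr pushforward.
apply/funext => w; rewrite /lin (big_nth 0) big_mkord; apply: eq_bigr => i _.
by rewrite !(tnth_nth 0)/= !(nth_map 0)// /Tuple.
Qed.

Definition lin_cos s x := \sum_(p <- s) p.1 * cos (p.2 * x) : R.
Definition lin_sin s x := \sum_(p <- s) p.1 * sin (p.2 * x) : R.

Let L2_bounded (f : R -> R) M : measurable_fun setT f -> (forall x, `|f x| <= M) -> L2 mu f.
Proof.
move=> mf fM; split => //; apply: (@le_bounded_integrable _ _ _ mu _ (M ^+ 2)).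
  exact: measurable_funX.
move=> x; rewrite ger0_norm ?sqr_ge0// -[f x ^+ 2]real_normK ?num_real//.
by rewrite ler_sqr ?nnegrE// (le_trans _ (fM x)).
Qed.

Let L2_cos t : L2 mu (fun x => cos (t * x)).
Proof.
apply: (@L2_bounded _ 1) => [|x]; last exact: norm_cos_le1.
by apply: measurableT_comp measurable_cos _; exact: measurable_funM.
Qed.

Let L2_sin t : L2 mu (fun x => sin (t * x)).
Proof.
apply: (@L2_bounded _ 1) => [|x]; last exact: norm_sin_le1.
by apply: measurableT_comp measurable_sin _; exact: measurable_funM.
Qed.

Let L2_lin_cos s : L2 mu (lin_cos s).
Proof.
elim: s => [|p s IH].
  by rewrite /lin_cos; under eq_fun do rewrite big_nil; exact: L2_cst.
rewrite /lin_cos; under eq_fun do rewrite big_cons.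
by apply: L2D => //; exact: L2Z.
Qed.

Let L2_lin_sin s : L2 mu (lin_sin s).
Proof.
elim: s => [|p s IH].
  by rewrite /lin_sin; under eq_fun do rewrite big_nil; exact: L2_cst.
rewrite /lin_sin; under eq_fun do rewrite big_cons.
by apply: L2D => //; exact: L2Z.
Qed.

Let Rintegral_bilin d' (T : measurableType d') (nu : {finite_measure set T -> \bar R})
    (f g k : T -> R) c : L2 nu f -> L2 nu g -> L2 nu k ->
  \int[nu]_w ((c * f w + g w) * k w) =
  c * \int[nu]_w (f w * k w) + \int[nu]_w (g w * k w).
Proof.
move=> Lf Lg Lk; rewrite -RintegralZl//; last exact: L2_mul.
rewrite -RintegralD//; last exact: L2_mul.
  by apply: eq_Rintegral => w _; rewrite mulrDl mulrA.
by have := integrableZl measurableT c (L2_mul Lf Lk); exact: eq_integrable.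
Qed.

(* The map sending [X t] to [x |-> e^{itx}] is an isometry into the complex
   [L^2(mu)]; here it is written with real and imaginary parts. *)
Lemma lin_isometry s s' : \int[P]_w (lin s w * lin s' w) =
  \int[mu]_x (lin_cos s x * lin_cos s' x) + \int[mu]_x (lin_sin s x * lin_sin s' x).
Proof.
(* Bilinear expansion for an arbitrary family e. It is used for X under P and for cos(t x) and sin(t
   x) under mu; the coefficients then match by the subtraction formula for the cosine. *)
have bil d' (T : measurableType d') (nu : {finite_measure set T -> \bar R})
    (e : R -> T -> R) (F := fun s x => \sum_(p <- s) p.1 * e p.2 x) :
    (forall t, L2 nu (e t)) -> forall s s',
    \int[nu]_x (F s x * F s' x) = \sum_(p <- s) \sum_(q <- s')
      p.1 * q.1 * \int[nu]_x (e p.2 x * e q.2 x).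
  move=> Le.
  have LF u : L2 nu (F u).
    elim: u => [|p u IH]; rewrite /F.
      by under eq_fun do rewrite big_nil; exact: L2_cst.
    by under eq_fun do rewrite big_cons; apply: L2D => //; exact: L2Z.
  have F1 t u : \int[nu]_x (F u x * e t x) = \sum_(q <- u) q.1 * \int[nu]_x (e q.2 x * e t x).
    elim: u => [|q u IH].
      rewrite big_nil /F; under eq_Rintegral do rewrite big_nil mul0r.
      by rewrite Rintegral_cst// mul0r.
    rewrite big_cons -IH -(Rintegral_bilin q.1 (Le q.2) (LF u) (Le t)).
    by apply: eq_Rintegral => x _; rewrite /F big_cons.
  move=> {}s {}s'; elim: s => [|p s IH].
    rewrite big_nil /F; under eq_Rintegral do rewrite big_nil mul0r.
    by rewrite Rintegral_cst// mul0r.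
  transitivity (p.1 * \int[nu]_x (e p.2 x * F s' x) + \int[nu]_x (F s x * F s' x)).
    rewrite -(Rintegral_bilin p.1 (Le p.2) (LF s) (LF s')).
    by apply: eq_Rintegral => x _; rewrite /F big_cons.
  rewrite big_cons IH; congr (_ + _).
  under eq_Rintegral do rewrite mulrC.
  rewrite F1 big_distrr/=; apply: eq_bigr => q _; rewrite mulrA.
  by congr (_ * _); apply: eq_Rintegral => x _; rewrite mulrC.
rewrite (bil _ _ P (fun t w => X t w) L2_X) (bil _ _ mu (fun t x => cos (t * x)) L2_cos).
rewrite (bil _ _ mu (fun t x => sin (t * x)) L2_sin) -big_split/=.
apply: eq_bigr => p _; rewrite -big_split/=; apply: eq_bigr => q _.
rewrite Rintegral_XX -mulrDr; congr (_ * _).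
rewrite -RintegralD//; [|exact: L2_mul|exact: L2_mul].
by apply: eq_Rintegral => x _; rewrite mulrBl cosB.
Qed.

Lemma lin_norm s : \int[P]_w (lin s w ^+ 2) =
  \int[mu]_x (lin_cos s x ^+ 2 + lin_sin s x ^+ 2).
Proof.
rewrite RintegralD//; [|exact: (L2_lin_cos s).2|exact: (L2_lin_sin s).2].
exact: lin_isometry.
Qed.

(** The part of [lin s] orthogonal to X_0 in L^2(P); for s consisting of (1, t) it is the Y_t of the
    decomposition. *)
Definition residual s w := lin s w - (\int[P]_w (lin s w * X 0 w)) / r 0 * X 0 w.

Lemma residualE s : residual s =
  lin ((- ((\int[P]_w (lin s w * X 0 w)) / r 0), 0) :: s).
Proof. by rewrite lin_cons; apply/funext => w; rewrite /residual addrC mulNr. Qed.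

Lemma L2_residual s : L2 P (residual s).
Proof. by rewrite residualE; exact: L2_lin. Qed.

Lemma residual_uncorrelated s : \int[P]_w (X 0 w * residual s w) = 0.
Proof.
set c := \int[P]_w (lin s w * X 0 w).
have := Rintegral_bilin (- (c / r 0)) (L2_X 0) (L2_lin s) (L2_X 0).
rewrite Rintegral_XX subrr -/c => h.
transitivity (- (c / r 0) * r 0 + c).
  rewrite -h; apply: eq_Rintegral => w _; rewrite /residual -/c; ring.
by rewrite mulNr divfK ?gt_eqF// addNr.
Qed.

(** Pythagoras: the projection on X_0 removes c^2 / r(0). *)
Lemma residual_norm_le s :
  \int[P]_w (residual s w ^+ 2) <= \int[P]_w (lin s w ^+ 2).
Proof.
set c := \int[P]_w (lin s w * X 0 w).
have -> : \int[P]_w (residual s w ^+ 2) =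
    \int[P]_w ((1 * lin s w + (- (c / r 0)) * X 0 w) ^+ 2).
  by apply: eq_Rintegral => w _; rewrite mul1r mulNr.
rewrite (Rintegral_sqrD 1 (- (c / r 0)) (L2_lin s) (L2_X 0)) expr1n mul1r -/c.
have -> : \int[P]_w (X 0 w ^+ 2) = r 0.
  by rewrite -[in RHS](subrr 0) -Rintegral_XX.
have -> : (- (c / r 0)) ^+ 2 * r 0 = c ^+ 2 / r 0 by field; rewrite gt_eqF.
have : 0 <= c ^+ 2 / r 0 by rewrite divr_ge0 ?sqr_ge0// ltW.
have -> : 2 * 1 * (- (c / r 0)) * c = - 2 * (c ^+ 2 / r 0) by ring.
lra.
Qed.

(** Combinations of X_0 and V are again of the form [lin], hence Gaussian, so orthogonality yields
    independence. V is given through an equation in order that any packaging of the function as a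
    random variable fits. *)
Lemma residual_independent s (V : {RV P >-> R}) c :
  (V : Omega -> R) = (fun w => c * residual s w) -> independent (X 0) V.
Proof.
move=> VE; apply: uncorrelated_gaussian_independent.
- move=> a b; have := gaussian_lin ((a, 0) :: map (fun p => (b * c * p.1, p.2))
    ((- ((\int[P]_w (lin s w * X 0 w)) / r 0), 0) :: s)).
  congr gaussian_law; congr pushforward; apply/funext => w.
  rewrite VE residualE lin_cons /lin big_map !big_distrr; congr (_ + _).
  by apply: eq_bigr => p _ /=; rewrite !mulrA.
- exact: L2_X.
- by rewrite VE; apply: L2Z; exact: L2_residual.
- exact: Rintegral_X.
- rewrite VE residualE RintegralZl//; first by rewrite Rintegral_lin0 mulr0.
  exact/L2_integrable/L2_lin.
- rewrite VE (@eq_Rintegral _ _ _ P _ (fun w => c * (X 0 w * residual s w))).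
    rewrite RintegralZl//; first by rewrite residual_uncorrelated mulr0.
    by apply: L2_mul; [exact: L2_X|exact: L2_residual].
  by move=> w _; ring.
Qed.

End linear_combinations.

Section increments.
Context {R : realType} (mu : {finite_measure set R -> \bar R}).
Context d (Omega : measurableType d) (P : probability Omega R).
Variable X : R -> {RV P >-> R}.
Local Notation r := (spectral_cov mu).
Hypotheses (X_mean : forall t : R, ('E_P[X t] = 0)%E)
  (X_gauss : gaussian_process X)
  (X_cov : forall s t : R, ('E_P[(fun w => X s w * X t w)%R] = (r (s - t))%:E)%E).
Hypothesis r0_gt0 : 0 < r 0.
Hypothesis mom2 : L2 mu (@idfun R).
Hypothesis X_cont : continuous_paths X.
Local Notation residual := (residual mu X).

Let L2_lin_ := L2_lin X_cov.

Lemma residual_cons p s w :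
  residual (p :: s) w = p.1 * residual [:: (1, p.2)] w + residual s w.
Proof.
have lin1 t : lin X [:: (1, t)] = X t :> (Omega -> R).
  by rewrite lin_cons lin_nil; apply/funext => v; rewrite mul1r addr0.
rewrite /residual lin1 lin_cons.
have -> : \int[P]_v ((p.1 * X p.2 v + lin X s v) * X 0 v) =
    p.1 * \int[P]_v (X p.2 v * X 0 v) + \int[P]_v (lin X s v * X 0 v).
  rewrite -RintegralZl//; last by apply: L2_mul; exact: L2_X X_cov _.
  rewrite -RintegralD//; last by apply: L2_mul; [exact: L2_lin_|exact: L2_X X_cov _].
    by apply: eq_Rintegral => v _; ring.
  have i := L2_mul (L2_X X_cov p.2) (L2_X X_cov 0).
  by have := integrableZl measurableT p.1 i; exact: eq_integrable.
by field; rewrite gt_eqF.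
Qed.

Lemma residual_nil w : residual [::] w = 0.
Proof.
rewrite /residual lin_nil; under eq_Rintegral do rewrite mul0r.
by rewrite Rintegral_cst// !mul0r subrr.
Qed.

Lemma residual1E t w : residual [:: (1, t)] w = X t w - r t / r 0 * X 0 w.
Proof.
rewrite /residual.
have -> : lin X [:: (1, t)] = X t :> (Omega -> R).
  by rewrite lin_cons lin_nil; apply/funext => v; rewrite mul1r addr0.
by rewrite (Rintegral_XX X_cov) subr0.
Qed.

(* The deviation of the rescaled residual [t |-> Y (t h) / h] from its linear
   interpolation [t |-> t Y(h) / h]. *)
Definition deviation h t w :=
  h^-1 * (residual [:: (1, t * h)] w - t * residual [:: (1, h)] w).

Lemma deviation0 h w : deviation h 0 w = 0.
Proof.
by rewrite /deviation mul0r residual1E divff ?gt_eqF// mul1r subrr mul0r subrr mulr0.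
Qed.

(** X_0 has residual 0, so the last pair leaves the residual unchanged. On the spectral side it
    turns e^{ihx} into e^{ihx} - 1, as [spectral_increment_le] requires. *)
Let increment (h a b : R) : seq (R * R) :=
  [:: (1, b * h); (-1, a * h); (- (b - a), h); (b - a, 0)].

Lemma deviation_increment h a b w :
  deviation h b w - deviation h a w = h^-1 * residual (increment h a b) w.
Proof.
have -> : residual (increment h a b) w =
    1 * residual [:: (1, b * h)] w + (-1 * residual [:: (1, a * h)] w +
    (- (b - a) * residual [:: (1, h)] w + ((b - a) * residual [:: (1, 0)] w + 0))).
  rewrite [LHS]residual_cons; congr (_ + _); rewrite [LHS]residual_cons; congr (_ + _).
  rewrite [LHS]residual_cons; congr (_ + _); rewrite [LHS]residual_cons; congr (_ + _).
  exact: residual_nil.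
rewrite [residual [:: (1, 0)] w]residual1E divff ?gt_eqF// !mul1r subrr.
by rewrite /deviation -mulrBr; congr (_ * _); ring.
Qed.

Lemma measurable_deviation h t : measurable_fun setT (deviation h t).
Proof.
apply: measurable_funM => //; apply: measurable_funB.
  exact: (L2_residual X_cov _).1.
by apply: measurable_funM => //; exact: (L2_residual X_cov _).1.
Qed.

(** The projection is discarded first: the norm of the full combination is explicit by the isometry,
    and already small enough. *)
Lemma increment_norm_le h a b K : 0 < h -> 0 <= K -> `|a| <= K -> `|b| <= K ->
  \int[P]_w (residual (increment h a b) w ^+ 2) <=
  8 * ((b - a) * h) ^+ 2 * truncated_moment mu ((K + 1) * h).
Proof.
move=> h0 K0 aK bK; apply: le_trans (residual_norm_le X_cov r0_gt0 _) _.
rewrite (lin_norm X_cov).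
have ah : `|a * h| <= K * h by rewrite normrM (gtr0_norm h0) ler_wpM2r// ltW.
have bh : `|a * h + (b - a) * h| <= K * h.
  by rewrite -mulrDl addrC subrK normrM (gtr0_norm h0) ler_wpM2r// ltW.
apply: le_trans (spectral_increment_le mom2 h0 K0 ah bh).
rewrite le_eqVlt; apply/orP; left; apply/eqP; apply: eq_Rintegral => x _.
rewrite /lin_cos /lin_sin /increment !big_cons !big_nil /= mul0r cos0 sin0.
have -> : a * h + (b - a) * h = b * h by ring.
ring.
Qed.

Let B u := [set w | u < X 0 w].

Let measurable_tail u : measurable (B u).
Proof.
rewrite (_ : B u = X 0 @^-1` `]u, +oo[).
  by rewrite -[X in measurable X]setTI; exact: measurable_funP.
by apply/seteqP; split => w /=; rewrite in_itv/= andbT.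
Qed.

(** By independence the left side is P(B u) E|V|, and E|V| is at most kappa because E V^2 is at most
    kappa^2. An unconditional bound thus survives conditioning on an event of vanishing
    probability. *)
Lemma independent_abs_le u (V : {RV P >-> R}) kappa : 0 < kappa ->
  independent (X 0) V -> L2 P V -> \int[P]_w (V w ^+ 2) <= kappa ^+ 2 ->
  (\int[P]_w (\1_(B u) w * `|V w|)%:E <= kappa%:E * P (B u))%E.
Proof.
move=> k0 iXV LV V2.
pose U := [set x : R | u < x].
have mU : measurable U.
  rewrite (_ : U = `]u, +oo[%classic); first exact: measurable_itv.
  by apply/seteqP; split => x /=; rewrite in_itv/= andbT.
have mV : measurable_fun setT (fun x : R => `|x|%:E).
  by apply/measurable_EFinP.
have mh : measurable_fun setT (fun z : R * R => (\1_U z.1 * `|z.2|)%:E).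
  apply/measurable_EFinP; apply: measurable_funM.
    by apply: measurableT_comp => //; exact: measurable_indic.
  exact: measurableT_comp.
have h0 (z : R * R) : (0 <= (\1_U z.1 * `|z.2|)%:E)%E by rewrite lee_fin mulr_ge0.
have -> : (\int[P]_w (\1_(B u) w * `|V w|)%:E =
    \int[P]_w (\1_U (X 0 w) * `|V w|)%:E)%E by [].
rewrite (independent_integralE iXV mh h0).
have inner v : (\int[distribution P (X 0)]_x (\1_U (x, v).1 * `|(x, v).2|)%:E =
    P (B u) * `|v|%:E)%E.
  under eq_integral do rewrite EFinM /=.
  rewrite ge0_integralZr//; last 2 first.
  - by apply/measurable_EFinP; exact: measurable_indic.
  - by rewrite lee_fin.
  by rewrite integral_indic// setIT.
under eq_integral do rewrite inner.
rewrite ge0_integralZl//.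
rewrite [leLHS]muleC; apply: lee_wpmul2r => //.
rewrite ge0_integral_distribution//.
have iV : P.-integrable setT (EFin \o (fun w => `|V w|)).
  by have := L2_integrable LV; exact: integrable_norm.
rewrite (_ : integral _ _ _ = (\int[P]_w `|V w|)%:E); last first.
  by rewrite /Rintegral fineK//; exact: integrable_fin_num.
rewrite lee_fin.
have i2 : P.-integrable setT (EFin \o (fun w => (2 * kappa)^-1 * V w ^+ 2)).
  by have := integrableZl measurableT (2 * kappa)^-1 LV.2; exact: eq_integrable.
have i3 : P.-integrable setT (EFin \o (fun w => kappa / 2 : R)).
  exact: finite_measure_integrable_cst.
(* AM-GM: [|v| <= v^2 / (2 kappa) + kappa / 2] *)
apply: (@le_trans _ _ (\int[P]_w ((2 * kappa)^-1 * V w ^+ 2 + kappa / 2))).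
  apply: le_Rintegral => //.
    by have := integrableD measurableT i2 i3; exact: eq_integrable.
  move=> w _; rewrite -[V w ^+ 2]real_normK ?num_real//.
  rewrite mulrC -subr_ge0 (_ : _ - _ = (`|V w| - kappa) ^+ 2 / (2 * kappa)).
    by rewrite divr_ge0 ?sqr_ge0// mulr_ge0// ltW.
  by field; rewrite gt_eqF.
rewrite RintegralD// RintegralZl//; last exact: LV.2.
rewrite Rintegral_cst//= probability_setT mulr1.
have := ler_wpM2l (_ : 0 <= (2 * kappa)^-1) V2.
rewrite invr_ge0 mulr_ge0 ?(ltW k0)// => /(_ isT).
rewrite (_ : (2 * kappa)^-1 * kappa ^+ 2 = kappa / 2); first lra.
by field; rewrite gt_eqF.
Qed.

Lemma deviation_increment_le h a b K kappa u : 0 < h -> 0 <= K ->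
  `|a| <= K -> `|b| <= K -> 0 < kappa ->
  8 * truncated_moment mu ((K + 1) * h) <= kappa ^+ 2 -> a != b ->
  (\int[P]_w (\1_(B u) w * `|deviation h b w - deviation h a w|)%:E <=
   (kappa * `|b - a|)%:E * P (B u))%E.
Proof.
move=> h0 K0 aK bK k0 hk ab.
have mV : measurable_fun setT (fun w => h^-1 * residual (increment h a b) w).
  by apply: measurable_funM => //; exact: (L2_residual X_cov _).1.
pose V : {RV P >-> R} := HB.pack (fun w => h^-1 * residual (increment h a b) w)
  (isMeasurableFun.Build _ _ _ _ _ mV).
under eq_integral do rewrite deviation_increment.
apply: (@independent_abs_le u V (kappa * `|b - a|)).
- by rewrite mulr_gt0// normr_gt0 subr_eq0 eq_sym.
- exact: (residual_independent X_mean X_gauss X_cov r0_gt0).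
- by apply: L2Z; exact: L2_residual X_cov _.
- under eq_Rintegral do rewrite exprMn.
  rewrite RintegralZl//; last exact: (L2_residual X_cov _).2.
  have := ler_wpM2l (sqr_ge0 h^-1) (increment_norm_le h0 K0 aK bK).
  move=> /le_trans; apply.
  rewrite [(kappa * _) ^+ 2]exprMn real_normK ?num_real//.
  rewrite [leLHS](_ : _ = 8 * truncated_moment mu ((K + 1) * h) * (b - a) ^+ 2).
    by rewrite ler_wpM2r// sqr_ge0.
  by field; rewrite gt_eqF.
Qed.

Let grid_variation h c n w := \sum_(i < n.+1)
  `|deviation h (c * (i.+1%:R / n.+1%:R)) w - deviation h (c * (i%:R / n.+1%:R)) w|.

Let grid_deviation_le h c n w (j : nat) : (j <= n.+1)%N ->
  `|deviation h (c * (j%:R / n.+1%:R)) w| <= grid_variation h c n w.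
Proof.
move=> jn.
have : `|deviation h (c * (j%:R / n.+1%:R)) w| <= \sum_(i < j)
    `|deviation h (c * (i.+1%:R / n.+1%:R)) w - deviation h (c * (i%:R / n.+1%:R)) w|.
  elim: j jn => [|j IH] jn; first by rewrite mul0r mulr0 deviation0 normr0 big_ord0.
  rewrite big_ord_recr/=; have := IH (ltnW jn).
  set A := deviation _ _ _ => h1; set C := deviation _ _ _.
  by rewrite -[C](subrK A) addrC (le_trans (ler_normD _ _))// lerD// subrK.
move=> /le_trans; apply; rewrite /grid_variation.
rewrite (big_ord_widen _ (fun i => `|deviation h (c * (i.+1%:R / n.+1%:R)) w -
  deviation h (c * (i%:R / n.+1%:R)) w|) jn).
by rewrite [leRHS](bigID (fun i : 'I_n.+1 => (i < j)%N))/= lerDl sumr_ge0.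
Qed.

Let continuous_deviation h w : continuous (fun t => deviation h t w).
Proof.
rewrite /deviation; under eq_fun do rewrite residual1E.
move=> t; have ch : (fun t => t * h) x @[x --> t] --> t * h.
  by apply: cvgM; [exact: cvg_id|exact: cvg_cst].
have cr : continuous r.
  move=> s; apply/differentiable_continuous/derivable1_diffP.
  have := is_derive_Rintegral_cos mom2.2 0 s.
  by under eq_fun do under eq_Rintegral do rewrite addr0; move=> ?; exact: ex_derive.
apply: cvgM; first exact: cvg_cst.
apply: cvgB; last by apply: cvgM; [exact: cvg_id|exact: cvg_cst].
apply: cvgB.
  apply: (@cvg_comp _ _ _ (fun x => x * h) (fun x => X x w) _ _ _ ch).
  exact: X_cont.
apply: cvgM; last exact: cvg_cst.
apply: cvgM; last exact: cvg_cst.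
apply: (@cvg_comp _ _ _ (fun x => x * h) r _ _ _ ch).
exact: cr.
Qed.

(* The increments of the deviation over [a, b] are [O(kappa |b - a|)] in [L^1], so
   its variation along every grid of [0, c] has mean at most [kappa |c|],
   uniformly in the mesh: no chaining is needed. *)
Lemma deviation_sup_le h c kappa eta u : 0 < h -> c != 0 -> 0 < kappa -> 0 < eta ->
  8 * truncated_moment mu ((`|c| + 1) * h) <= kappa ^+ 2 ->
  exists N : set Omega, [/\ measurable N,
    (P (N `&` B u) <= (kappa * `|c| / eta)%:E * P (B u))%E &
    forall w, ~ N w -> forall th, 0 <= th <= 1 -> `|deviation h (c * th) w| <= eta].
Proof.
move=> h0 c0 k0 e0 hk.
pose A n := [set w | eta < grid_variation h c n w].
have mD (i n : nat) : measurable_fun setT (fun w =>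
    `|deviation h (c * (i.+1%:R / n.+1%:R)) w - deviation h (c * (i%:R / n.+1%:R)) w|).
  by apply: measurableT_comp => //; apply: measurable_funB; exact: measurable_deviation.
have mA n : measurable (A n).
  rewrite (_ : A n = grid_variation h c n @^-1` `]eta, +oo[); last first.
    by apply/seteqP; split => w /=; rewrite in_itv/= andbT.
  rewrite -[X in measurable X]setTI; apply: measurable_sum => // i; exact: mD.
have mB := measurable_tail u.
(* Markov's inequality on B u: the n + 1 increments have mean at most kappa |c| / (n + 1) times P(B
   u) each. *)
have PA n : (P (A n `&` B u) <= (kappa * `|c| / eta)%:E * P (B u))%E.
  rewrite (_ : kappa * `|c| / eta = eta^-1 * (kappa * `|c|)); last by rewrite mulrC.
  rewrite EFinM -muleA lee_pdivlMl//.
  have mAB : measurable (A n `&` B u) by exact: measurableI.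
  have -> : (eta%:E * P (A n `&` B u) = \int[P]_w (eta * \1_(A n `&` B u) w)%:E)%E.
    under eq_integral do rewrite EFinM.
    rewrite ge0_integralZl ?integral_indic ?setIT// ?lee_fin ?ltW//.
    by apply/measurable_EFinP; exact: measurable_indic.
  apply: (@le_trans _ _ (\int[P]_w \sum_(i < n.+1) (\1_(B u) w *
    `|deviation h (c * (i.+1%:R / n.+1%:R)) w - deviation h (c * (i%:R / n.+1%:R)) w|)%:E)%E).
    apply: ge0_le_integral => //.
    - by move=> w _; rewrite lee_fin mulr_ge0// ltW.
    - by apply/measurable_EFinP; apply: measurable_funM => //; exact: measurable_indic.
    - apply: emeasurable_sum => i; apply/measurable_EFinP.
      by apply: measurable_funM; [exact: measurable_indic|exact: mD].
    move=> w _; rewrite sumEFin lee_fin -mulr_sumr -/(grid_variation h c n w).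
    rewrite indicI /=; have [wA|wA] := boolP (w \in A n); last first.
      rewrite indicE (negbTE wA) mul0r mulr0 mulr_ge0//.
      by apply: sumr_ge0 => i _.
    rewrite indicE wA mul1r mulrC ler_wpM2l//.
    by move: wA; rewrite inE /A/= => /ltW.
  rewrite ge0_integral_sum//; last first.
    move=> i; apply/measurable_EFinP.
    by apply: measurable_funM; [exact: measurable_indic|exact: mD].
  pose p := fine (P (B u)).
  have pE : P (B u) = p%:E by rewrite fineK// fin_num_measure.
  apply: (@le_trans _ _ (\sum_(i < n.+1) (kappa * (`|c| / n.+1%:R) * p)%:E)%E).
    apply: lee_sum => i _; rewrite [leRHS]EFinM -pE.
    have frac (k : nat) : (k <= n.+1)%N -> `|c * (k%:R / n.+1%:R)| <= `|c|.
      move=> kn; rewrite normrM ler_piMr// ger0_norm// ler_pdivrMr ?ltr0n//.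
      by rewrite mul1r ler_nat.
    have dif : c * (i.+1%:R / n.+1%:R) - c * (i%:R / n.+1%:R) = c / n.+1%:R.
      by rewrite -mulrBr -mulrBl -natrB// subSn// subnn mul1r.
    have -> : `|c| / n.+1%:R =
        `|c * (i.+1%:R / n.+1%:R) - c * (i%:R / n.+1%:R)| :> R.
      by rewrite dif normrM [X in _ = _ * X]ger0_norm.
    apply: (@deviation_increment_le h (c * (i%:R / n.+1%:R))
      (c * (i.+1%:R / n.+1%:R)) `|c| kappa u) => //.
    + exact/frac/ltnW/ltn_ord.
    + exact/frac/ltn_ord.
    + by rewrite eq_sym -subr_eq0 dif mulf_neq0// invr_neq0// pnatr_eq0.
  rewrite sumEFin sumr_const card_ord pE -EFinM lee_fin [leLHS](_ : _ = kappa * `|c| * p)//.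
  by rewrite -[LHS]mulr_natl; field; rewrite ?nat1r ?natr1 pnatr_eq0.
(* The grids with n + 1 cells are not nested, so the events [A n] are not monotone and their union
   is out of control. Their lower limit is an increasing union of the [C n], each contained in
   [A n], and keeps the same bound. *)
pose C n := \bigcap_(m in [set m | (n <= m)%N]) A m.
have mC n : measurable (C n).
  by apply: bigcap_measurable => [|? ?]; [exists n => /=|exact: mA].
pose N := \bigcup_n C n.
exists N; split.
- exact: bigcupT_measurable.
- rewrite setI_bigcupl.
  have cvN : P (C n `&` B u) @[n --> \oo] --> P (\bigcup_n (C n `&` B u)).
    apply: nondecreasing_cvg_mu.
    + by move=> n; exact: measurableI.
    + by apply: bigcupT_measurable => n; exact: measurableI.
    + move=> n m nm; apply/subsetPset; apply: setSI => w Cw k /= mk.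
      by apply: Cw => /=; exact: leq_trans mk.
  rewrite -(cvg_lim _ cvN)//; apply: lime_le; first by apply/cvg_ex; eexists; exact: cvN.
  apply: nearW => n; apply: le_trans (PA n); apply: le_measure; rewrite ?inE//.
  + exact: measurableI.
  + exact: measurableI.
  + by apply: setSI => w; apply => /=.
(* Off the lower limit there are arbitrarily fine grids of variation at most eta. A deviation above
   eta at [c * th] would by continuity persist at a neighbouring point of such a grid. *)
- move=> w Nw th /andP[th0 th1]; rewrite leNgt; apply/negP => dev.
  have : \forall x \near c * th, eta < `|deviation h x w|.
    have cD : (deviation h)^~ w x @[x --> c * th] --> deviation h (c * th) w.
      exact: continuous_deviation.
    exact: (@cvgr_norm_gt _ R^o _ _ _ _ _ cD eta dev).
  move=> -[e /= ep He].
  have [n cn] : exists n : nat, `|c| / n.+1%:R < e.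
    exists (Num.bound (`|c| / e)); rewrite ltr_pdivrMr ?ltr0n// mulrC -ltr_pdivrMr//.
    rewrite (lt_trans (archi_boundP _)) ?divr_ge0// ?(ltW ep)//.
    by rewrite ltr_nat.
  have [m nm Am] : exists2 m, (n <= m)%N & ~ A m w.
    apply: contrapT => H; apply: Nw; exists n => // m /= nm.
    by apply: contrapT => Am; apply: H; exists m.
  have m1 : (0 : R) < m.+1%:R by [].
  have xm0 : 0 <= th * m.+1%:R by rewrite mulr_ge0.
  pose j := Num.truncn (th * m.+1%:R).
  have /andP[j1 j2] := truncn_itv xm0; rewrite -/j in j1 j2.
  have jm : (j <= m.+1)%N.
    by rewrite -(ler_nat R) (le_trans j1)// ler_piMl.
  apply: Am; rewrite /A/=; apply: lt_le_trans (grid_deviation_le h c w jm).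
  apply: He => /=; apply: le_lt_trans cn.
  rewrite -mulrBr normrM ler_wpM2l//.
  apply: (@le_trans _ _ m.+1%:R^-1); last by rewrite lef_pV2 ?posrE ?ltr0n// ler_nat.
  rewrite -(@ler_pM2r _ m.+1%:R)// mulVf ?gt_eqF// -[X in _ * X]gtr0_norm// -normrM.
  rewrite mulrBl divfK ?gt_eqF//; rewrite -natr1 in j2.
  by rewrite ger0_norm; lra.
Qed.

End increments.

(** * Hitting times *)

Section hitting_time.
Context {R : realType}.
Implicit Types (p : R -> R) (u t : R).

Definition hit p u : \bar R := ereal_inf [set t%:E | t in [set t | 0 <= t /\ p t <= u]].

Lemma tau_plusE d (Omega : measurableType d) (P : probability Omega R)
  (X : R -> {RV P >-> R}) u w : tau_plus X u w = hit (fun t => X t w) u.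
Proof. by []. Qed.

(** Time reversal: both ends of the excursion are handled by [hit]. *)
Lemma tau_minusE d (Omega : measurableType d) (P : probability Omega R)
  (X : R -> {RV P >-> R}) u w : tau_minus X u w = (- hit (fun t => X (- t)%R w) u)%E.
Proof.
rewrite /hit /ereal_inf oppeK /tau_minus; congr ereal_sup.
apply/seteqP; split => [_ [t [t0 Xt] <-]|_ [_ [t [t0 Xt] <-] <-]] /=.
  by exists (- t)%:E; [exists (- t) => //; rewrite oppr_ge0 opprK|rewrite EFinN oppeK].
by exists (- t) => //; rewrite oppr_le0.
Qed.

Lemma hit_ge0 p u : (0 <= hit p u)%E.
Proof. by apply: le_ereal_inf_tmp => _ [t [t0 _] <-]; rewrite lee_fin. Qed.

(** The rescaled path lies between the parabola lowered by eta and the parabola raised by eta, so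
    its hitting time lies between their positive roots. The condition eta < x makes both start above
    the level; the bound K keeps the larger root within the range of the approximation. *)
Lemma hit_parabola p u c x v eta K : 0 < u -> 0 < c -> 0 <= eta < x ->
  (v + Num.sqrt (v ^+ 2 + 4 * c * (x + eta))) / (2 * c) <= K ->
  (forall t, 0 <= t <= K -> `|u * (p (t / u) - u) - (x + t * v - c * t ^+ 2)| <= eta) ->
  (((v + Num.sqrt (v ^+ 2 + 4 * c * (x - eta))) / (2 * c) / u)%:E <= hit p u <=
   ((v + Num.sqrt (v ^+ 2 + 4 * c * (x + eta))) / (2 * c) / u)%:E)%E.
Proof.
move=> u0 c0 /andP[e0 ex] bK hp.
pose D y := Num.sqrt (v ^+ 2 + 4 * c * y).
have D0 y : 0 <= D y by exact: sqrtr_ge0.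
have D2 y : 0 <= y -> D y ^+ 2 = v ^+ 2 + 4 * c * y.
  by move=> y0; rewrite sqr_sqrtr// addr_ge0 ?sqr_ge0// mulr_ge0// mulr_ge0// ltW.
have Dv y : 0 <= y -> `|v| <= D y.
  by move=> y0; rewrite -sqrtr_sqr ler_wsqrtr// lerDl mulr_ge0// mulr_ge0// ltW.
have Dmono y z : y <= z -> D y <= D z.
  by move=> yz; rewrite ler_wsqrtr// lerD2l ler_wpM2l// mulr_ge0// ltW.
rewrite -/(D (x + eta)) in bK.
rewrite -/(D (x - eta)) -/(D (x + eta)).
have xe : 0 <= x + eta by lra.
have c20 : 0 < 2 * c by lra.
have b0 : 0 <= (v + D (x + eta)) / (2 * c).
  by rewrite divr_ge0 ?(ltW c20)//; have := Dv _ xe; rewrite ler_norml; lra.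
apply/andP; split.
- apply: le_ereal_inf_tmp => _ [t [t0 pt] <-]; rewrite lee_fin leNgt; apply/negP => ta.
  have xme : 0 <= x - eta by lra.
  set s := D (x - eta) in ta.
  have s2 : s ^+ 2 = v ^+ 2 + 4 * c * (x - eta) by exact: D2.
  have sv : `|v| < s.
    rewrite -(@ltr_pXn2r _ 2)// ?nnegrE ?D0// s2 real_normK ?num_real//.
    by rewrite ltrDl mulr_gt0 ?subr_gt0//; lra.
  have tu : t * u < (v + s) / (2 * c) by rewrite -ltr_pdivlMr.
  have tu0 : 0 <= t * u by rewrite mulr_ge0// ltW.
  have tK : 0 <= t * u <= K.
    rewrite tu0 (le_trans (ltW tu))// (le_trans _ bK)// ler_wpM2r ?invr_ge0 ?(ltW c20)//.
    by rewrite lerD2l; apply: Dmono; lra.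
  have := hp _ tK; rewrite mulfK ?gt_eqF// ler_norml => /andP[h1 _].
  have : u * (p t - u) <= 0 by rewrite pmulr_rle0// subr_le0.
  move: h1; set z := t * u in tu tu0 *.
  (* Factorization of the lowered parabola over its roots: strictly before the positive root the
     path is above u. *)
  have -> : x + z * v - c * z ^+ 2 = eta + c * ((v + s) / (2 * c) - z) * (z - (v - s) / (2 * c)).
    have -> : x = eta + (s ^+ 2 - v ^+ 2) / (4 * c).
      by rewrite s2; field; rewrite gt_eqF.
    by field; rewrite gt_eqF.
  have h2 : 0 < c * ((v + s) / (2 * c) - z) by rewrite mulr_gt0// subr_gt0.
  have h3 : 0 < z - (v - s) / (2 * c).
    rewrite subr_gt0 (lt_le_trans _ tu0)// pmulr_llt0 ?invr_gt0// subr_lt0.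
    by rewrite (le_lt_trans (ler_norm v)).
  have := mulr_gt0 h2 h3; lra.
- apply: ge_ereal_inf; exists ((v + D (x + eta)) / (2 * c) / u)%:E => //.
  exists ((v + D (x + eta)) / (2 * c) / u) => //; split.
    by rewrite divr_ge0// ltW.
  have := hp ((v + D (x + eta)) / (2 * c)); rewrite b0 bK => /(_ isT).
  set b := _ / (2 * c); rewrite ler_norml => /andP[_].
  (* At the root b of the raised parabola the unperturbed one equals -eta, so the path is at most u
     there. *)
  have -> : x + b * v - c * b ^+ 2 = - eta.
    have -> : x = (D (x + eta) ^+ 2 - v ^+ 2) / (4 * c) - eta.
      by rewrite D2//; field; rewrite gt_eqF.
    by rewrite /b; field; rewrite gt_eqF.
  move=> h; rewrite -subr_le0 -(pmulr_rle0 _ u0); lra.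
Qed.

Lemma sqrtrD_le (y z : R) : 0 <= y -> 0 <= z -> Num.sqrt (y + z) <= Num.sqrt y + Num.sqrt z.
Proof.
move=> y0 z0; have yz0 : 0 <= Num.sqrt y + Num.sqrt z by rewrite addr_ge0 ?sqrtr_ge0.
rewrite -(@ler_pXn2r _ 2)// ?nnegrE ?sqrtr_ge0// sqr_sqrtr ?addr_ge0//.
rewrite sqrrD !sqr_sqrtr// lerD2r lerDl mulrn_wge0// mulr_ge0// sqrtr_ge0.
Qed.

(** The reversed path has slope -v, and the two positive roots add up to the square root of the
    discriminant divided by c. Shifting x by eta changes that square root by at most sqrt(4 c eta),
    by subadditivity. The bounds also exclude infinite hitting times, hence the real y. *)
Lemma hit_width p u c x v eta K : 0 < u -> 0 < c -> 0 <= eta < x ->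
  (`|v| + Num.sqrt (v ^+ 2 + 4 * c * (x + eta))) / (2 * c) <= K ->
  (forall t, `|t| <= K -> `|u * (p (t / u) - u) - (x + t * v - c * t ^+ 2)| <= eta) ->
  exists2 y : R, (u%:E * (hit p u - - hit (p \o -%R) u))%E = y%:E &
    `|y - Num.sqrt (v ^+ 2 + 4 * c * x) / c| <= Num.sqrt (4 * c * eta) / c.
Proof.
move=> u0 c0 ex hK hp; have /andP[e0 ex'] := ex.
have c20 : 0 < 2 * c by lra.
have K1 : (v + Num.sqrt (v ^+ 2 + 4 * c * (x + eta))) / (2 * c) <= K.
  apply: le_trans hK; rewrite ler_wpM2r ?invr_ge0 ?(ltW c20)// lerD2r.
  exact: ler_norm.
have K2 : (- v + Num.sqrt ((- v) ^+ 2 + 4 * c * (x + eta))) / (2 * c) <= K.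
  apply: le_trans hK; rewrite sqrrN ler_wpM2r ?invr_ge0 ?(ltW c20)// lerD2r.
  by rewrite -normrN ler_norm.
have hp1 t : 0 <= t <= K -> `|u * (p (t / u) - u) - (x + t * v - c * t ^+ 2)| <= eta.
  by move=> /andP[t0 tK]; apply: hp; rewrite ger0_norm.
have hp2 t : 0 <= t <= K ->
    `|u * ((p \o -%R) (t / u) - u) - (x + t * - v - c * t ^+ 2)| <= eta.
  move=> /andP[t0 tK]; have := hp (- t); rewrite normrN ger0_norm// => /(_ tK).
  by rewrite /= mulNr sqrrN mulNr mulrN.
have /andP[l1 r1] := hit_parabola u0 c0 ex K1 hp1.
have /andP[l2 r2] := hit_parabola u0 c0 ex K2 hp2.
rewrite sqrrN in l2 r2.
rewrite oppeK.
move: l1 r1 l2 r2.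
case: (hit p u) => [h1| |]; [|by rewrite ?leye_eq|by rewrite ?leeNy_eq].
case: (hit (p \o -%R) u) => [h2| |]; [|by rewrite ?leye_eq|by rewrite ?leeNy_eq].
rewrite !lee_fin; set sm := Num.sqrt (_ + _ * (x - eta)); set sp := Num.sqrt (_ + _ * (x + eta)).
move=> l1 r1 l2 r2.
exists (u * (h1 + h2)) => //.
set s := Num.sqrt (_ + _ * x).
rewrite ler_pdivrMr// in l1; rewrite ler_pdivrMr// in l2.
rewrite ler_pdivlMr// in r1; rewrite ler_pdivlMr// in r2.
have low : sm / c <= u * (h1 + h2).
  have -> : sm / c = (v + sm) / (2 * c) + (- v + sm) / (2 * c) by field; rewrite gt_eqF.
  by move: l1 l2; lra.
have upp : u * (h1 + h2) <= sp / c.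
  have -> : sp / c = (v + sp) / (2 * c) + (- v + sp) / (2 * c) by field; rewrite gt_eqF.
  by move: r1 r2; lra.
have c40 : 0 <= 4 * c by lra.
have A0 y : 0 <= y -> 0 <= v ^+ 2 + 4 * c * y.
  by move=> y0; apply: addr_ge0; [exact: sqr_ge0|exact: mulr_ge0].
have sp_le : sp <= s + Num.sqrt (4 * c * eta).
  rewrite /sp mulrDr addrA; apply: sqrtrD_le; last exact: mulr_ge0.
  by apply: A0; lra.
have sm_ge : s <= sm + Num.sqrt (4 * c * eta).
  rewrite /s; have -> : v ^+ 2 + 4 * c * x = v ^+ 2 + 4 * c * (x - eta) + 4 * c * eta by ring.
  apply: sqrtrD_le; last exact: mulr_ge0.
  by apply: A0; lra.
have ci : 0 <= c^-1 by rewrite invr_ge0 ltW.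
have := ler_wpM2r ci sp_le; have := ler_wpM2r ci sm_ge; rewrite ler_norml !mulrDl.
by move=> h3 h4; apply/andP; split; lra.
Qed.

End hitting_time.

Section hit_measurable.
Context {R : realType}.

(** If p > u on [0, s], then by continuity p > u slightly beyond s too, and the infimum exceeds
    s. *)
Lemma hit_le_itv (p : R -> R) u s : 0 <= s -> continuous p ->
  (hit p u <= s%:E)%E <-> exists2 t, 0 <= t <= s & p t <= u.
Proof.
move=> s0 cp; split; last first.
  by move=> [t /andP[t0 ts] pt]; apply: ge_ereal_inf; exists t%:E => //; exists t.
move=> hs; apply: contrapT => H.
have pos t : 0 <= t <= s -> u < p t.
  by move=> ts; rewrite ltNge; apply/negP => pt; apply: H; exists t.
have : \forall t \near s, u < p t.
  by apply: (cvgr_gt _ (cp s)); apply: pos; rewrite s0 lexx.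
move=> -[e /= e0 He].
suff : ((s + e / 2)%:E <= hit p u)%E.
  by move=> /le_trans/(_ hs); rewrite lee_fin; lra.
apply: le_ereal_inf_tmp => _ [t [t0 pt] <-]; rewrite lee_fin leNgt; apply/negP => te.
have [ts|st] := leP t s; first by have := pos t; rewrite t0 ts => /(_ isT); lra.
have := He t; rewrite /= distrC gtr0_norm ?subr_gt0// => He'.
by have := He' ltac:(lra); lra.
Qed.

(** A countable description, for measurability. The slack 1/(n+1) compensates for the grid missing
    the exact hitting point; conversely the minimum of p over [0, s] is then at most u. [Num.min 1]
    keeps the grid in [0, s] without a bound on j. *)
Lemma hit_le_grid (p : R -> R) u s : 0 <= s -> continuous p ->
  (hit p u <= s%:E)%E <-> forall n : nat, exists (m : nat) (j : nat),
    p (s * Num.min 1 (j%:R / m.+1%:R)) < u + n.+1%:R^-1.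
Proof.
move=> s0 cp; rewrite hit_le_itv//; split.
  move=> [t /andP[t0 ts] pt] n.
  have : \forall x \near t, p x < u + n.+1%:R^-1.
    by apply: (cvgr_lt _ (cp t)); rewrite (le_lt_trans pt)// ltrDl invr_gt0.
  move=> -[e /= e0 He].
  have [s00|sp] := eqVneq s 0.
    exists 0%N, 0%N; apply: He => /=; rewrite s00 mul0r subr0.
    by rewrite (_ : t = 0) ?normr0//; lra.
  have {}sp : 0 < s by rewrite lt_neqAle eq_sym sp.
  pose m := Num.bound (s / e); exists m.
  have m1 : (0 : R) < m.+1%:R by [].
  pose th := t / s.
  have th0 : 0 <= th by rewrite divr_ge0// ltW.
  have th1 : th <= 1 by rewrite ler_pdivrMr// mul1r.
  have xm0 : 0 <= th * m.+1%:R by rewrite mulr_ge0.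
  pose j := Num.truncn (th * m.+1%:R); exists j.
  have /andP[j1 j2] := truncn_itv xm0; rewrite -/j in j1 j2.
  have jth : j%:R / m.+1%:R <= th by rewrite ler_pdivrMr.
  rewrite min_r; last exact: le_trans jth th1.
  apply: He => /=.
  have -> : t = s * th by rewrite /th mulrCA mulfV ?gt_eqF// mulr1.
  rewrite -mulrBr normrM (gtr0_norm sp) ger0_norm ?subr_ge0//.
  rewrite mulrC -ltr_pdivlMr// -[e / s]invf_div.
  apply: (@lt_trans _ _ m.+1%:R^-1); last first.
    rewrite ltf_pV2 ?posrE ?divr_gt0//.
    by rewrite (lt_trans (archi_boundP _)) ?divr_ge0 ?ltr_nat// ltW.
  rewrite -(ltr_pM2r m1) mulrBl mulVf ?gt_eqF// divfK ?gt_eqF//.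
  by rewrite -natr1 in j2; lra.
move=> H.
have cpw : {within `[0, s], continuous p} by exact: continuous_subspaceT.
have [c cs cmin] := EVT_min s0 cpw; exists c; first by move: cs; rewrite in_itv.
rewrite leNgt; apply/negP => uc.
have uc0 : 0 < p c - u by rewrite subr_gt0.
pose n := Num.bound (p c - u)^-1.
have [m [j Hmj]] := H n.
have : p c <= p (s * Num.min 1 (j%:R / m.+1%:R)).
  apply: cmin; rewrite in_itv/= mulr_ge0 ?le_min ?ler01 ?divr_ge0//=.
  by rewrite ler_piMr// ge_min lexx.
have : n.+1%:R^-1 < p c - u.
  rewrite -[ltRHS]invrK ltf_pV2 ?posrE ?invr_gt0//.
  by rewrite (lt_trans (archi_boundP _)) ?ltr_nat// invr_ge0 ltW.
by move=> h1 h2; have := le_lt_trans h2 Hmj; move: h1; set k := _^-1; lra.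
Qed.

Lemma measurable_hit d (Omega : measurableType d) (X : R -> Omega -> R) u :
  (forall t, measurable_fun setT (X t)) ->
  (forall w, continuous (fun t => X t w)) ->
  measurable_fun setT (fun w => hit (fun t => X t w) u).
Proof.
move=> mX cX; apply: (measurability _ (ErealGenOInfty.measurableE R)) => //.
move=> _ [_ [s ->] <-]; rewrite setTI.
have [s0|s0] := ltP s 0.
  rewrite (_ : _ @^-1` _ = setT) //; apply/seteqP; split => // w _ /=.
  by rewrite in_itv/= andbT (lt_le_trans _ (hit_ge0 _ _))// lte_fin.
have -> : (fun w => hit (fun t => X t w) u) @^-1` `]s%:E, +oo[ =
    ~` \bigcap_n \bigcup_m \bigcup_j
      [set w | X (s * Num.min 1 (j%:R / m.+1%:R)) w < u + n.+1%:R^-1].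
  apply/seteqP; split => w /=; rewrite in_itv/= andbT ltNge.
    move=> /negP h1 h2; apply: h1; apply/hit_le_grid => // n.
    by have [m _ [j _ h]] := h2 n I; exists m, j.
  move=> h1; apply/negP => /hit_le_grid h2; apply: h1 => n _.
  by have [//|//|m [j h]] := h2 _ _ n; exists m => //; exists j.
apply: measurableC; apply: bigcapT_measurable => n.
apply: bigcupT_measurable => m; apply: bigcupT_measurable => j.
rewrite (_ : [set w | _] = X (s * Num.min 1 (j%:R / m.+1%:R)) @^-1`
  `]-oo, u + n.+1%:R^-1[); last by apply/seteqP; split => w /=; rewrite in_itv.
by rewrite -[X in measurable X]setTI; apply: mX.
Qed.

Lemma measurable_tau_width d (Omega : measurableType d) (P : probability Omega R)
    (X : R -> {RV P >-> R}) u : continuous_paths X ->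
  measurable_fun setT (fun w => (u%:E * (tau_plus X u w - tau_minus X u w))%E).
Proof.
move=> cX; apply: measurable_funeM; apply: emeasurable_funB.
  by apply: (@measurable_hit _ _ (fun t => X t)) => // t; exact: measurable_funP.
rewrite (_ : tau_minus X u = fun w => (- hit (fun t => X (- t)%R w) u)%E); last first.
  by apply/funext => w; exact: tau_minusE.
apply: measurableT_comp => //.
apply: (@measurable_hit _ _ (fun t => X (- t))) => [t|w t]; first exact: measurable_funP.
apply: (@cvg_comp _ _ _ -%R (fun x => X x w)); last exact: cX.
exact: cvgN.
Qed.

End hit_measurable.

(** * Conditional law of the overshoot and the slope *)

Section exceedance.
Context {R : realType}.
Local Notation leb := (@lebesgue_measure R).
Local Notation gamma := (@normal_law R 0 1).
Local Notation phi := (@normal_pdf R 0 1).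

Lemma ge0_integral_gamma (f : R -> \bar R) : measurable_fun setT f ->
  (forall x, 0 <= f x)%E -> (\int[gamma]_x f x = \int[leb]_x (f x * (phi x)%:E))%E.
Proof.
move=> mf f0; rewrite ge0_integral_normal_law//.
apply: (@ge0_integral_density _ _ _ (normal_prob 0 1) leb phi) => //.
  exact: measurable_normal_pdf.
by move=> x; exact: normal_pdf_ge0.
Qed.

Let measurable_idR : measurable_fun (T := measurableTypeR R) (U := R) setT idfun.
Proof. by move=> mT Y mY; rewrite setTI preimage_id. Qed.

Lemma ge0_integral_exponential d (T : measurableType d) (P : probability T R)
    (Y : {RV P >-> R}) (f : R -> \bar R) :
  same_law (distribution P Y) (exponential_prob 1) ->
  measurable_fun setT f -> (forall x, 0 <= f x)%E ->
  (\int[distribution P Y]_x f x =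
   \int[leb]_(x in `[0%R, +oo[) (f x * (expR (- x))%:E))%E.
Proof.
move=> YE mf f0.
pose n : {measure set R -> \bar R} := pushforward (exponential_prob 1) (@idfun R).
transitivity (\int[n ltr01 measurable_idR]_x f x)%E.
  by apply: eq_measure_integral => A mA _; exact: YE.
rewrite ge0_integral_pushforward// preimage_setT.
rewrite (@ge0_integral_density _ _ _ (exponential_prob 1) leb (exponential_pdf 1))//.
- rewrite [RHS]integral_mkcond; apply: eq_integral => x _; rewrite patchE.
  rewrite mem_setE in_itv/= andbT; case: ifPn => x0.
    by rewrite exponential_pdfE// mul1r mulN1r.
  by rewrite lt0_exponential_pdf ?mule0// ltNge.
- exact: measurable_exponential_pdf.
- by move=> x; exact: exponential_pdf_ge0.
Qed.

Variables (rho u : R).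
Hypotheses (rho0 : 0 < rho) (u0 : 0 < u).

(* With [y = (u + rho t / u) / sqrt rho], [y^2 / 2 = u^2 / (2 rho) + t + rho t^2 / (2 u^2)]:
   the middle term is the exponential law of the overshoot. *)
Definition exceed_const : R :=
  normal_peak 1 * expR (- (u ^+ 2 / rho / 2)) * (Num.sqrt rho / u).

Definition exceed_weight t : R := expR (- (rho * t ^+ 2 / (2 * u ^+ 2))).

Lemma exceed_const_gt0 : 0 < exceed_const.
Proof.
rewrite /exceed_const !mulr_gt0 ?expR_gt0 ?normal_peak_gt0 ?oner_eq0//.
  by rewrite sqrtr_gt0.
by rewrite invr_gt0.
Qed.

(** Substitution y = (u + rho t / u) / sqrt rho, under which the scaled overshoot becomes rho t. The
    identity is exact for every u; all asymptotics are left to the weight. *)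
Lemma integral_exceedance1 (k : R -> R) : continuous k -> (forall x, 0 <= k x) ->
  (\int[gamma]_y (\1_[set x | (u < x)%R] (Num.sqrt rho * y) * k (u * (Num.sqrt rho * y - u)))%:E =
   \int[leb]_(t in `[0%R, +oo[)
     ((exceed_const * (k (rho * t) * exceed_weight t))%:E * (expR (- t))%:E))%E.
Proof.
move=> ck k0.
set q := Num.sqrt rho.
have q0 : 0 < q by rewrite sqrtr_gt0.
have q2 : q ^+ 2 = rho by rewrite sqr_sqrtr// ltW.
pose a := u / q.
have mk : measurable_fun setT k by exact: continuous_measurable_fun.
have mlin : measurable_fun setT (fun y : R => u * (q * y - u)).
  by apply: measurable_funM => //; apply: measurable_funB => //; exact: measurable_funM.
have mphi : measurable_fun setT phi by exact: measurable_normal_pdf.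
have mind : measurable_fun setT (fun y : R => \1_[set x | (u < x)%R] (q * y) : R).
  have mI : measurable [set x : R | (u < x)%R].
    rewrite (_ : [set x | _] = `]u, +oo[%classic) //.
    by apply/seteqP; split => x /=; rewrite in_itv/= andbT.
  have mi : measurable_fun setT (\1_[set x : R | (u < x)%R] : R -> R).
    exact: measurable_indic.
  have mq : measurable_fun setT (fun y : R => q * y) by exact: measurable_funM.
  exact: measurableT_comp mi mq.
rewrite ge0_integral_gamma; last 2 first.
- apply/measurable_EFinP; apply: measurable_funM => //.
  exact: measurableT_comp mk mlin.
- by move=> y; rewrite lee_fin mulr_ge0.
pose G y := k (u * (q * y - u)) * phi y.
transitivity (\int[leb]_(y in `]a, +oo[) (G y)%:E)%E.
  rewrite [RHS]integral_mkcond; apply: eq_integral => y _; rewrite patchE.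
  rewrite mem_setE in_itv/= andbT /a ltr_pdivrMr// [y * q]mulrC indicE.
  rewrite -EFinM /G; case: ifPn => uy.
    by rewrite mem_set//= mul1r.
  by rewrite memNset/= ?mul0r//; apply/negP.
rewrite integral_itv_obnd_cbnd; last first.
  apply/measurable_EFinP; apply: measurable_funTS; apply: measurable_funM => //.
  exact: measurableT_comp mk mlin.
pose F (t : R) := a + q / u * t.
have F0 : F 0 = a by rewrite /F mulr0 addr0.
have dF (t : R) : is_derive t 1 F (q / u).
  by apply: trigger_derive; rewrite /GRing.scale/=; ring.
have F'E : F^`()%classic = cst (q / u).
  by apply/funext => x; rewrite derive1E; exact: (@derive_val _ _ _ _ _ _ _ (dF x)).
have qu0 : 0 < q / u by rewrite divr_gt0.
rewrite -{1}F0 increasing_ge0_integration_by_substitutiony.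
- apply: eq_integral => t _; rewrite -EFinM; congr EFin.
  rewrite !fctE/= F'E /G std_normal_pdfE /exceed_const /exceed_weight -/q.
  have -> : u * (q * F t - u) = rho * t.
    by rewrite -q2 /F /a; field; rewrite !gt_eqF.
  have -> : - F t ^+ 2 / 2 =
      - (u ^+ 2 / rho / 2) + (- t + - (rho * t ^+ 2 / (2 * u ^+ 2))).
    by rewrite -q2 /F /a; field; rewrite !gt_eqF.
  by rewrite !expRD /cst; ring.
- by move=> x y _ _ xy; rewrite /F ltrD2l ltr_pM2l.
- by rewrite F'E => x _; exact: cvg_cst.
- by rewrite F'E; exact: is_cvg_cst.
- by rewrite F'E; exact: is_cvg_cst.
- split; first by move=> x _; exact: ex_derive.
  apply: cvg_at_right_filter; apply/differentiable_continuous/derivable1_diffP.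
  exact: ex_derive.
- exact: cvg_comp (gt0_cvgMry qu0 cvg_id) (cvg_addrl a).
- apply: continuous_subspaceT => y; apply: cvgM.
    apply: (@cvg_comp _ _ _ (fun y => u * (q * y - u)) k); last exact: ck.
    apply: cvgM; first exact: cvg_cst.
    by apply: cvgB; [apply: cvgM; [exact: cvg_cst|exact: cvg_id]|exact: cvg_cst].
  by apply: continuous_normal_pdf; rewrite oner_eq0.
- by move=> y _; rewrite mulr_ge0// normal_pdf_ge0.
Qed.

End exceedance.

Section exceedance_law.
Context {R : realType} d (Omega : measurableType d) (P : probability Omega R)
  (X0 V : {RV P >-> R}) (rho : R).
Local Notation gamma := (@normal_law R 0 1).
Hypotheses (rho0 : 0 < rho)
  (X0E : forall A, measurable A ->
    pushforward P X0 A = gamma ((fun y => Num.sqrt rho * y) @^-1` A))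
  (VE : forall A, measurable A -> distribution P V A = gamma A)
  (X0V : independent X0 V).
Context d' (Omega' : measurableType d') (P' : probability Omega' R)
  (Z T : {RV P' >-> R}).
Hypotheses (ZE : forall A, measurable A -> distribution P' Z A = gamma A)
  (TE : same_law (distribution P' T) (exponential_prob 1))
  (TZ : independent T Z).
Variable u : R.
Hypothesis u0 : 0 < u.

Let mtail : measurable [set x : R | (u < x)%R].
Proof.
rewrite (_ : [set x | _] = `]u, +oo[%classic) //.
by apply/seteqP; split => x /=; rewrite in_itv/= andbT.
Qed.

Let mtail_ind : measurable_fun setT (\1_[set x : R | (u < x)%R] : R -> R).
Proof. exact: measurable_indic. Qed.

Let mweight : measurable_fun setT (exceed_weight rho u).
Proof.
apply: measurableT_comp => //; apply: measurableT_comp => //.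
by apply: measurable_funM => //; apply: measurable_funM => //; exact: measurable_funX.
Qed.

Let exceedance1 (k : R -> R) : continuous k -> (forall x, 0 <= k x) ->
  (\int[distribution P X0]_x (\1_[set x | (u < x)%R] x * k (u * (x - u)))%:E =
   \int[distribution P' T]_t (exceed_const rho u * (k (rho * t) * exceed_weight rho u t))%:E)%E.
Proof.
move=> ck k0.
have mk : measurable_fun setT k by exact: continuous_measurable_fun.
have mq : measurable_fun setT (fun y : R => Num.sqrt rho * y) by exact: measurable_funM.
pose n : {measure set R -> \bar R} := pushforward gamma (fun y => Num.sqrt rho * y).
have mf : measurable_fun setT
    (fun x : R => (\1_[set x | (u < x)%R] x * k (u * (x - u)))%:E).
  apply/measurable_EFinP; apply: measurable_funM => //.
  apply: measurableT_comp => //; apply: measurable_funM => //.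
  exact: measurable_funB.
transitivity (\int[n mq]_x (\1_[set x | (u < x)%R] x * k (u * (x - u)))%:E)%E.
  by apply: eq_measure_integral => A mA _; exact: X0E.
rewrite ge0_integral_pushforward//; last by move=> y _; rewrite lee_fin mulr_ge0.
rewrite preimage_setT (integral_exceedance1 rho0 u0 ck k0).
rewrite (ge0_integral_exponential TE)//.
- apply/measurable_EFinP; apply: measurable_funM => //; apply: measurable_funM => //.
  by apply: measurableT_comp => //; exact: measurable_funM.
- move=> t; rewrite lee_fin; apply: mulr_ge0; first exact/ltW/exceed_const_gt0.
  by apply: mulr_ge0 => //; exact: expR_ge0.
Qed.

(** By independence on either side these are iterated integrals: the inner ones agree by the
    substitution, which needs continuity in the first variable, and the outer ones because V and Z
    have the same law. *)
Lemma exceedance_law (h : R * R -> R) : measurable_fun setT h ->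
  (forall z, 0 <= h z) -> (forall v, continuous (fun x => h (x, v))) ->
  (\int[P]_w (\1_[set x | (u < x)%R] (X0 w) * h (u * (X0 w - u), V w))%:E =
   \int[P']_w (exceed_const rho u * (h (rho * T w, Z w) * exceed_weight rho u (T w)))%:E)%E.
Proof.
move=> mh h0 ch.
have m1 : measurable_fun setT
    (fun z : R * R => (\1_[set x | (u < x)%R] z.1 * h (u * (z.1 - u), z.2))%:E).
  apply/measurable_EFinP; apply: measurable_funM.
    exact: measurableT_comp mtail_ind measurable_fst.
  apply: measurableT_comp mh _; apply/measurable_fun_pairP; split => /=.
    by apply: measurable_funM => //; apply: measurable_funB => //; exact: measurable_fst.
  exact: measurable_snd.
have m2 : measurable_fun setT (fun z : R * R =>
    (exceed_const rho u * (h (rho * z.1, z.2) * exceed_weight rho u z.1))%:E).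
  apply/measurable_EFinP; apply: measurable_funM => //; apply: measurable_funM.
    apply: measurableT_comp mh _; apply/measurable_fun_pairP; split => /=.
      by apply: measurable_funM => //; exact: measurable_fst.
    exact: measurable_snd.
  exact: measurableT_comp mweight measurable_fst.
have p1 (z : R * R) : (0 <= (\1_[set x | (u < x)%R] z.1 * h (u * (z.1 - u), z.2))%:E)%E.
  by rewrite lee_fin mulr_ge0.
have p2 (z : R * R) : (0 <=
    (exceed_const rho u * (h (rho * z.1, z.2) * exceed_weight rho u z.1))%:E)%E.
  rewrite lee_fin; apply: mulr_ge0; first exact/ltW/exceed_const_gt0.
  by apply: mulr_ge0 => //; exact: expR_ge0.
rewrite (independent_integralE X0V m1 p1) (independent_integralE TZ m2 p2).
under eq_integral => v _ do rewrite (exceedance1 (ch v) (fun x => h0 (x, v))).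
by apply: eq_measure_integral => A mA _; exact: (etrans (VE mA) (esym (ZE mA))).
Qed.

(** The nonnegative identity is applied to h + M and to the constant M, and the two are
    subtracted. *)
Lemma exceedance_Rintegral (h : R * R -> R) M : measurable_fun setT h ->
  (forall z, `|h z| <= M) -> (forall v, continuous (fun x => h (x, v))) ->
  \int[P]_w (\1_[set x | (u < x)%R] (X0 w) * h (u * (X0 w - u), V w)) =
  exceed_const rho u * \int[P']_w (h (rho * T w, Z w) * exceed_weight rho u (T w)).
Proof.
have mX0V : measurable_fun setT (fun w => (u * (X0 w - u), V w)).
  apply/measurable_fun_pairP; split => /=; last exact: measurable_funP.
  by apply: measurable_funM => //; apply: measurable_funB.
have mTZ : measurable_fun setT (fun w => (rho * T w, Z w)).
  by apply/measurable_fun_pairP; split => /=; [exact: measurable_funM|exact: measurable_funP].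
have w1 t : 0 <= exceed_weight rho u t <= 1.
  rewrite expR_ge0/= -expR0 ler_expR oppr_le0 divr_ge0// mulr_ge0 ?sqr_ge0//.
  exact: ltW.
have iL (g : R * R -> R) K : measurable_fun setT g -> (forall z, `|g z| <= K) ->
    P.-integrable setT (EFin \o (fun w => \1_[set x | (u < x)%R] (X0 w) *
      g (u * (X0 w - u), V w))).
  move=> mg gK; apply: (@le_bounded_integrable _ _ _ P _ K) => [|w].
    apply: measurable_funM; first exact: measurableT_comp mtail_ind _.
    exact: measurableT_comp mg mX0V.
  rewrite normrM -[leRHS]mul1r ler_pM// indicE.
  by case: (_ \in _); rewrite ?normr1 ?normr0.
have iR (g : R * R -> R) K : measurable_fun setT g -> (forall z, `|g z| <= K) ->
    P'.-integrable setT (EFin \o (fun w => g (rho * T w, Z w) * exceed_weight rho u (T w))).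
  move=> mg gK; apply: (@le_bounded_integrable _ _ _ P' _ K) => [|w].
    apply: measurable_funM; first exact: measurableT_comp mg mTZ.
    exact: measurableT_comp mweight _.
  have /andP[a b] := w1 (T w).
  by rewrite normrM -[leRHS]mulr1 ler_pM// ger0_norm.
have pos (g : R * R -> R) K : measurable_fun setT g -> (forall z, `|g z| <= K) ->
    (forall z, 0 <= g z) -> (forall v, continuous (fun x => g (x, v))) ->
    \int[P]_w (\1_[set x | (u < x)%R] (X0 w) * g (u * (X0 w - u), V w)) =
    exceed_const rho u * \int[P']_w (g (rho * T w, Z w) * exceed_weight rho u (T w)).
  move=> mg gK g0 cg; rewrite -RintegralZl//; last exact: iR gK.
  by congr fine; exact: exceedance_law.
move=> mh hM ch.
have M0 : 0 <= M by apply: le_trans (hM (0, 0)).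
have mhM : measurable_fun setT (fun z => h z + M) by exact: measurable_funD.
have hM2 z : `|h z + M| <= M + M.
  by rewrite (le_trans (ler_normD _ _))// lerD// ger0_norm.
have hM0 z : 0 <= h z + M by have := hM z; rewrite ler_norml; lra.
have chM v : continuous (fun x => h (x, v) + M).
  by move=> x; apply: cvgD; [exact: ch|exact: cvg_cst].
have := pos _ _ mhM hM2 hM0 chM.
have cM (z : R * R) : `|M| <= M by rewrite ger0_norm.
have := pos (fun=> M) M (measurable_cst _) cM (fun=> M0) (fun v x => cvg_cst M).
under [X in _ -> X = _ -> _]eq_Rintegral do rewrite mulrDr.
under [X in _ -> _ = _ * X -> _]eq_Rintegral do rewrite mulrDl.
rewrite RintegralD//; [|exact: iL hM|exact: (iL (fun=> M) M (measurable_cst _) cM)].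
rewrite RintegralD//; [|exact: iR hM|exact: (iR (fun=> M) M (measurable_cst _) cM)].
by move=> ->; rewrite mulrDr => /addIr.
Qed.

End exceedance_law.

Section conditional_limit.
Context {R : realType} d (Omega : measurableType d) (P : probability Omega R)
  (X0 : {RV P >-> R}) (rho : R).
Local Notation gamma := (@normal_law R 0 1).

Definition exceedance (u : R) := [set w | u < X0 w].

Definition cond_mean (u : R) (g : Omega -> R) : R :=
  \int[P]_w (\1_(exceedance u) w * g w) / fine (P (exceedance u)).

Lemma measurable_exceedance u : measurable (exceedance u).
Proof.
rewrite (_ : exceedance u = X0 @^-1` `]u, +oo[).
  by rewrite -[X in measurable X]setTI; exact: measurable_funP.
by apply/seteqP; split => w /=; rewrite in_itv/= andbT.
Qed.

Hypotheses (rho0 : 0 < rho)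
  (X0E : forall A, measurable A ->
    pushforward P X0 A = gamma ((fun y => Num.sqrt rho * y) @^-1` A)).
Variables (V : R -> {RV P >-> R}) (s : R -> R) (sg U0 : R).
Hypotheses (VE : forall u, U0 < u -> forall A, measurable A ->
    distribution P (V u) A = gamma A)
  (X0V : forall u, U0 < u -> independent X0 (V u))
  (s_cvg : s u @[u --> +oo] --> sg).
Context d' (Omega' : measurableType d') (P' : probability Omega' R)
  (Z T : {RV P' >-> R}).
Hypotheses (ZE : forall A, measurable A -> distribution P' Z A = gamma A)
  (TE : same_law (distribution P' T) (exponential_prob 1))
  (TZ : independent T Z).

Let weight_bound (u t : R) : 0 < u -> 0 <= exceed_weight rho u t <= 1.
Proof.
move=> u0; rewrite expR_ge0/= -expR0 ler_expR oppr_le0 divr_ge0// mulr_ge0 ?sqr_ge0//.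
exact: ltW.
Qed.

Let mweight (u : R) : measurable_fun setT (exceed_weight rho u).
Proof.
apply: measurableT_comp => //; apply: measurableT_comp => //.
by apply: measurable_funM => //; apply: measurable_funM => //; exact: measurable_funX.
Qed.

Lemma exceedance_prob u : U0 < u -> 0 < u ->
  fine (P (exceedance u)) = exceed_const rho u * \int[P']_w exceed_weight rho u (T w).
Proof.
move=> Uu u0.
have mone : measurable_fun setT (fun _ : R * R => 1 : R) by exact: measurable_cst.
have one1 (z : R * R) : `|1 : R| <= 1 by rewrite normr1.
have cone (x : R) : continuous (fun _ : R => 1 : R) by exact: cst_continuous.
have := exceedance_Rintegral rho0 X0E (VE Uu) (X0V Uu) ZE TE TZ u0 mone one1 cone.
under [X in _ -> _ = _ * X]eq_Rintegral do rewrite -[exceed_weight _ _ _]mul1r.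
move=> <-; under [RHS]eq_Rintegral do rewrite mulr1.
by rewrite /Rintegral integral_indic ?setIT//; exact: measurable_exceedance.
Qed.

Let cvg_weighted (h : R * R -> R) M : measurable_fun setT h ->
  (forall z, `|h z| <= M) -> (forall x, continuous (fun v => h (x, v))) ->
  \int[P']_w (h (rho * T w, s u * Z w) * exceed_weight rho u (T w)) @[u --> +oo] -->
  \int[P']_w h (rho * T w, sg * Z w).
Proof.
(* Dominated convergence works along sequences. The first N terms are dropped so that a is positive,
   which puts the weight in [0, 1]. *)
move=> mh hM ch; apply/cvg_pinftyP => a acvg.
have := acvg => /cvgryPgt/(_ 0)[N _ aN].
rewrite -(cvg_shiftn N).
have a0 n : 0 < a (n + N)%N by apply: aN => /=; exact: leq_addl.
have sa : s (a n) @[n --> \oo] --> sg by exact: cvg_comp acvg s_cvg.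
apply: (@dominated_cvg_Rintegral _ _ _ P' _ _ (cst M)).
- move=> n; apply: measurable_funM; last exact: measurableT_comp (mweight _) _.
  apply: measurableT_comp mh _; apply/measurable_fun_pairP.
  by split => /=; exact: measurable_funM.
- move=> w; rewrite -[X in _ --> X]mulr1; apply: cvgM.
    have cx : (fun v => h (rho * T w, v)) v @[v --> sg * Z w] --> h (rho * T w, sg * Z w).
      exact: ch.
    apply: (@cvg_comp _ _ _ (fun n => s (a (n + N)%N) * Z w) _ _ _ _ _ cx).
    apply: cvgM; last exact: cvg_cst.
    by move: sa; rewrite -(cvg_shiftn N).
  have aycvg : a (n + N)%N @[n --> \oo] --> +oo by rewrite (cvg_shiftn N).
  have inv0 : (2 * a (n + N)%N ^+ 2)^-1 @[n --> \oo] --> (0 : R).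
    apply/(gtr0_cvgV0 (f := fun n => 2 * a (n + N)%N ^+ 2)).
      by apply: nearW => n; rewrite mulr_gt0// exprn_gt0.
    have two0 : (0 : R) < 2 by [].
    apply: (@cvg_comp _ _ _ (fun n => a (n + N)%N) (fun x => 2 * x ^+ 2) _ _ _ aycvg).
    exact: (gt0_cvgMry two0 cvgr_expr2).
  have e0 : - (rho * T w ^+ 2 / (2 * a (n + N)%N ^+ 2)) @[n --> \oo] --> (0 : R).
    rewrite -[X in _ --> X]oppr0; apply: cvgN.
    rewrite -[X in _ --> X](mulr0 (rho * T w ^+ 2)); apply: cvgM => //.
    exact: cvg_cst.
  rewrite -(expR0 R); apply: (@cvg_comp _ _ _ _ expR _ _ _ e0).
  exact: continuous_expR.
- move=> n w; have /andP[b c] := weight_bound (T w) (a0 n).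
  by rewrite normrM -[leRHS]mulr1 ler_pM// ger0_norm.
- exact: finite_measure_integrable_cst.
Qed.

Lemma exceedance_prob_gt0 : \forall u \near +oo, 0 < fine (P (exceedance u)).
Proof.
have mone : measurable_fun setT (fun _ : R * R => 1 : R) by exact: measurable_cst.
have one1 (z : R * R) : `|1 : R| <= 1 by rewrite normr1.
have cone (x : R) : continuous (fun _ : R => 1 : R) by exact: cst_continuous.
have := cvg_weighted mone one1 cone.
rewrite Rintegral_cst//= probability_setT mulr1 => /cvgr_gt/(_ _ ltr01) H.
near=> u.
have u0 : 0 < u by near: u; exact: nbhs_pinfty_gt.
have Uu : U0 < u by near: u; apply: nbhs_pinfty_gt; exact: num_real.
rewrite exceedance_prob// mulr_gt0 ?exceed_const_gt0//.
have : 0 < \int[P']_w (1 * exceed_weight rho u (T w)) by near: u.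
by under eq_Rintegral do rewrite mul1r.
Unshelve. all: end_near. Qed.

(** [exceed_const] occurs in the numerator and in the probability and cancels; what remains is a
    ratio of weighted means whose denominator tends to 1. *)
Lemma cond_mean_cvg (h : R * R -> R) M : measurable_fun setT h ->
  (forall z, `|h z| <= M) -> (forall x, continuous (fun v => h (x, v))) ->
  (forall v, continuous (fun x => h (x, v))) ->
  cond_mean u (fun w => h (u * (X0 w - u), s u * V u w)) @[u --> +oo] -->
  \int[P']_w h (rho * T w, sg * Z w).
Proof.
move=> mh hM ch2 ch1.
have mone : measurable_fun setT (fun _ : R * R => 1 : R) by exact: measurable_cst.
have one1 (z : R * R) : `|1 : R| <= 1 by rewrite normr1.
have cone (x : R) : continuous (fun _ : R => 1 : R) by exact: cst_continuous.
have C1 := cvg_weighted mone one1 cone.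
rewrite Rintegral_cst//= probability_setT mulr1 in C1.
have one0 : (1 : R) != 0 by exact: oner_neq0.
have : \int[P']_w (h (rho * T w, s u * Z w) * exceed_weight rho u (T w)) *
    (\int[P']_w (1 * exceed_weight rho u (T w)))^-1 @[u --> +oo] -->
    \int[P']_w h (rho * T w, sg * Z w).
  rewrite -[X in _ --> X]mulr1 -[X in _ * X]invr1.
  by apply: cvgM; [exact: cvg_weighted mh hM ch2|exact: cvgV one0 C1].
apply: cvg_trans; apply: near_eq_cvg; near=> u.
have u0 : 0 < u by near: u; exact: nbhs_pinfty_gt.
have Uu : U0 < u by near: u; apply: nbhs_pinfty_gt; exact: num_real.
rewrite /cond_mean exceedance_prob//.
(* The scale s(u) is moved into the test function, so that the exact identity is used with a
   standard normal variable at each fixed u. *)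
pose hu z := h (z.1, s u * z.2).
have mhu : measurable_fun setT hu.
  apply: measurableT_comp mh _; apply/measurable_fun_pairP; split => /=.
    exact: measurable_fst.
  by apply: measurable_funM => //; exact: measurable_snd.
have huM z : `|hu z| <= M by exact: hM.
have huc v : continuous (fun x => hu (x, v)) by exact: (ch1 (s u * v)).
have := exceedance_Rintegral rho0 X0E (VE Uu) (X0V Uu) ZE TE TZ u0 mhu
  huM huc.
rewrite /hu /= => E; rewrite [X in _ = X / _]E.
under [X in _ = _ / (_ * X)]eq_Rintegral do rewrite -[exceed_weight _ _ _]mul1r.
rewrite invfM mulrACA divff ?mul1r// gt_eqF//.
exact: exceed_const_gt0.
Unshelve. all: end_near. Qed.

End conditional_limit.

(** * Weak convergence of the excursion length *)

Section weak_convergence_tools.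
Context {R : realType}.

(** Only x is confined to [a, b]: x will be the width given by the parabola, which the cutoff
    bounds, and y the true width. *)
Lemma uniform_continuity_itv (f : R -> R) (a b eps : R) : continuous f -> 0 < eps ->
  exists2 del : R, 0 < del & forall x y, a <= x <= b -> `|y - x| <= del ->
    `|f y - f x| <= eps.
Proof.
move=> cf e0.
have cov x : `[a, b]%classic x ->
    \forall x' \near x & del \near (0 : R)^'+,
      forall y, `|y - x'| <= del -> `|f y - f x'| <= eps.
  move=> _.
  have e20 : 0 < eps / 2 by lra.
  have := cf x => /cvgrPdist_lt/(_ _ e20) [d /= d0 Hd].
  exists (ball x (d / 2), [set del | del < d / 2]); first split => /=.
  - by exists (d / 2) => //=; lra.
  - by apply: nbhs_right_lt; lra.
  - move=> [x' del] /= [xx' dd] y yx'.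
    have h1 : `|f x - f x'| < eps / 2 by apply: Hd => /=; rewrite /ball/= in xx'; lra.
    have h2 : `|f x - f y| < eps / 2.
      apply: Hd => /=; rewrite /ball/= in xx'.
      have -> : x - y = (x - x') - (y - x') by ring.
      by rewrite (le_lt_trans (ler_normB _ _))//; lra.
    have -> : f y - f x' = (f x - f x') - (f x - f y) by ring.
    by rewrite (le_trans (ler_normB _ _))//; lra.
have H := (compact_near_coveringP _).1 (@segment_compact R a b) R (0 : R)^'+
  (fun del x => forall y, `|y - x| <= del -> `|f y - f x| <= eps) _ cov.
have [del [d0 Hd]] : exists del : R, 0 < del /\ (`[a, b]%classic `<=`
    (fun x => forall y, `|y - x| <= del -> `|f y - f x| <= eps)).
  by near (0 : R)^'+ => del; exists del; split; near: del; [exact: nbhs_right_gt|exact: H].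
exists del => // x y axb; apply: Hd.
by rewrite /= in_itv.
Unshelve. all: end_near. Qed.

Context d (Omega : measurableType d) (P : probability Omega R).

(** [conditional P B] is a bare set function. It is identified with a rescaled restriction of P, a
    genuine measure with density 1_B / P(B). *)
Lemma integral_conditional (B : set Omega) (W : Omega -> \bar R) (f : \bar R -> R) M :
  measurable B -> 0 < fine (P B) -> measurable_fun setT W -> measurable_fun setT f ->
  (forall x, `|f x| <= M) ->
  (\int[pushforward (conditional P B) W]_x (f x)%:E)%E =
  ((\int[P]_w (\1_B w * f (W w))) / fine (P B))%:E.
Proof.
move=> mB p0 mW mf fM; set p := fine (P B).
have pE : P B = p%:E by rewrite fineK// fin_num_measure.
have pi0 : 0 <= p^-1 by rewrite invr_ge0 ltW.
pose nu : {finite_measure set Omega -> \bar R} := mscale (NngNum pi0) (mrestr P mB).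
have nuE A : nu A = conditional P B A.
  rewrite /conditional pE inver gt_eqF//.
  by rewrite muleC.
have -> : pushforward (conditional P B) W = pushforward nu W.
  by apply/funext => A; rewrite /pushforward nuE.
have mEf : measurable_fun setT (EFin \o f) by exact/measurable_EFinP.
have mfW : measurable_fun setT (f \o W) by exact: measurableT_comp.
have if_ : nu.-integrable setT (EFin \o (f \o W)).
  by apply: (@le_bounded_integrable _ _ _ nu _ M) => // w; exact: fM.
rewrite (integral_pushforward mW mEf if_ measurableT) preimage_setT.
rewrite -[LHS]fineK; last exact: integrable_fin_num.
congr EFin.
rewrite -[LHS]/(\int[nu]_w (f (W w))).
pose g (w : Omega) : R := p^-1 * \1_B w.
have mg : measurable_fun setT g.
  by apply: measurable_funM => //; exact: measurable_indic.
have g0 w : 0 <= g w by rewrite mulr_ge0.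
have igE A : measurable A -> nu A = (\int[P]_(w in A) (g w)%:E)%E.
  move=> mA; rewrite /g; under eq_integral do rewrite EFinM.
  rewrite ge0_integralZl//; last first.
    by apply/measurable_EFinP; apply: measurable_funTS; exact: measurable_indic.
  by rewrite integral_indic// [LHS]/= /mscale /mrestr/= setIC.
have ifg : P.-integrable setT (EFin \o (fun w => f (W w) * g w)).
  apply: (@le_bounded_integrable _ _ _ _ _ (M * p^-1)).
    exact: measurable_funM.
  move=> w; rewrite normrM ler_pM// /g normrM ger0_norm// ler_piMr//.
  by rewrite indicE; case: (_ \in _); rewrite ?normr1 ?normr0.
rewrite (Rintegral_density mg g0 igE mfW ifg).
rewrite mulrC -RintegralZl//.
  by apply: eq_Rintegral => w _; rewrite /g /=; ring.
apply: (@le_bounded_integrable _ _ _ _ _ M).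
  by apply: measurable_funM => //; exact: measurable_indic.
move=> w; rewrite normrM -[leRHS]mul1r ler_pM// indicE.
by case: (_ \in _); rewrite ?normr1 ?normr0.
Qed.

End weak_convergence_tools.

Section cutoff.
Context {R : realType}.

Lemma cvg_maxr {T : Type} {F : set_system T} {FF : Filter F} (f g : T -> R) (a b : R) :
  f x @[x --> F] --> a -> g x @[x --> F] --> b ->
  Num.max (f x) (g x) @[x --> F] --> Num.max a b.
Proof.
move=> fa gb; rewrite maxr_absE; under eq_fun do rewrite maxr_absE.
apply: cvgM; last exact: cvg_cst.
by apply: cvgD; [exact: cvgD|apply: cvg_norm; exact: cvgB].
Qed.

Lemma cvg_minr {T : Type} {F : set_system T} {FF : Filter F} (f g : T -> R) (a b : R) :
  f x @[x --> F] --> a -> g x @[x --> F] --> b ->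
  Num.min (f x) (g x) @[x --> F] --> Num.min a b.
Proof.
move=> fa gb; rewrite minr_absE; under eq_fun do rewrite minr_absE.
apply: cvgM; last exact: cvg_cst.
by apply: cvgB; [exact: cvgD|apply: cvg_norm; exact: cvgB].
Qed.

(* Supported in [1/n < x < n], [|v| < n]; the hitting times are unstable at [x = 0]. *)
Definition cutoff (n : nat) (z : R * R) : R :=
  Num.max 0 (1 - (`|z.1| + `|z.2|) / n%:R) * Num.min 1 (Num.max 0 (n%:R * z.1 - 1)).

Lemma cutoff_ge0_le1 n z : 0 <= cutoff n z <= 1.
Proof.
rewrite mulr_ge0 ?le_max ?le_min ?lexx ?ler01//= ?le_max ?lexx//.
rewrite mulr_ile1 ?le_max ?le_min ?lexx ?ler01 ?ge_min ?lexx ?le_max ?lexx//=.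
Qed.

Lemma cutoff_neq0 n z : cutoff n z != 0 ->
  [/\ (0 < n)%N, n%:R^-1 < z.1 < n%:R & `|z.2| < n%:R].
Proof.
rewrite /cutoff mulf_eq0 negb_or => /andP[h1 h2].
have n0 : (0 < n)%N.
  rewrite lt0n; apply: contraNneq h2 => ->; apply/eqP.
  by rewrite mul0r sub0r max_l ?lerN10// min_r.
have nR : (0 : R) < n%:R by rewrite ltr0n.
have {}h1 : `|z.1| + `|z.2| < n%:R.
  rewrite ltNge; apply: contraNN h1 => h; rewrite max_l//.
  by rewrite subr_le0 ler_pdivlMr// mul1r.
have {}h2 : 1 < n%:R * z.1.
  rewrite ltNge; apply: contraNN h2 => h; rewrite max_l ?min_r//.
  by rewrite subr_le0.
have := normr_ge0 z.1; have := normr_ge0 z.2; have := ler_norm z.1.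
split => //; last lra.
by rewrite -div1r ltr_pdivrMr// mulrC h2/=; lra.
Qed.

Lemma measurable_cutoff n : measurable_fun setT (cutoff n).
Proof.
have m1 : measurable_fun setT (fun z : R * R => `|z.1|).
  by apply: measurableT_comp => //; exact: measurable_fst.
have m2 : measurable_fun setT (fun z : R * R => `|z.2|).
  by apply: measurableT_comp => //; exact: measurable_snd.
apply: measurable_funM.
  apply: measurable_maxr => //; apply: measurable_funB => //.
  by apply: measurable_funM => //; exact: measurable_funD.
apply: measurable_minr => //; apply: measurable_maxr => //.
by apply: measurable_funB => //; apply: measurable_funM => //; exact: measurable_fst.
Qed.

Lemma continuous_cutoff1 n v : continuous (fun x => cutoff n (x, v)).
Proof.
move=> x; rewrite /cutoff/=; apply: cvgM.
  apply: cvg_maxr; first exact: cvg_cst.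
  apply: cvgB; first exact: cvg_cst.
  apply: cvgM; last exact: cvg_cst.
  by apply: cvgD; [exact: (@norm_continuous R R x)|exact: cvg_cst].
apply: cvg_minr; first exact: cvg_cst.
apply: cvg_maxr; first exact: cvg_cst.
apply: cvgB; last exact: cvg_cst.
by apply: cvgM; [exact: cvg_cst|exact: cvg_id].
Qed.

Lemma continuous_cutoff2 n x : continuous (fun v => cutoff n (x, v)).
Proof.
move=> v; rewrite /cutoff/=; apply: cvgM; last exact: cvg_cst.
apply: cvg_maxr; first exact: cvg_cst.
apply: cvgB; first exact: cvg_cst.
apply: cvgM; last exact: cvg_cst.
by apply: cvgD; [exact: cvg_cst|exact: (@norm_continuous R R v)].
Qed.

Lemma cutoff_cvg z : 0 < z.1 -> cutoff n z @[n --> \oo] --> (1 : R).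
Proof.
move=> z0.
have inv0 : n%:R^-1 @[n --> \oo] --> (0 : R).
  by rewrite -(cvg_shiftn 1); under eq_fun do rewrite addn1; exact: cvg_harmonic.
have -> : (1 : R) = Num.max 0 (1 - (`|z.1| + `|z.2|) * 0) * 1.
  by rewrite mulr0 subr0 max_r ?mulr1.
apply: cvgM.
  apply: cvg_maxr; first exact: cvg_cst.
  apply: cvgB; first exact: cvg_cst.
  by apply: cvgM => //; exact: cvg_cst.
apply: cvg_near_cst; near=> n.
have nz : 2 / z.1 < n%:R by near: n; exact: nbhs_infty_gtr.
have : 2 < n%:R * z.1 by rewrite -ltr_pdivrMr.
by move=> h; rewrite max_r ?min_l//; lra.
Unshelve. all: end_near. Qed.

End cutoff.

Section spectral_facts.
Context {R : realType} (mu : {finite_measure set R -> \bar R}).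

Lemma fourier_spectral_cov (r : R -> R) :
  (forall t, (r t)%:C = fourier mu t) -> r = spectral_cov mu.
Proof.
move=> rE; apply/funext => t.
by have /(congr1 (@complex.Re R)) := rE t.
Qed.

Lemma L2_idfun : (\int[mu]_x (x ^+ 2)%:E < +oo)%E -> L2 mu (@idfun R).
Proof.
move=> m2; split; first exact: measurable_id.
have mx2 : measurable_fun setT (fun x : R => (x ^+ 2)%:E).
  by apply/measurable_EFinP; exact: measurable_funX.
apply/integrableP; split; first exact: mx2.
by under eq_integral do rewrite /= ger0_norm ?sqr_ge0//.
Qed.

Lemma second_moment_gt0 : L2 mu (@idfun R) -> (0 < mu (~` [set 0%R]))%E ->
  0 < second_moment mu.
Proof.
move=> [_ i2] mu0; rewrite lt_neqAle Rintegral_ge0 ?andbT; last first.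
  by move=> x _; exact: sqr_ge0.
apply/negP => /eqP s0; move: mu0; apply/negP; rewrite -leNgt.
have mx2 : measurable_fun setT (fun x : R => (x ^+ 2)%:E).
  by apply/measurable_EFinP; exact: measurable_funX.
have : (\int[mu]_x `|(x ^+ 2)%:E| = 0)%E.
  under eq_integral do rewrite /= ger0_norm ?sqr_ge0//.
  by rewrite -[LHS]fineK ?integrable_fin_num//; congr EFin; rewrite s0.
move=> /(ae_eq_integral_abs mu measurableT mx2)[N [mN N0 sN]].
rewrite -N0; apply: le_measure; rewrite ?inE//; first exact: measurableC.
move=> x /= /eqP x0; apply: sN => /= /(_ I) [] /eqP.
by rewrite sqrf_eq0 (negbTE x0).
Qed.

Lemma spectral_cov0_gt0 : (0 < mu setT)%E -> 0 < spectral_cov mu 0.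
Proof.
move=> mu0; rewrite /spectral_cov.
rewrite (_ : \int[mu]_x _ = fine (mu setT)); last first.
  by under eq_Rintegral do rewrite mul0r cos0; rewrite Rintegral_cst// mul1r.
by rewrite fine_gt0// mu0/= ltey_eq fin_num_measure.
Qed.

End spectral_facts.

Section slope.
Context {R : realType} (mu : {finite_measure set R -> \bar R}).
Context d (Omega : measurableType d) (P : probability Omega R).
Variable X : R -> {RV P >-> R}.
Local Notation gamma := (@normal_law R 0 1).
Local Notation r := (spectral_cov mu).
Local Notation sg2 := (second_moment mu).
Local Notation residual := (residual mu X).

Hypotheses (X_mean : forall t : R, ('E_P[X t] = 0)%E)
  (X_gauss : gaussian_process X)
  (X_cov : forall s t : R, ('E_P[(fun w => X s w * X t w)%R] = (r (s - t))%:E)%E).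
Hypothesis r0_gt0 : 0 < r 0.
Hypothesis mom2 : L2 mu (@idfun R).

Lemma Rintegral_X2 t : \int[P]_w (X t w ^+ 2) = r 0.
Proof.
by rewrite -[in RHS](subrr t) -(Rintegral_XX X_cov); apply: eq_Rintegral => w _; rewrite expr2.
Qed.

Lemma level_law A : measurable A ->
  pushforward P (X 0) A = gamma ((fun y => Num.sqrt (r 0) * y) @^-1` A).
Proof.
move=> mA.
have gX : gaussian_law (pushforward P (X 0)).
  have := gaussian_lin X_gauss [:: (1, 0)]; congr gaussian_law; congr pushforward.
  by apply/funext => w; rewrite lin_cons lin_nil addr0 mul1r.
have [s s0 [sE ->//]] := centered_gaussian_law gX (L2_X X_cov 0) (Rintegral_X X_mean 0) (Rintegral_X2 0).
by rewrite -sE sqrtr_sqr ger0_norm.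
Qed.

Definition slope (u : R) (w : Omega) : R := u * residual [:: (1, u^-1)] w.

Lemma L2_slope u : L2 P (slope u).
Proof. by apply: L2Z; exact: L2_residual X_cov _. Qed.

Lemma Rintegral_slope u : \int[P]_w slope u w = 0.
Proof.
rewrite /slope residualE RintegralZl//; last exact: L2_integrable (L2_lin X_cov _).
by rewrite (Rintegral_lin0 X_mean X_cov) mulr0.
Qed.

Lemma Rintegral_slope2 u :
  \int[P]_w (slope u w ^+ 2) = u ^+ 2 * (r 0 - r u^-1 ^+ 2 / r 0).
Proof.
rewrite /slope; under eq_Rintegral do rewrite exprMn (residual1E X_cov).
rewrite RintegralZl//; last first.
  by under eq_fun do rewrite -(residual1E X_cov); exact: (L2_residual X_cov _).2.
congr (_ * _).
have := Rintegral_sqrD 1 (- (r u^-1 / r 0)) (L2_X X_cov u^-1) (L2_X X_cov 0).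
under eq_Rintegral do rewrite mul1r mulNr.
move=> ->; rewrite !Rintegral_X2 (Rintegral_XX X_cov) subr0.
by field; rewrite gt_eqF.
Qed.

Definition curvature := sg2 / (2 * r 0).
Local Notation c := curvature.

(** The first estimate gives the quadratic term of the parabola. The second allows r(t/u) / r(0) to
    be replaced by 1 in front of an overshoot x with |x| <= B. *)
Lemma spectral_remainder_small (K B e : R) : 0 < K -> 0 <= B -> 0 < e ->
  \forall u \near +oo, forall t, `|t| <= K ->
    `|u ^+ 2 * (r (t / u) / r 0 - 1) + c * t ^+ 2| <= e /\
    B * `|r (t / u) / r 0 - 1| <= e.
Proof.
move=> K0 B0 e0.
(* With truncated moment at most e / k, the remainder of [spectral_quadratic] times u^2 / r(0) is at
   most e t^2 / K^2. *)
pose k := 2 * K ^+ 2 / r 0.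
have K20 : 0 < K ^+ 2 by rewrite exprn_gt0.
have k0 : 0 < k by rewrite divr_gt0// mulr_gt0.
have ek0 : 0 < e / k by rewrite divr_gt0.
have [del del0 mdel] := truncated_moment_small mom2 ek0.
have c0 : 0 <= c.
  by rewrite divr_ge0 ?mulr_ge0 ?(ltW r0_gt0)// Rintegral_ge0// => x _; exact: sqr_ge0.
near=> u.
have u1 : 1 <= u by near: u; exact: nbhs_pinfty_ge.
have u0 : 0 < u by lra.
have uK : K / del <= u by near: u; apply: nbhs_pinfty_ge; exact: num_real.
have uB : B * (c * K ^+ 2 + e) / e <= u.
  by near: u; apply: nbhs_pinfty_ge; exact: num_real.
move=> t tK; set q := r (t / u) / r 0.
have tu : `|t / u| = `|t| / u by rewrite normrM normfV (gtr0_norm u0).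
have mt : truncated_moment mu `|t / u| <= e / k.
  apply: mdel; rewrite normr_ge0/= tu.
  rewrite (@le_trans _ _ (K / u)) ?ler_pM2r ?invr_gt0//.
  by rewrite ler_pdivrMr// mulrC -ler_pdivrMr.
have h : `|u ^+ 2 * (q - 1) + c * t ^+ 2| <= e.
  have -> : u ^+ 2 * (q - 1) + c * t ^+ 2 =
      - (u ^+ 2 / r 0 * (r 0 - r (t / u) - (t / u) ^+ 2 * sg2 / 2)).
    by rewrite /q /curvature; field; rewrite !gt_eqF.
  rewrite normrN normrM ger0_norm ?divr_ge0 ?sqr_ge0 ?(ltW r0_gt0)//.
  have := spectral_quadratic mom2 (t / u).
  have h1 : 2 * (t / u) ^+ 2 * truncated_moment mu `|t / u| <=
      2 * (t / u) ^+ 2 * (e / k).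
    by rewrite ler_wpM2l// mulr_ge0// sqr_ge0.
  move=> /le_trans/(_ h1) h2.
  have h3 : 0 <= u ^+ 2 / r 0 by rewrite divr_ge0 ?sqr_ge0 ?(ltW r0_gt0).
  have := ler_wpM2l h3 h2; move=> /le_trans; apply.
  have -> : u ^+ 2 / r 0 * (2 * (t / u) ^+ 2 * (e / k)) = (t ^+ 2 / K ^+ 2) * e.
    by rewrite /k; field; rewrite !gt_eqF.
  rewrite ler_piMl ?(ltW e0)// ler_pdivrMr// mul1r -real_normK ?num_real//.
  by rewrite lerXn2r ?nnegrE// ltW.
split => //.
have t2 : t ^+ 2 <= K ^+ 2.
  by rewrite -real_normK ?num_real// lerXn2r ?nnegrE// ltW.
have ct : c * t ^+ 2 <= c * K ^+ 2 by rewrite ler_wpM2l.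
have ct0 : 0 <= c * t ^+ 2 by rewrite mulr_ge0// sqr_ge0.
have h1 : u ^+ 2 * `|q - 1| <= c * K ^+ 2 + e.
  rewrite -[u ^+ 2]ger0_norm ?sqr_ge0// -normrM.
  by move: h; rewrite !ler_norml; lra.
have cK : 0 <= c * K ^+ 2 + e by lra.
have h2 : B * (c * K ^+ 2 + e) <= u ^+ 2 * e.
  rewrite ler_pdivrMr// in uB; rewrite (le_trans uB)// ler_wpM2r ?(ltW e0)//.
  by rewrite expr2 ler_peMl// ltW.
rewrite -(ler_pM2l (_ : 0 < u ^+ 2)) ?exprn_gt0//.
by rewrite (le_trans _ h2)// mulrCA ler_wpM2l.
Unshelve. all: end_near. Qed.

(** With q = r(1/u) / r(0) the variance is r(0) u^2 (1 - q)(1 + q), where u^2 (1 - q) tends to c and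
    1 + q to 2. *)
Lemma slope2_cvg : \int[P]_w (slope u w ^+ 2) @[u --> +oo] --> sg2.
Proof.
pose q u := r u^-1 / r 0.
have H e : 0 < e -> \forall u \near +oo,
    `|u ^+ 2 * (q u - 1) + c| <= e /\ `|q u - 1| <= e.
  move=> e0; have := spectral_remainder_small ltr01 ler01 e0.
  apply: filterS => u /(_ 1); rewrite normr1 lexx => /(_ isT).
  by rewrite !div1r expr1n mulr1 mul1r.
have qc : q u @[u --> +oo] --> (1 : R).
  apply/cvgrPdist_le => e e0; have := H e e0.
  by apply: filterS => u [_]; rewrite distrC.
have ac : u ^+ 2 * (1 - q u) @[u --> +oo] --> c.
  apply/cvgrPdist_le => e e0; have := H e e0.
  apply: filterS => u [h _].
  by rewrite (_ : c - _ = u ^+ 2 * (q u - 1) + c)//; ring.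
under eq_fun do rewrite Rintegral_slope2.
have -> : sg2 = r 0 * (c * (1 + 1)) by rewrite /curvature; field; rewrite gt_eqF.
have -> : (fun u => u ^+ 2 * (r 0 - r u^-1 ^+ 2 / r 0)) =
    (fun u => r 0 * ((u ^+ 2 * (1 - q u)) * (1 + q u))).
  by apply/funext => u; rewrite /q; field; rewrite gt_eqF.
apply: cvgM; first exact: cvg_cst.
by apply: cvgM => //; apply: cvgD => //; exact: cvg_cst.
Qed.

Definition slope_sd u := Num.sqrt (\int[P]_w (slope u w ^+ 2)).

Lemma slope_sd_cvg : slope_sd u @[u --> +oo] --> Num.sqrt sg2.
Proof.
exact: (@cvg_comp _ _ _ _ Num.sqrt _ _ _ slope2_cvg (@sqrt_continuous R sg2)).
Qed.

Lemma measurable_std_slope u : measurable_fun setT (fun w => (slope_sd u)^-1 * slope u w).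
Proof. by apply: measurable_funM => //; exact: (L2_slope u).1. Qed.

Definition std_slope u : {RV P >-> R} :=
  HB.pack (fun w => (slope_sd u)^-1 * slope u w)
    (isMeasurableFun.Build _ _ _ _ _ (measurable_std_slope u)).

Lemma std_slopeK u w : 0 < slope_sd u -> slope_sd u * std_slope u w = slope u w.
Proof. by move=> s0; rewrite /= mulrA divff ?mul1r// gt_eqF. Qed.

Lemma std_slope_independent u : independent (X 0) (std_slope u).
Proof.
apply: (@residual_independent _ _ _ _ _ _ X_mean X_gauss X_cov r0_gt0 [:: (1, u^-1)] _
  ((slope_sd u)^-1 * u)).
by apply/funext => w /=; rewrite mulrA.
Qed.

Lemma std_slope_law u : 0 < slope_sd u -> forall A, measurable A ->
  distribution P (std_slope u) A = gamma A.
Proof.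
move=> s0; apply: standard_gaussian_law.
- rewrite /= (_ : (fun w => _) = lin X [seq ((slope_sd u)^-1 * u * p.1, p.2) | p <-
    (- ((\int[P]_w (lin X [:: (1, u^-1)] w * X 0 w)) / r 0), 0) :: [:: (1, u^-1)]]).
    exact: gaussian_lin.
  apply/funext => w; rewrite /slope residualE /lin big_map mulrA big_distrr.
  by apply: eq_bigr => p _ /=; rewrite !mulrA.
- by apply: L2Z; exact: L2_slope.
- rewrite /= RintegralZl//; first by rewrite Rintegral_slope mulr0.
  exact: L2_integrable (L2_slope u).
- rewrite /=; under eq_Rintegral do rewrite exprMn.
  rewrite RintegralZl//; last exact: (L2_slope u).2.
  rewrite -[X in _ * X]sqr_sqrtr; last by apply: Rintegral_ge0 => w _; exact: sqr_ge0.
  by rewrite -/(slope_sd u) -exprMn mulVf ?expr1n// gt_eqF.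
Qed.

End slope.

Section width_approximation.
Context {R : realType} (mu : {finite_measure set R -> \bar R}).
Context d (Omega : measurableType d) (P : probability Omega R).
Variable X : R -> {RV P >-> R}.
Local Notation r := (spectral_cov mu).
Local Notation c := (curvature mu).
Local Notation slope := (slope mu X).
Local Notation deviation := (deviation mu X).
Hypothesis X_cov : forall s t : R,
  ('E_P[(fun w => X s w * X t w)%R] = (r (s - t))%:E)%E.
Hypothesis r0_gt0 : 0 < r 0.
Hypothesis c_gt0 : 0 < c.

Let c2_gt0 : 0 < 2 * c. Proof. by rewrite pmulr_rgt0. Qed.
Let c4_gt0 : 0 < 4 * c. Proof. by rewrite pmulr_rgt0. Qed.

Lemma rescaled_path u t w : u != 0 ->
  u * (X (t / u) w - u) =
  u * (X 0 w - u) * (r (t / u) / r 0) + t * slope u w +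
  u ^+ 2 * (r (t / u) / r 0 - 1) + deviation u^-1 t w.
Proof.
move=> u0; rewrite /deviation /slope invrK !(residual1E X_cov).
by field; rewrite gt_eqF.
Qed.

(* The distance between the two roots of [x + t v - c t^2], where [z = (x, v)]. *)
Definition limit_width (z : R * R) := Num.sqrt (z.2 ^+ 2 + 4 * c * z.1) / c.

(** K dominates the roots of all parabolas with x < n, |v| < n and x raised by eta <= 1. The error
    eta splits into eta / 4 for the factor of x, eta / 4 for the quadratic term and eta / 2 for the
    deviation. *)
Lemma tau_width_close (n : nat) eta K u w : 0 < u -> 0 < eta < n%:R^-1 -> eta <= 1 ->
  (n%:R + Num.sqrt (n%:R ^+ 2 + 4 * c * (n%:R + 1))) / (2 * c) <= K ->
  n%:R^-1 < u * (X 0 w - u) < n%:R -> `|slope u w| < n%:R ->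
  (forall t, `|t| <= K -> `|u ^+ 2 * (r (t / u) / r 0 - 1) + c * t ^+ 2| <= eta / 4 /\
     n%:R * `|r (t / u) / r 0 - 1| <= eta / 4) ->
  (forall t, `|t| <= K -> `|deviation u^-1 t w| <= eta / 2) ->
  exists2 y : R, (u%:E * (tau_plus X u w - tau_minus X u w))%E = y%:E &
    `|y - limit_width (u * (X 0 w - u), slope u w)| <= Num.sqrt (4 * c * eta) / c.
Proof.
move=> u0 /andP[eta0 etan] eta1 Kn; set x := u * (X 0 w - u); set v := slope u w.
move=> /andP[xn nx] vn Hr HD.
have n0 : (0 : R) <= n%:R by [].
rewrite tau_plusE tau_minusE.
apply: (@hit_width _ (fun t => X t w) u c x v eta K) => //.
- by rewrite (ltW eta0)/= (lt_trans etan).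
- apply: le_trans Kn; rewrite ler_pM2r ?invr_gt0//.
  apply: lerD; first exact: ltW.
  apply: ler_wsqrtr; apply: lerD.
    by rewrite -real_normK ?num_real// lerXn2r ?nnegrE// ltW.
  by rewrite ler_pM2l// lerD// ltW.
move=> t tK; rewrite rescaled_path ?gt_eqF// -/x -/v.
have [h1 h2] := Hr t tK; have h3 := HD t tK.
set q := r (t / u) / r 0 in h1 h2 *.
have h4 : `|x * (q - 1)| <= eta / 4.
  rewrite (le_trans _ h2)// normrM ler_wpM2r// ger0_norm; first exact: ltW.
  by apply: ltW; apply: lt_trans xn; exact: lt_trans eta0 etan.
have -> : x * q + t * v + u ^+ 2 * (q - 1) + deviation u^-1 t w - (x + t * v - c * t ^+ 2) =
  x * (q - 1) + (u ^+ 2 * (q - 1) + c * t ^+ 2) + deviation u^-1 t w by ring.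
apply: (le_trans (ler_normD _ _)).
by have := ler_normD (x * (q - 1)) (u ^+ 2 * (q - 1) + c * t ^+ 2); lra.
Qed.

Lemma limit_width_le (n : nat) z : 0 <= z.1 <= n%:R -> `|z.2| <= n%:R ->
  0 <= limit_width z <= Num.sqrt (n%:R ^+ 2 + 4 * c * n%:R) / c.
Proof.
move=> /andP[z0 zn] z2; rewrite divr_ge0 ?(ltW c_gt0)//=.
rewrite ler_pM2r ?invr_gt0//; apply: ler_wsqrtr; apply: lerD.
  by rewrite -(real_normK (num_real z.2))  lerXn2r ?nnegrE.
by rewrite ler_pM2l.
Qed.

Lemma measurable_limit_width : measurable_fun setT limit_width.
Proof.
apply: measurable_funM => //.
apply: (measurableT_comp (continuous_measurable_fun (@sqrt_continuous R))).
apply: measurable_funD; first by apply: measurable_funX; exact: measurable_snd.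
by apply: measurable_funM => //; exact: measurable_fst.
Qed.

Lemma continuous_limit_width1 v : continuous (fun x => limit_width (x, v)).
Proof.
move=> x; apply: cvgM; last exact: cvg_cst.
apply: (@cvg_comp _ _ _ (fun x => v ^+ 2 + 4 * c * x) Num.sqrt _ _ _ _
  (@sqrt_continuous R _)).
by apply: cvgD; [exact: cvg_cst|apply: cvgM; [exact: cvg_cst|exact: cvg_id]].
Qed.

Lemma continuous_limit_width2 x : continuous (fun v => limit_width (x, v)).
Proof.
move=> v; apply: cvgM; last exact: cvg_cst.
apply: (@cvg_comp _ _ _ (fun v => v ^+ 2 + 4 * c * x) Num.sqrt _ _ _ _
  (@sqrt_continuous R _)).
by apply: cvgD; [exact: exprn_continuous|exact: cvg_cst].
Qed.

End width_approximation.

Section extended_line.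
Context {R : realType}.

Lemma measurable_fun_ereal (f : \bar R -> R) :
  measurable_fun setT (f \o EFin) -> measurable_fun setT f.
Proof.
move=> mf _ Y mY; rewrite setTI.
exists ((f \o EFin) @^-1` Y); first by rewrite -[X in _ X]setTI; exact: mf.
exists (f @^-1` Y `&` [set -oo; +oo]%E).
  by apply/ps_inftyP => x [].
apply/seteqP; split => [x [[y Yy <-//]|[]//]|[x| |] Yx /=].
- by left; exists x.
- by right; split => //; right.
- by right; split => //; left.
Qed.

Lemma continuous_comp_EFin (f : \bar R -> R) : continuous f -> continuous (f \o EFin).
Proof. by move=> cf x A /(cf x%:E)/nbhs_EFin. Qed.

End extended_line.

Section comparison.
Context {R : realType} d (Omega : measurableType d) (P : probability Omega R)
  (X0 : {RV P >-> R}).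

(** On the exceedance event |g - k| <= e + 2 M (1 - chi) + 2 M 1_N holds pointwise: on N and where
    chi = 0 the trivial bound 2 M applies, elsewhere e. *)
Lemma cond_mean_dist_le u (g k chi : Omega -> R) (N : set Omega) (M e nu : R) :
  0 < fine (P (exceedance X0 u)) ->
  measurable_fun setT g -> measurable_fun setT k -> measurable_fun setT chi ->
  measurable N -> (P (N `&` exceedance X0 u) <= nu%:E * P (exceedance X0 u))%E ->
  (forall w, `|g w| <= M) -> (forall w, `|k w| <= M) -> (forall w, 0 <= chi w <= 1) ->
  0 <= e ->
  (forall w, u < X0 w -> ~ N w -> chi w != 0 -> `|g w - k w| <= e) ->
  `|cond_mean X0 u g - cond_mean X0 u k| <=
    e + 2 * M * (1 - cond_mean X0 u chi) + 2 * M * nu.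
Proof.
set B := exceedance X0 u; set p := fine (P B) => p0 mg mk mchi mN PN gM kM chi01 e0 H.
have mB : measurable B := measurable_exceedance X0 u.
have mI : measurable_fun setT (\1_B : Omega -> R) by exact: measurable_indic.
have mIN : measurable_fun setT (\1_(N `&` B) : Omega -> R).
  by apply: measurable_indic; exact: measurableI.
have PE : P B = p%:E by rewrite fineK// fin_num_measure.
have iI : \int[P]_w \1_B w = p.
  by rewrite /Rintegral integral_indic// setIT.
have iIN : \int[P]_w \1_(N `&` B) w <= nu * p.
  rewrite /Rintegral integral_indic//; last exact: measurableI.
  rewrite setIT -lee_fin fineK ?fin_num_measure//; last exact: measurableI.
  by rewrite EFinM -PE.
have ib (f : Omega -> R) L : measurable_fun setT f -> (forall w, `|f w| <= L) ->
    P.-integrable setT (EFin \o (fun w => \1_B w * f w)).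
  move=> mf fL; apply: (@le_bounded_integrable _ _ _ P _ L).
    exact: measurable_funM.
  move=> w; rewrite normrM -[leRHS]mul1r ler_pM// indicE.
  by case: (_ \in _); rewrite ?normr1 ?normr0.
have ig := ib _ _ mg gM; have ik := ib _ _ mk kM.
have ichi : P.-integrable setT (EFin \o (fun w => \1_B w * chi w)).
  by apply: (ib _ 1) => // w; have /andP[? ?] := chi01 w; rewrite ger0_norm.
have iI_ : P.-integrable setT (EFin \o (\1_B : Omega -> R)).
  apply: (@le_bounded_integrable _ _ _ P _ 1) => // w.
  by rewrite indicE; case: (_ \in _); rewrite ?normr1 ?normr0.
have iIN_ : P.-integrable setT (EFin \o (\1_(N `&` B) : Omega -> R)).
  apply: (@le_bounded_integrable _ _ _ P _ 1) => // w.
  by rewrite indicE; case: (_ \in _); rewrite ?normr1 ?normr0.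
have M0 w : 0 <= M := le_trans (normr_ge0 _) (gM w).
have iZ c (f : Omega -> R) : P.-integrable setT (EFin \o f) ->
    P.-integrable setT (EFin \o (fun w => c * f w)).
  by move=> h; have := integrableZl measurableT c h; exact: eq_integrable.
have iD (f h : Omega -> R) : P.-integrable setT (EFin \o f) ->
    P.-integrable setT (EFin \o h) -> P.-integrable setT (EFin \o (fun w => f w + h w)).
  by move=> hf hh; have := integrableD measurableT hf hh; exact: eq_integrable.
rewrite /cond_mean -/B -/p -mulrBl normrM (@ger0_norm _ p^-1) ?invr_ge0 ?(ltW p0)//.
rewrite ler_pdivrMr//.
rewrite -RintegralB//.
have i1 := iD _ _ ig (iZ (-1) _ ik).
apply: (le_trans (le_normr_Rintegral _ _)) => //.
  by apply: eq_integrable i1 => // w _ /=; rewrite mulN1r.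
have -> : (e + 2 * M * (1 - (\int[P]_w (\1_B w * chi w)) / p) + 2 * M * nu) * p =
  (e + 2 * M) * p + - (2 * M) * \int[P]_w (\1_B w * chi w) + 2 * M * (nu * p).
  by field; rewrite gt_eqF.
have M20 : 0 <= 2 * M by rewrite mulr_ge0//; exact: (M0 point).
apply: (@le_trans _ _ ((e + 2 * M) * p + - (2 * M) * \int[P]_w (\1_B w * chi w) +
    2 * M * \int[P]_w \1_(N `&` B) w)); last by rewrite lerD2l ler_wpM2l.
have ia := iZ (e + 2 * M) _ iI_; have ibb := iZ (- (2 * M)) _ ichi.
have ic := iZ (2 * M) _ iIN_; have iab := iD _ _ ia ibb.
rewrite -iI -!RintegralZl// -RintegralD// -RintegralD//.
apply: le_Rintegral => //.
- by apply: integrable_norm; apply: eq_integrable i1 => // w _ /=; rewrite mulN1r.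
- exact: iD.
move=> w _ /=; rewrite -mulrBr normrM.
have := gM w; have := kM w; have := chi01 w; have := H w; have := M0 w.
rewrite !indicE in_setI; case: (boolP (w \in B)) => wB; last first.
  by rewrite andbF !(mulr0, mul0r, normr0, addr0).
have {}wB : u < X0 w by have := set_mem wB.
rewrite andbT normr1 !mul1r !mulr1.
move=> {}M0 {}H /andP[c0 c1] km gm.
have gk := ler_normB (g w) (k w).
have [/set_mem wN|/negP wN] := boolP (w \in N).
  rewrite mulr1; have : 2 * M * chi w <= 2 * M by rewrite ler_piMr.
  by lra.
rewrite mulr0 addr0; have [->|ch0] := eqVneq (chi w) 0; first by lra.
have : 2 * M * chi w <= 2 * M by rewrite ler_piMr.
have : `|g w - k w| <= e by apply: H => // wN'; apply: wN; exact: mem_set.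
by lra.
Qed.

End comparison.

Section cutoff_limit.
Context {R : realType} d (Omega : measurableType d) (P : probability Omega R).

Lemma cutoff_eq0 n (z : R * R) : z.1 <= 0 -> cutoff n z = 0.
Proof.
move=> z0; apply/eqP/negPn/negP => /cutoff_neq0[n0 /andP[z1 _] _].
by have : 0 < z.1; [apply: lt_trans z1; rewrite invr_gt0 ltr0n|rewrite ltNge z0].
Qed.

(** The cutoffs converge to 1 where T > 0 and vanish where T <= 0, so the limit is P(T > 0), which
    is 1 for an exponential law. *)
Lemma cutoff_mean_cvg (T Z : {RV P >-> R}) (rho sg : R) : 0 < rho ->
  same_law (distribution P T) (exponential_prob 1) ->
  \int[P]_w cutoff n (rho * T w, sg * Z w) @[n --> \oo] --> (1 : R).
Proof.
move=> rho0 TE.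
have T0 : P (T @^-1` `]0, +oo[) = 1%E.
  pose f (x : R) : \bar R := (\1_(`]-oo, (0 : R)]%classic) x)%:E.
  have mf : measurable_fun setT f.
    by apply/measurable_EFinP; exact: measurable_indic.
  have f0 (x : R) : (0 <= f x)%E by rewrite lee_fin.
  have mE : measurable_fun `](0 : R), +oo[%classic (fun x : R => f x * (expR (- x))%:E)%E.
    apply: measurable_funTS; apply: emeasurable_funM => //.
    by apply/measurable_EFinP; apply: measurableT_comp => //; exact: measurable_funN.
  have := ge0_integral_exponential TE mf f0.
  rewrite -integral_itv_obnd_cbnd// [X in _ = X -> _]integral0_eq; last first.
    move=> x /=; rewrite in_itv/= andbT => x0.
    by rewrite /f indicE memNset ?mul0e//= in_itv/= leNgt x0.
  rewrite integral_indic// setIT /distribution /pushforward => PT.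
  have -> : T @^-1` `]0, +oo[%classic = ~` (T @^-1` `]-oo, (0 : R)]).
    by apply/seteqP; split => w /=; rewrite !in_itv/= andbT ltNge => /negP.
  rewrite probability_setC; last first.
    by rewrite -[X in _ X]setTI; exact: measurable_funPT.
  by rewrite [X in (_ - X)%E](_ : _ = 0%E) ?sube0.
have -> : (1 : R) = \int[P]_w \1_(T @^-1` `](0 : R), +oo[) w.
  rewrite /Rintegral integral_indic//; first by rewrite setIT [X in fine X]T0.
  by rewrite -[X in _ X]setTI; exact: measurable_funPT.
apply: (@dominated_cvg_Rintegral _ _ _ P _ _ (cst 1)).
- move=> n; apply: (measurableT_comp (measurable_cutoff n)).
  by apply: measurable_fun_pair; apply: measurable_funM.
- move=> w; rewrite indicE; case: (boolP (w \in _)) => [/set_mem/=|/negP].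
    rewrite in_itv/= andbT => Tw.
    by apply: cutoff_cvg; rewrite mulr_gt0.
  move=> Tw; have {}Tw : T w <= 0.
    by rewrite leNgt; apply/negP => h; apply/Tw/mem_set; rewrite /= in_itv/= h.
  under eq_fun do rewrite cutoff_eq0 ?pmulr_rle0//.
  exact: cvg_cst.
- by move=> n w; have /andP[? ?] := cutoff_ge0_le1 n (rho * T w, sg * Z w); rewrite ger0_norm.
- apply: (@le_bounded_integrable _ _ _ P _ 1) => // w; by rewrite normr1.
Qed.

End cutoff_limit.

Section conditional_width.
Context {R : realType} (mu : {finite_measure set R -> \bar R}).
Context d (Omega : measurableType d) (P : probability Omega R).
Variable X : R -> {RV P >-> R}.
Local Notation r := (spectral_cov mu).
Local Notation sg2 := (second_moment mu).
Local Notation c := (curvature mu).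
Local Notation slope := (slope mu X).
Local Notation deviation := (deviation mu X).
Hypotheses (X_mean : forall t : R, ('E_P[X t] = 0)%E)
  (X_gauss : gaussian_process X)
  (X_cov : forall s t : R, ('E_P[(fun w => X s w * X t w)%R] = (r (s - t))%:E)%E).
Hypothesis r0_gt0 : 0 < r 0.
Hypothesis mom2 : L2 mu (@idfun R).
Hypothesis sg2_gt0 : 0 < sg2.
Hypothesis X_cont : continuous_paths X.
Local Notation B u := (exceedance (X 0) u).

Let c_gt0 : 0 < c. Proof. by rewrite divr_gt0// mulr_gt0. Qed.

Lemma deviation_event (K eta nu : R) : 0 < K -> 0 < eta -> 0 < nu ->
  \forall u \near +oo, exists N : set Omega,
    [/\ measurable N, (P (N `&` B u) <= nu%:E * P (B u))%E &
    forall w, ~ N w -> forall t, `|t| <= K -> `|deviation u^-1 t w| <= eta].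
Proof.
move=> K0 eta0 nu0.
(* Makes kappa K / eta equal to nu / 2: one half for the times in [0, K], one for those in
   [-K, 0]. *)
pose kappa := nu * eta / (2 * K).
have kappa0 : 0 < kappa by rewrite divr_gt0 ?mulr_gt0.
have k8 : 0 < kappa ^+ 2 / 8 by rewrite divr_gt0// exprn_gt0.
have [del del0 mdel] := truncated_moment_small mom2 k8.
near=> u.
have u0 : 0 < u by near: u; exact: nbhs_pinfty_gt.
have uK : (K + 1) / del <= u by near: u; apply: nbhs_pinfty_ge; exact: num_real.
have h0 : 0 < u^-1 by rewrite invr_gt0.
have mk : 8 * truncated_moment mu ((K + 1) * u^-1) <= kappa ^+ 2.
  rewrite mulrC -ler_pdivlMr//; apply: mdel.
  apply/andP; split; first by rewrite mulr_ge0// ltW// addr_gt0.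
  by rewrite ler_pdivrMr// mulrC -ler_pdivrMr.
have K_ : K != 0 by rewrite gt_eqF.
have KN : - K != 0 by rewrite oppr_eq0.
have mk1 : 8 * truncated_moment mu ((`|K| + 1) * u^-1) <= kappa ^+ 2 by rewrite gtr0_norm.
have mk2 : 8 * truncated_moment mu ((`|- K| + 1) * u^-1) <= kappa ^+ 2 by rewrite normrN.
have H0 := deviation_sup_le X_mean X_gauss X_cov r0_gt0 mom2 X_cont u.
have [N1 [mN1 PN1 H1]] := H0 _ _ _ _ h0 K_ kappa0 eta0 mk1.
have [N2 [mN2 PN2 H2]] := H0 _ _ _ _ h0 KN kappa0 eta0 mk2.
exists (N1 `|` N2); split; first exact: measurableU.
  have mB := measurable_exceedance (X 0) u.
  rewrite setIUl; apply: (le_trans (measureU2 _ _ _)); [exact: measurableI..|].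
  apply: (le_trans (leeD PN1 PN2)).
  have q0 : (0 <= (kappa * K / eta)%:E)%E.
    by rewrite lee_fin ltW// divr_gt0// mulr_gt0.
  rewrite normrN (gtr0_norm K0) -ge0_muleDl// -EFinD (_ : kappa * K / eta + kappa * K / eta = nu)//.
  by rewrite /kappa; field; rewrite !gt_eqF.
move=> w Nw t tK.
have [N1w N2w] : ~ N1 w /\ ~ N2 w by split => ?; apply: Nw; [left|right].
have [t0|t0] := leP 0 t.
- have -> : t = K * (t / K) by field.
  apply: H1 => //; rewrite ger0_norm// in tK.
  by rewrite divr_ge0 ?(ltW K0)//= ler_pdivrMr// mul1r.
- have -> : t = - K * (- t / K) by field.
  apply: H2 => //; rewrite ltr0_norm// in tK.
  by rewrite divr_ge0 ?oppr_ge0 ?(ltW K0) ?(ltW t0)//= ler_pdivrMr// mul1r.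
Unshelve. all: end_near. Qed.

Context d' (Omega' : measurableType d') (P' : probability Omega' R)
  (Z T : {RV P' >-> R}).
Hypotheses (ZE : forall A, measurable A -> distribution P' Z A = normal_law 0 1 A)
  (TE : same_law (distribution P' T) (exponential_prob 1))
  (TZ : independent T Z).
Local Notation level u w := (u * (X 0 w - u)).
Local Notation limit w := (r 0 * T w, Num.sqrt sg2 * Z w).

Let sd_cvg := slope_sd_cvg X_cov r0_gt0 mom2.

Let slope_sd_gt0 : exists U0, forall u, U0 < u -> 0 < slope_sd mu X u.
Proof.
have sg0 : 0 < Num.sqrt sg2 by rewrite sqrtr_gt0.
by have [U0 [_ HU0]] := cvgr_gt _ sd_cvg _ sg0; exists U0.
Qed.

Lemma exceedance_pos : \forall u \near +oo, 0 < fine (P (B u)).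
Proof.
have [U0 HU0] := slope_sd_gt0.
exact: (exceedance_prob_gt0 r0_gt0 (level_law X_mean X_gauss X_cov)
  (fun u hu => std_slope_law X_mean X_gauss X_cov (HU0 u hu))
  (fun u hu => std_slope_independent X_mean X_gauss X_cov r0_gt0 u) sd_cvg ZE TE TZ).
Qed.

Let conditional_limit (h : R * R -> R) (M : R) : measurable_fun setT h ->
  (forall z, `|h z| <= M) -> (forall x, continuous (fun v => h (x, v))) ->
  (forall v, continuous (fun x => h (x, v))) ->
  cond_mean (X 0) u (fun w => h (level u w, slope u w)) @[u --> +oo] -->
  \int[P']_w h (limit w).
Proof.
move=> mh hM hc2 hc1.
have [U0 HU0] := slope_sd_gt0.
have := cond_mean_cvg r0_gt0 (level_law X_mean X_gauss X_cov)
  (fun u hu => std_slope_law X_mean X_gauss X_cov (HU0 u hu))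
  (fun u hu => std_slope_independent X_mean X_gauss X_cov r0_gt0 u) sd_cvg
  ZE TE TZ mh hM hc2 hc1.
apply: cvg_trans; apply: near_eq_cvg; exists U0; split; first exact: num_real.
move=> u /HU0 su; congr cond_mean; apply/funext => w.
by rewrite std_slopeK.
Qed.

Lemma width_cond_mean_cvg (f : \bar R -> R) (M : R) : continuous f -> (forall x, `|f x| <= M) ->
  cond_mean (X 0) u (fun w => f (u%:E * (tau_plus X u w - tau_minus X u w))%E)
    @[u --> +oo] -->
  \int[P']_w f (limit_width mu (limit w))%:E.
Proof.
move=> cf fM0.
pose M1 := `|M| + 1.
have M10 : 0 < M1 by rewrite ltr_wpDl.
have fM x : `|f x| <= M1 by rewrite (le_trans (fM0 x))// (le_trans (ler_norm M))// lerDl.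
have cfE := continuous_comp_EFin cf.
have mfE : measurable_fun setT (f \o EFin) by exact: continuous_measurable_fun.
pose F (z : R * R) := f (limit_width mu z)%:E.
have mF : measurable_fun setT F.
  exact: (measurableT_comp mfE (measurable_limit_width mu)).
have H1 : cond_mean (X 0) u (fun w => F (level u w, slope u w)) @[u --> +oo] -->
    \int[P']_w F (limit w).
  apply: (conditional_limit mF (fun z => fM _)).
  - move=> x v; exact: (@continuous_comp _ _ _ (fun v => limit_width mu (x, v))
      (f \o EFin) v (@continuous_limit_width2 R mu x v) (cfE _)).
  - move=> v x; exact: (@continuous_comp _ _ _ (fun x => limit_width mu (x, v))
      (f \o EFin) x (@continuous_limit_width1 R mu v x) (cfE _)).
pose g u w := f (u%:E * (tau_plus X u w - tau_minus X u w))%E.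
pose k u w := F (level u w, slope u w).
apply/cvgrPdist_le => e e0.
have e40 : 0 < e / 4 by rewrite divr_gt0.
(* The budget e is split in four: the convergence of the parabola width, uniform continuity of f,
   the mass lost by the cutoff and the exceptional event N. The last two cost at most 2 M1 nu = e /
   4 each. *)
pose nu := e / (8 * M1).
have nu0 : 0 < nu by rewrite divr_gt0// mulr_gt0.
have nu20 : 0 < nu / 2 by rewrite divr_gt0.
(* The cutoff is chosen on the limit law and transferred to large u by the convergence [H2], so no
   separate tightness estimate is made. *)
have [n [n0 Hn]] : exists n : nat, (0 < n)%N /\
    `|1 - \int[P']_w cutoff n (limit w)| <= nu / 2.
  have /cvgrPdist_le/(_ _ nu20) h := cutoff_mean_cvg Z (Num.sqrt sg2) r0_gt0 TE.
  near \oo => n; exists n; split; near: n; first exact: nbhs_infty_gt.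
  exact: h.
have nR : (0 : R) < n%:R by rewrite ltr0n.
have cut1 (z : R * R) : `|cutoff n z| <= 1 by have /andP[? ?] := cutoff_ge0_le1 n z; rewrite ger0_norm.
have H2 := conditional_limit (@measurable_cutoff R n) cut1
  (@continuous_cutoff2 R n) (@continuous_cutoff1 R n).
have [del del0 Hdel] := uniform_continuity_itv 0
  (Num.sqrt (n%:R ^+ 2 + 4 * c * n%:R) / c) cfE e40.
(* The first term puts eta below the overshoot on the support of the cutoff; the second is the value
   for which sqrt(4 c eta) / c equals del. *)
pose eta := Num.min (n%:R^-1 / 2) (c * del ^+ 2 / 4).
have eta0 : 0 < eta.
  rewrite lt_min; apply/andP; split; first by rewrite divr_gt0// invr_gt0.
  by apply: divr_gt0 => //; apply: mulr_gt0 => //; exact: exprn_gt0.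
have eta1 : eta <= n%:R^-1 / 2 by rewrite ge_min lexx.
have eta2 : eta <= c * del ^+ 2 / 4 by rewrite ge_min lexx orbT.
have eta_n : eta < n%:R^-1.
  by rewrite (le_lt_trans eta1)// ltr_pdivrMr// ltr_pMr ?invr_gt0// ltr1n.
have eta_1 : eta <= 1.
  rewrite (le_trans (ltW eta_n))// invf_le1//.
  by rewrite ler1n.
have eta_del : Num.sqrt (4 * c * eta) / c <= del.
  have dc : 0 <= del * c by apply: mulr_ge0; exact: ltW.
  rewrite ler_pdivrMr// -(ger0_norm dc) -sqrtr_sqr.
  apply: ler_wsqrtr.
  have -> : (del * c) ^+ 2 = 4 * c * (c * del ^+ 2 / 4) by field.
  by rewrite ler_pM2l// pmulr_rgt0.
pose K := (n%:R + Num.sqrt (n%:R ^+ 2 + 4 * c * (n%:R + 1))) / (2 * c).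
have K0 : 0 < K.
  rewrite divr_gt0//; first by rewrite ltr_pwDl// sqrtr_ge0.
  by rewrite pmulr_rgt0.
have eta20 : 0 < eta / 2 by rewrite divr_gt0.
have eta40 : 0 < eta / 4 by rewrite divr_gt0.
pose chi u w := cutoff n (level u w, slope u w).
near=> u.
have u0 : 0 < u by near: u; exact: nbhs_pinfty_gt.
have [N [mN PN HN]] : exists N : set Omega,
    [/\ measurable N, (P (N `&` B u) <= nu%:E * P (B u))%E &
    forall w, ~ N w -> forall t, `|t| <= K -> `|deviation u^-1 t w| <= eta / 2].
  by near: u; exact: deviation_event.
have Hr : forall t, `|t| <= K ->
    `|u ^+ 2 * (r (t / u) / r 0 - 1) + c * t ^+ 2| <= eta / 4 /\
    n%:R * `|r (t / u) / r 0 - 1| <= eta / 4.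
  by near: u; apply: spectral_remainder_small.
have Hk : `|\int[P']_w F (limit w) - cond_mean (X 0) u (k u)| <= e / 4.
  by near: u; move/cvgrPdist_le: H1 => /(_ _ e40).
have Hchi : `|\int[P']_w cutoff n (limit w) - cond_mean (X 0) u (chi u)| <= nu / 2.
  by near: u; move/cvgrPdist_le: H2 => /(_ _ nu20).
have p0 : 0 < fine (P (B u)) by near: u; exact: exceedance_pos.
have mls : measurable_fun setT (fun w => (level u w, slope u w)).
  apply: measurable_fun_pair.
    by apply: measurable_funM => //; exact: measurable_funB.
  exact: (L2_slope X_cov u).1.
have mg : measurable_fun setT (g u).
  apply: (measurableT_comp (measurable_fun_ereal mfE)).
  exact: measurable_tau_width.
have mk : measurable_fun setT (k u) by exact: (measurableT_comp mF).
have mchi : measurable_fun setT (chi u) by exact: (measurableT_comp (measurable_cutoff n)).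
have := @cond_mean_dist_le _ _ _ _ (X 0) u (g u) (k u) (chi u) N M1 (e / 4) nu p0 mg mk mchi mN PN
  (fun w => fM _) (fun w => fM _) (fun w => cutoff_ge0_le1 n _) (ltW e40).
have hgk w : u < X 0 w -> ~ N w -> chi u w != 0 -> `|g u w - k u w| <= e / 4.
  move=> _ /HN Nw /cutoff_neq0[_ /= xn vn].
  have [y yE yl] := tau_width_close X_cov r0_gt0 c_gt0 u0 (introT andP (conj eta0 eta_n))
    eta_1 (lexx K) xn vn Hr Nw.
  rewrite /g yE /k /F; apply: Hdel; last exact: le_trans yl eta_del.
  move/andP: xn => [xn nx].
  apply: limit_width_le => //=; last exact: ltW.
  by rewrite (ltW nx) andbT ltW// (lt_trans _ xn)// invr_gt0.
move=> /(_ hgk) Hgk.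
have -> : \int[P']_w F (limit w) - cond_mean (X 0) u (g u) =
  (\int[P']_w F (limit w) - cond_mean (X 0) u (k u)) -
  (cond_mean (X 0) u (g u) - cond_mean (X 0) u (k u)) by ring.
apply: (le_trans (ler_normB _ _)).
have nuM : 2 * M1 * nu = e / 4 by rewrite /nu; field; rewrite gt_eqF.
have chi_nu : 1 - cond_mean (X 0) u (chi u) <= nu.
  by move: Hn Hchi; rewrite !ler_norml; lra.
have : 2 * M1 * (1 - cond_mean (X 0) u (chi u)) <= 2 * M1 * nu.
  by rewrite ler_wpM2l// mulr_ge0// ltW.
by lra.
Unshelve. all: end_near. Qed.

End conditional_width.

Theorem theorem3p1 (R : realType)
  (mu : {finite_measure set R -> \bar R})
  (mu_sym : symmetric_measure mu)
  (mu_pos : (0 < mu [set: R])%E)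
  (mu_mom2 : (\int[mu]_x (x ^+ 2)%:E < +oo)%E)
  (mu_nontriv : (0 < mu (~` [set 0%R]))%E)
  (r : R -> R) (rE : forall t : R, (r t)%:C = fourier mu t)
  (r_holder : exists2 eps : R, 0 < eps &
     exists C : R, forall t : R, `|r t - r 0| <= C * `|t| `^ eps)
  (d : measure_display) (Omega : measurableType d) (P : probability Omega R)
  (X : R -> {RV P >-> R})
  (X_mean : forall t : R, ('E_P[X t] = 0)%E)
  (X_stat : stationary X)
  (X_gauss : gaussian_process X)
  (X_cont : continuous_paths X)
  (X_cov : forall s t : R,
     ('E_P[(fun w => X s w * X t w)%R] = (r (s - t))%:E)%E)
  (d' : measure_display) (Omega' : measurableType d')
  (P' : probability Omega' R) (Z Tstar : {RV P' >-> R})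
  (Z_normal : same_law (distribution P' Z) (normal_prob 0 1))
  (Tstar_exp : same_law (distribution P' Tstar) (exponential_prob 1))
  (ZT_indep : independent Z Tstar) :
  cvg_weakly +oo
    (fun u : R =>
       pushforward (conditional P [set w | u < X 0 w])
         (fun w => (u%:E * (tau_plus X u w - tau_minus X u w))%E))
    (pushforward P'
       (fun w => (2 * (r 0 / Num.sqrt (- derive1n 2 r 0)) *
                  Num.sqrt (Z w ^+ 2 + 2 * Tstar w))%:E)).
Proof.
have rS := fourier_spectral_cov rE; subst r => {rE r_holder mu_sym X_stat}.
have mom2 := L2_idfun mu_mom2.
have r0_gt0 := spectral_cov0_gt0 mu_pos.
have sg2_gt0 := second_moment_gt0 mom2 mu_nontriv.
have ZE A : measurable A -> distribution P' Z A = normal_law 0 1 A by exact: Z_normal.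
have TZ : independent Tstar Z.
  by move=> A B mA mB; rewrite [X in P' X]setIC (ZT_indep B A mB mA) muleC.
move=> f cf fb.
have [M fM] : exists M : R, forall x, `|f x| <= M.
  move: fb => [M0 [_ /(_ (M0 + 1))]]; rewrite ltrDl ltr01 => /(_ isT) h.
  by exists (M0 + 1) => x; exact: h.
have mf : measurable_fun setT f.
  by apply: measurable_fun_ereal; apply: continuous_measurable_fun; exact: continuous_comp_EFin.
set G := fun w => (_ * _)%:E.
have GE w : G w = (limit_width mu (spectral_cov mu 0 * Tstar w,
    Num.sqrt (second_moment mu) * Z w))%:E.
  rewrite /G /limit_width derive2_spectral// opprK; congr EFin => /=.
  set sg2 := second_moment mu in sg2_gt0 *; set r0 := spectral_cov mu 0 in r0_gt0 *.
  have sg0 : 0 < Num.sqrt sg2 by rewrite sqrtr_gt0.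
  have sgE := sqr_sqrtr (ltW sg2_gt0); set sg := Num.sqrt sg2 in sg0 sgE *.
  rewrite /curvature -/sg2 -/r0 exprMn sgE.
  have -> : sg2 * Z w ^+ 2 + 4 * (sg2 / (2 * r0)) * (r0 * Tstar w) =
      sg2 * (Z w ^+ 2 + 2 * Tstar w) by field; rewrite gt_eqF.
  rewrite sqrtrM ?(ltW sg2_gt0)// -/sg; set q := Num.sqrt (_ + _).
  by rewrite -[in RHS]sgE; field; rewrite !gt_eqF.
have mlim : measurable_fun setT (fun w => limit_width mu (spectral_cov mu 0 * Tstar w,
    Num.sqrt (second_moment mu) * Z w)).
  apply: (measurableT_comp (measurable_limit_width mu)).
  by apply: measurable_fun_pair; exact: measurable_funM.
have mG : measurable_fun setT G.
  by rewrite (funext GE); exact/measurable_EFinP.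
have -> : (\int[pushforward P' G]_x (f x)%:E)%E = (\int[P']_w f (G w))%:E.
  have ifG : P'.-integrable setT (EFin \o (f \o G)).
    apply: (@le_bounded_integrable _ _ _ P' _ M); first exact: (measurableT_comp mf).
    by move=> w; exact: fM.
  rewrite (integral_pushforward mG _ ifG measurableT) ?preimage_setT//.
    by rewrite -[LHS]fineK//; exact: integrable_fin_num.
  exact/measurable_EFinP.
have H := width_cond_mean_cvg X_mean X_gauss X_cov r0_gt0 mom2 sg2_gt0 X_cont ZE Tstar_exp TZ cf fM.
rewrite (@eq_Rintegral _ _ _ P' _ (fun w => f (limit_width mu (spectral_cov mu 0 * Tstar w,
    Num.sqrt (second_moment mu) * Z w))%:E)); last by move=> w _; rewrite GE.
have {}H : (cond_mean (X 0) u (fun w => f (u%:E * (tau_plus X u w - tau_minus X u w))%E))%:E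
    @[u --> +oo] --> (\int[P']_w f (limit_width mu (spectral_cov mu 0 * Tstar w,
      Num.sqrt (second_moment mu) * Z w))%:E)%:E.
  by apply: cvg_EFin; [exact: nearW|exact: H].
apply: cvg_trans H; apply: near_eq_cvg; near=> u.
have p0 : 0 < fine (P (exceedance (X 0) u)).
  near: u.
  exact: (exceedance_pos X_mean X_gauss X_cov r0_gt0 mom2 sg2_gt0 ZE Tstar_exp TZ).
rewrite (integral_conditional _ p0 _ mf fM)//.
- exact: measurable_exceedance.
- exact: measurable_tau_width.
Unshelve. all: end_near. Qed.
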